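(* Let $N\geq 5$ and let $(M,g)$ be an $N$-dimensional Riemannian model with pole $o$ and metric $ds^2=dr^2+\psi^2(r)\,d\omega^2$, where $\psi$ is a $C^\infty$ nonnegative function on $[0,+\infty)$, positive on $(0,+\infty)$, with $\psi'(0)=1$, $\psi^{(2k)}(0)=0$ for all $k\geq0$, and such that for all $r>0$: $K_{\pi,r}^{rad}\leq -1$ and $K_{\pi,r}^{rad}\geq H_{\pi,r}^{tan}$. Then for all $u\in C_c^\infty(M)$, $$\int_M(\Delta_g u)^2dv_g-\Big(\frac{N-1}{2}\Big)^2\int_M|\nabla_g u|^2dv_g\geq\frac14\int_M\frac{|\nabla_g u|^2}{r^2}dv_g+\frac{N^2-1}{4}\int_M\frac{|\nabla_g u|^2}{\psi^2}dv_g.$$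
   Context: $d\omega^2$ is the standard metric on $\mathbb{S}^{N-1}$, $r$ the geodesic distance from $o$, $dv_g$ the Riemannian volume, $\nabla_g$ and $\Delta_g$ the Riemannian gradient and Laplace–Beltrami operator, $K_{\pi,r}^{rad}=-\frac{\psi''}{\psi}$, $H_{\pi,r}^{tan}=-\frac{(\psi')^2-1}{\psi^2}$. *)

(* Defs.v *)
From HB Require Import structures.
From mathcomp Require Import all_boot all_order all_algebra.
From mathcomp Require Import all_classical all_reals all_analysis.
Set Implicit Arguments. Unset Strict Implicit. Unset Printing Implicit Defensive.
Import Order.TTheory GRing.Theory Num.Theory.
Import numFieldNormedType.Exports.
Local Open Scope classical_set_scope.
Local Open Scope ring_scope.

Section Defs.
Variables (R : realType) (N : nat).
Notation V := 'rV[R]_N.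

Definition evec (i : 'I_N) : V := delta_mx 0 i.

Definition pder (i : 'I_N) (f : V -> R) : V -> R := fun x => derive f x (evec i).

Definition pder_seq (l : seq 'I_N) (f : V -> R) : V -> R := foldr pder f l.

Definition smooth (f : V -> R) : Prop :=
  forall l : seq 'I_N, continuous (pder_seq l f) /\
    forall (i : 'I_N) (x : V), derivable (pder_seq l f) x (evec i).

Definition compact_support (f : V -> R) : Prop :=
  exists Rad : R, forall x : V, Rad < `|x| -> f x = 0.

Definition Cc_infty (f : V -> R) : Prop := smooth f /\ compact_support f.

(* Euclidean norm = geodesic distance r from the pole o = 0 *)
Definition geod_r (x : V) : R := Num.sqrt (\sum_i x 0 i ^+ 2).

(* The model metric ds^2 = dr^2 + psi(r)^2 dω^2 written in the global
   (normal) Cartesian chart centred at the pole o = 0. *)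
Definition model_metric (psi : R -> R) (x : V) : 'M[R]_N :=
  \matrix_(i, j)
    (if x == 0 then (i == j)%:R
     else x 0 i * x 0 j / geod_r x ^+ 2
          + psi (geod_r x) ^+ 2 / geod_r x ^+ 2 * ((i == j)%:R - x 0 i * x 0 j / geod_r x ^+ 2)).

Definition inv_metric (psi : R -> R) (x : V) : 'M[R]_N := invmx (model_metric psi x).

Definition vol_density (psi : R -> R) (x : V) : R := Num.sqrt (\det (model_metric psi x)).

Definition grad_norm2 (psi : R -> R) (u : V -> R) (x : V) : R :=
  \sum_i \sum_j inv_metric psi x i j * pder i u x * pder j u x.

Definition lap_g (psi : R -> R) (u : V -> R) (x : V) : R :=
  (vol_density psi x)^-1 *
  \sum_i pder i (fun y => vol_density psi y * \sum_j inv_metric psi y i j * pder j u y) x.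

Definition upd (x : V) (i : nat) (t : R) : V :=
  \row_k (if (k : nat) == i then t else x 0 k).

Fixpoint iint (n : nat) (f : V -> \bar R) (x : V) : \bar R :=
  match n with
  | 0 => f x
  | n'.+1 => (\int[@lebesgue_measure R]_t iint n' f (upd x n' t))%E
  end.

(* Lebesgue integral over R^N (of nonnegative functions, Tonelli) *)
Definition intRN (f : V -> \bar R) : \bar R := iint N f 0.

Definition int_M (psi : R -> R) (f : V -> R) : \bar R :=
  intRN (fun x => (f x * vol_density psi x)%:E).

End Defs.

Definition K_rad {R : realType} (psi : R -> R) (r : R) : R :=
  - (derive1n 2 psi r / psi r).
Definition H_tan {R : realType} (psi : R -> R) (r : R) : R :=
  - ((derive1n 1 psi r ^+ 2 - 1) / psi r ^+ 2).

(* Main.v *)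
(* In polar terms write u_r for the radial derivative, T = |grad_S u|^2 and
   D = Delta_S u on the geodesic sphere, so that Delta_g u = L + D / psi^2 with
   L = u_rr + (N - 1) (psi' / psi) u_r, and |grad_g u|^2 = u_r^2 + T / psi^2.
   The inequality holds pointwise up to a divergence: there is a vector field F,
   quadratic in the derivatives of u, such that away from the pole
     (Delta_g u)^2 - ((N - 1) / 2)^2 |grad_g u|^2 - |grad_g u|^2 / (4 r^2)
       - (N^2 - 1) / 4 |grad_g u|^2 / psi^2 - div_g F
   is a sum of four kinds of nonnegative terms: the squares
   (u_rr - q u_r)^2 and |grad_S (u_r - q' u)|^2 / psi^2, with q and q' the
   logarithmic derivatives of (r / psi^(N-1))^(1/2) and (r / psi^(N-3))^(1/2)
   (the Hardy ground states on the half line for u_r and for grad_S u); the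
   traceless part of the Hessian of u along the sphere, from the Bochner formula
   (it replaces the first eigenvalue N - 1 of the sphere and makes a
   decomposition in spherical harmonics unnecessary); and u_r^2 and T with
   coefficients that are nonnegative because psi'^2 >= 1 + psi psi'',
   psi'' >= psi and N >= 5.
   The field F is of order 1 / r at the pole, so a cutoff at scale 1 / m costs
   O(m^(2 - N)), and monotone convergence gives the four integrals. *)
Require Import Defs.
From HB Require Import structures.
From mathcomp Require Import all_boot all_order all_algebra.
From mathcomp Require Import all_classical all_reals all_analysis.
From mathcomp Require Import measurable_realfun ring lra.
Import Order.TTheory GRing.Theory Num.Theory.
Import numFieldNormedType.Exports.
Set Implicit Arguments. Unset Strict Implicit. Unset Printing Implicit Defensive.
Local Open Scope classical_set_scope.
Local Open Scope ring_scope.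

(** * Integrals of continuous functions of bounded support *)

(** No polar coordinates are introduced. [int_M] is an iterated integral over the Cartesian chart,
    so every spherical object is written as a polynomial in x, grad u, Hess u and the third
    derivatives, and the decomposition becomes an identity between numbers at a point. The third
    derivatives occur only in the divergence of the field, where they cancel. The analysis reduces
    to a divergence theorem for fields that are C^1 off the pole and vanish near it and far away,
    proved by translation invariance.

    The constants ((N - 1) / 2)^2 and (N^2 - 1) / 4 are those of psi = sinh: there psi'^2 = 1 + psi
    psi'' and psi'' = psi, and the coefficient left in front of u_r^2 vanishes identically. The 1/4
    in front of 1 / r^2 comes from the factor r^(1/2) of the ground states. The condition N >= 5
    enters through the coefficient of T: once psi'^2 is bounded below by 1 + psi psi'', its 1 /
    psi^2 part is (N - 5)(N + 1) / 4. *)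

Section OneDim.
Context {R : realType}.
Notation mu := (@lebesgue_measure R).

Lemma integrable_cpt (h : R -> R) (A : R) : continuous h ->
  (forall t, A < `|t| -> h t = 0) -> mu.-integrable setT (EFin \o h).
Proof.
move=> ch h0.
have i1 : mu.-integrable `[- A, A] (EFin \o h).
  apply: (@continuous_compact_integrable R h); first exact: segment_compact.
  exact: continuous_subspaceT.
have -> : EFin \o h = ((EFin \o h) \_ `[- A, A]).
  apply/funext => t; rewrite patchE; case: ifPn => // /negP.
  rewrite inE /= in_itv /= -ler_norml => /negP; rewrite -ltNge => /h0 /= -> //.
by apply/integrable_restrict => //; rewrite setTI.
Qed.

Lemma Rintegral_itv_cpt (h : R -> R) (A : R) :
  (forall t, A < `|t| -> h t = 0) ->
  \int[mu]_t h t = \int[mu]_(t in `[- A, A]) h t.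
Proof.
move=> h0; rewrite [RHS]Rintegral_mkcond; apply: eq_Rintegral => t _.
rewrite patchE; case: ifPn => // /negP.
by rewrite inE /= in_itv /= -ler_norml => /negP; rewrite -ltNge => /h0.
Qed.

Lemma Rintegral_cpt_le (h : R -> R) (A M : R) : continuous h -> 0 <= A ->
  (forall t, A < `|t| -> h t = 0) -> (forall t, `|h t| <= M) ->
  `|\int[mu]_t h t| <= M * (2 * A).
Proof.
move=> ch A0 h0 hM.
have i1 : mu.-integrable `[- A, A] (EFin \o h).
  apply: (@continuous_compact_integrable R h); first exact: segment_compact.
  exact: continuous_subspaceT.
rewrite (Rintegral_itv_cpt h0).
apply: le_trans (le_normr_Rintegral _ i1) _ => //.
have -> : M * (2 * A) = \int[mu]_(t in `[- A, A]) M.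
  rewrite Rintegral_cst//= lebesgue_measure_itv /= lte_fin.
  case: ltrP => [_|]; first by rewrite /= opprK mulr_natl mulr2n.
  move=> AA; have -> : A = 0 by lra.
  by rewrite /= !mulr0.
apply: le_Rintegral => //.
- exact: (integrable_norm i1).
- apply: (@continuous_compact_integrable R (cst M)); first exact: segment_compact.
  apply: continuous_subspaceT; exact: cst_continuous.
Qed.

(** The pushforward under a translation gives every half-open interval its length, and this
    determines Lebesgue measure. *)
Lemma lebesgue_shift (s : R) (A : set R) : measurable A ->
  pushforward mu (shift s : _ -> measurableTypeR R) A = mu A.
Proof.
have ms : measurable_fun setT (shift s : measurableTypeR R -> measurableTypeR R).
  exact: measurable_funD.
move=> mA; apply/esym.
apply: (@lebesgue_measure_unique R (pushforward mu (shift s : _ -> measurableTypeR R))) => //= _ [[a b]] _ <-.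
rewrite /pushforward /=.
have -> : (shift s : R -> R) @^-1` `]a, b]%classic = `]a - s, b - s]%classic.
  by apply/seteqP; split => t /=; rewrite !in_itv /= ltrBlDr lerBrDr.
rewrite !lebesgue_measure_itv/= !lte_fin.
rewrite ltrD2r; case: ifP => // _.
by congr EFin; ring.
Qed.

Lemma Rintegral_shift (h : R -> R) (s A : R) : continuous h ->
  (forall t, A < `|t| -> h t = 0) ->
  \int[mu]_t h (t + s) = \int[mu]_t h t.
Proof.
move=> ch h0.
have ms : measurable_fun setT (shift s : measurableTypeR R -> measurableTypeR R).
  exact: measurable_funD.
rewrite /Rintegral; congr fine.
pose nu0 : {measure set (measurableTypeR R) -> \bar R} :=
  pushforward mu (shift s : _ -> measurableTypeR R).
pose nu := nu0 ms.
have -> : (\int[mu]_t (h t)%:E = \int[nu]_t (h t)%:E)%E.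
  by apply: eq_measure_integral => /= B mB _; apply/esym; exact: (lebesgue_shift s mB).
have -> := @integral_pushforward _ _ _ _ _ _ ms mu setT (EFin \o h); rewrite ?preimage_setT //.
  by apply/measurable_EFinP; exact: continuous_measurable_fun.
apply: (@integrable_cpt (h \o shift s) (A + `|s|)).
  move=> t; apply: continuous_comp; last exact: ch.
  by apply: cvgD; [exact: cvg_id|exact: cvg_cst].
move=> t ht /=; apply: h0.
have := ler_normB (t + s) s; rewrite addrK; lra.
Qed.

End OneDim.

(** * Iterated integrals and their invariance under translations *)

Section IterInt.
Context {R : realType} {N : nat}.
Notation V := 'rV[R]_N.
Notation mu := (@lebesgue_measure R).
Implicit Types (x y : V) (t s : R).

Lemma rV_norm_le x (M : R) : 0 <= M -> (forall k, `|x 0 k| <= M) -> `|x| <= M.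
Proof.
move=> M0 h; rewrite /Num.Def.normr/= mx_normrE.
by apply: bigmax_le => // -[i k] _ /=; rewrite ord1.
Qed.

Lemma rV_coord_le x k : `|x 0 k| <= `|x|.
Proof.
rewrite [leRHS]/Num.Def.normr/= mx_normrE.
exact: (le_bigmax _ (fun ij => `|x ij.1 ij.2|) (0, k)).
Qed.

Lemma rV_normP x (M : R) : 0 <= M -> M < `|x| -> exists k, M < `|x 0 k|.
Proof.
move=> M0 h; apply: contrapT => /forallNP hk.
have : `|x| <= M by apply: rV_norm_le => // k; rewrite leNgt; apply/negP/hk.
by rewrite leNgt h.
Qed.

Lemma norm_evec (k : 'I_N) : `|evec R k| <= 1.
Proof.
apply: rV_norm_le => // l; rewrite mxE eqxx /=.
by case: (l == k); rewrite ?normr1 ?normr0.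
Qed.

Lemma upd_coord x n t (k : 'I_N) :
  (upd x n t) 0 k = if (k : nat) == n then t else x 0 k.
Proof. by rewrite mxE. Qed.

Lemma upd_distx x y n t : `|upd x n t - upd y n t| <= `|x - y|.
Proof.
apply: rV_norm_le => // k; rewrite !mxE; case: ifP => _.
  by rewrite subrr normr0.
by have := rV_coord_le (x - y) k; rewrite !mxE.
Qed.

Lemma upd_distt x n s t : `|upd x n t - upd x n s| <= `|t - s|.
Proof.
apply: rV_norm_le => // k; rewrite !mxE; case: ifP => _ //.
by rewrite subrr normr0.
Qed.

(** Uniform continuity on the whole space, with a weak inequality on the values: in this form it is
    reproduced by integrating out one coordinate. *)
Definition ucont (h : V -> R) := forall e, 0 < e -> exists2 d, 0 < d &
  forall x y, `|x - y| < d -> `|h x - h y| <= e.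

(** Only the coordinates from [n] on are constrained: in the use made of it, those before [n] have
    been integrated out and the function no longer depends on them. *)
Definition vanish (A : R) (n : nat) (h : V -> R) :=
  forall x (k : 'I_N), (n <= k)%N -> A < `|x 0 k| -> h x = 0.

Lemma slice_continuous h n x : ucont h -> continuous (fun t => h (upd x n t)).
Proof.
move=> hu t; apply/cvgrPdist_le => /= e /hu[d d0 hd].
near=> s; apply: hd; apply: le_lt_trans (upd_distt _ _ _ _) _.
near: s; by exists d.
Unshelve. all: by end_near. Qed.

Lemma slice_vanish A h n x : vanish A n h -> (n < N)%N ->
  forall t, A < `|t| -> h (upd x n t) = 0.
Proof.
move=> hv nN t ht; apply: (hv _ (Ordinal nN)) => //=.
by rewrite upd_coord /= eqxx.
Qed.

Definition int_coord (n : nat) (h : V -> R) x : R := \int[mu]_t h (upd x n t).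

Lemma int_coord_vanish A n h : vanish A n h -> vanish A n.+1 (int_coord n h).
Proof.
move=> hv x k nk hk; rewrite /int_coord.
transitivity (\int[mu]_t (0 : R)); last first.
  by rewrite /Rintegral integral0.
apply: eq_Rintegral => t _; apply: (hv _ k); first exact: ltnW.
by rewrite upd_coord gtn_eqF.
Qed.

Lemma slice_integrable A n h x : ucont h -> vanish A n h -> (n < N)%N ->
  mu.-integrable setT (EFin \o (fun t => h (upd x n t))).
Proof.
move=> hu hv nN; apply: (@integrable_cpt _ _ A); first exact: slice_continuous.
exact: slice_vanish.
Qed.

Lemma int_coord_ucont A n h : 0 <= A -> (n < N)%N -> ucont h -> vanish A n h ->
  ucont (int_coord n h).
Proof.
move=> A0 nN hu hv e e0.
have A1 : 0 < 2 * A + 1 by lra.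
have [d d0 hd] := hu (e / (2 * A + 1)) (divr_gt0 e0 A1).
exists d => // x y xy; rewrite /int_coord -RintegralB //; last 2 first.
- exact: slice_integrable hu hv nN.
- exact: slice_integrable hu hv nN.
apply: le_trans (@Rintegral_cpt_le _ _ A (e / (2 * A + 1)) _ _ _ _) _ => //.
- move=> t; apply: cvgB; exact: slice_continuous.
- by move=> t ht; rewrite !(slice_vanish _ hv) // subrr.
- by move=> t; apply: hd; apply: le_lt_trans xy; exact: upd_distx.
by rewrite -mulrA ler_piMr ?(ltW e0)// mulrC ler_pdivrMr//; lra.
Qed.

(* The real-valued form of [iint]. *)
Fixpoint iter_int (n : nat) (g : V -> R) : V -> R :=
  if n is n'.+1 then int_coord n' (iter_int n' g) else g.

Lemma iter_int_good A g n : 0 <= A -> ucont g -> vanish A 0 g -> (n <= N)%N ->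
  ucont (iter_int n g) /\ vanish A n (iter_int n g).
Proof.
move=> A0 gu gv; elim: n => [//|n IH] nN.
have [hu hv] := IH (ltnW nN); split; first exact: (int_coord_ucont A0 nN).
exact: int_coord_vanish.
Qed.

Lemma iter_int_lin A (a b : R) f g n x : 0 <= A -> ucont f -> vanish A 0 f ->
  ucont g -> vanish A 0 g -> (n <= N)%N ->
  iter_int n (fun y => a * f y + b * g y) x = a * iter_int n f x + b * iter_int n g x.
Proof.
move=> A0 fu fv gu gv; elim: n x => [//|n IH] x nN /=.
have [fu' fv'] := iter_int_good A0 fu fv (ltnW nN).
have [gu' gv'] := iter_int_good A0 gu gv (ltnW nN).
have i1 := slice_integrable x fu' fv' nN.
have i2 := slice_integrable x gu' gv' nN.
rewrite /int_coord -!RintegralZl// -RintegralD//.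
- by apply: eq_Rintegral => t _; rewrite IH // ltnW.
- exact: (integrableZl measurableT a i1).
- exact: (integrableZl measurableT b i2).
Qed.

Lemma iter_int_le A f g n x : 0 <= A -> ucont f -> vanish A 0 f ->
  ucont g -> vanish A 0 g -> (n <= N)%N -> (forall y, f y <= g y) ->
  iter_int n f x <= iter_int n g x.
Proof.
move=> A0 fu fv gu gv + fg; elim: n x => [//|n IH] x nN /=.
have [fu' fv'] := iter_int_good A0 fu fv (ltnW nN).
have [gu' gv'] := iter_int_good A0 gu gv (ltnW nN).
have i1 := slice_integrable x fu' fv' nN.
have i2 := slice_integrable x gu' gv' nN.
by apply: le_Rintegral => // t _; apply: IH; exact: ltnW.
Qed.

Lemma iter_int_bound A M g n x : 0 <= A -> ucont g -> vanish A 0 g -> (n <= N)%N ->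
  (forall y, `|g y| <= M) -> `|iter_int n g x| <= M * (2 * A) ^+ n.
Proof.
move=> A0 gu gv + gM; elim: n x => [|n IH] x nN /=; first by rewrite mulr1.
have [gu' gv'] := iter_int_good A0 gu gv (ltnW nN).
rewrite exprSr mulrA; apply: Rintegral_cpt_le => //.
- exact: slice_continuous.
- exact: slice_vanish.
- by move=> t; apply: IH; exact: ltnW.
Qed.

Lemma iter_int0 n x : iter_int n (fun=> 0) x = 0.
Proof.
elim: n x => [//|n IH] x /=; rewrite /int_coord.
under eq_Rintegral do rewrite IH.
by rewrite /Rintegral integral0.
Qed.

Lemma ucont0 : ucont (fun=> 0).
Proof. by move=> e e0; exists 1 => // *; rewrite subrr normr0 ltW. Qed.

Lemma upd_shift (i : 'I_N) n s x t : (i : nat) != n ->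
  upd x n t + s *: evec R i = upd (x + s *: evec R i) n t.
Proof.
move=> inn; apply/rowP => k; rewrite !mxE eqxx /=.
case: (eqVneq (k : nat) n) => // kn.
have -> : (k == i) = false.
  by apply/eqP => ki; move: inn; rewrite -ki kn eqxx.
by rewrite mulr0 addr0.
Qed.

Lemma upd_shift_eq (i : 'I_N) s x t :
  upd x i t + s *: evec R i = upd x i (t + s).
Proof.
apply/rowP => k; rewrite !mxE eqxx /=.
have -> : ((k : nat) == i) = (k == i) by [].
by case: eqVneq => _; rewrite ?mulr1 ?mulr0 ?addr0.
Qed.

(** The shift passes through the integrations in the other variables, where it only moves the base
    point, and is absorbed by the integration in variable [i]. For [n = N] no trace of it is
    left. *)
Lemma iter_int_shift A g (i : 'I_N) s n x : 0 <= A -> ucont g -> vanish A 0 g ->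
  (n <= N)%N ->
  iter_int n (fun y => g (y + s *: evec R i)) x =
  if (i < n)%N then iter_int n g x else iter_int n g (x + s *: evec R i).
Proof.
move=> A0 gu gv; elim: n x => [//|n IH] x nN /=.
have [gu' gv'] := iter_int_good A0 gu gv (ltnW nN).
rewrite /int_coord.
under eq_Rintegral do rewrite (IH _ (ltnW nN)).
rewrite ltnS; case: ltngtP => [lin|lni|ein].
- by [].
- by apply: eq_Rintegral => t _; rewrite upd_shift // gtn_eqF.
have := Rintegral_shift s (@slice_continuous _ n x gu') (@slice_vanish _ _ _ x gv' nN).
rewrite /int_coord => <-.
by apply: eq_Rintegral => t _; rewrite -ein upd_shift_eq.
Qed.

Lemma compact_ball0 (r : R) : compact [set x : V | `|x| <= r].
Proof.
apply: bounded_closed_compact.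
  exists r; split; first exact: num_real.
  by move=> M rM x /= /le_trans; apply; exact: ltW.
apply: (@closed_comp _ _ (fun x : V => `|x|) [set z : R | z <= r]); last exact: closed_le.
by move=> x _; exact: norm_continuous.
Qed.

(** Heine's theorem on the ball of radius [A + 1]. The modulus is kept below 1, so that if one point
    lies beyond that ball, both lie where [g] vanishes. *)
Lemma continuous_cpt_ucont A g : continuous g ->
  (forall x, A < `|x| -> g x = 0) -> ucont g.
Proof.
move=> gc g0 e e0.
have e20 : 0 < e / 2 by rewrite divr_gt0.
pose K := [set x : V | `|x| <= A + 1].
have /compact_near_coveringP cK := @compact_ball0 (A + 1).
have h1 : forall x, K x -> \forall x' \near x & d \near (0:R)^'+, forall y,
    `|x' - y| < d -> `|g x' - g y| <= e.
  move=> x Kx.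
  have /cvgrPdist_le /(_ (e / 2) e20) /nbhs_normP [d /= d0 hd] := gc x.
  have nx : \forall x' \near x, `|x - x'| < d / 2.
    by apply/nbhs_normP; exists (d / 2) => //=; rewrite divr_gt0.
  have n0 : (0 : R)^'+ [set r : R | r < d / 2].
    by apply: nbhs_right_lt; rewrite divr_gt0.
  exists ([set x' | `|x - x'| < d / 2], [set r : R | r < d / 2]).
    by split; [exact: nx|exact: n0].
  move=> [x' r] /= [xx' rd] y x'y.
  have h1 : `|g x - g x'| <= e / 2 by apply: hd => /=; lra.
  have h2 : `|g x - g y| <= e / 2.
    apply: hd => /=; apply: le_lt_trans (ler_distD x' x y) _.
    by rewrite [ltRHS]splitr ltrD // (lt_trans x'y).
  apply: le_trans (ler_distD (g x) _ _) _.
  by rewrite [leRHS]splitr lerD // distrC.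
have [d /= [d0 d1 hd]] : exists d : R, [/\ 0 < d, d < 1 & forall x, K x -> forall y,
    `|x - y| < d -> `|g x - g y| <= e].
  have hh := cK R _ (fun d x => forall y, `|x - y| < d -> `|g x - g y| <= e) _ h1.
  have : \forall d \near (0:R)^'+, [/\ 0 < d, d < 1 & forall x, K x -> forall y,
    `|x - y| < d -> `|g x - g y| <= e].
    by near=> d; split; [near: d; exact: nbhs_right_gt|near: d; exact: nbhs_right_lt|near: d; exact: hh].
  by move=> /filter_ex.
exists d => // x y xy.
have [Kx|nKx] := lerP `|x| (A + 1); first exact: hd.
have Ay : A < `|y|.
  rewrite ltNge; apply/negP => yA; move: nKx; rewrite ltNge => /negP; apply.
  rewrite -[x](subrK y) (le_trans (ler_normD _ _)) // addrC lerD //.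
  exact: ltW (lt_trans xy d1).
by rewrite (g0 _ Ay) g0 ?subrr ?normr0 ?(ltW e0) // (lt_trans _ nKx) // ltrDl.
Unshelve. all: by end_near. Qed.

End IterInt.

(** * Integrals of partial derivatives, monotone limits *)

Section DivInt.
Context {R : realType} {N : nat}.
Notation V := 'rV[R]_N.
Notation mu := (@lebesgue_measure R).
Implicit Types (x y : V) (t s : R).

Lemma vanishP A (g : V -> R) : 0 <= A -> (forall x, A < `|x| -> g x = 0) <-> vanish A 0 g.
Proof.
move=> A0; split => [h x k _ hk|h x hx].
  by apply: h; apply: lt_le_trans hk (rV_coord_le _ _).
by have [k hk] := rV_normP A0 hx; apply: (h x k).
Qed.

Lemma line_is_derive (f : V -> R) x v t : derivable f (t *: v + x) v ->
  is_derive t 1 (fun t => f (t *: v + x)) ('D_v f (t *: v + x)).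
Proof.
move=> df.
have E : (fun h : R => h^-1 *: ((f \o shift (t *: v + x)) (h *: v) - f (t *: v + x)))
   = (fun h : R => h^-1 *: (((fun t => f (t *: v + x)) \o shift t) (h *: 1) - f (t *: v + x))).
  apply/funext => h /=; congr (_ *: (f _ - _)).
  by rewrite [h *: 1]mulr1 scalerDl addrA.
apply: DeriveDef.
  by rewrite /derivable -E.
by rewrite /derive -E.
Qed.

Lemma ucont_lin (a b : R) (f g : V -> R) : ucont f -> ucont g ->
  ucont (fun x => a * f x + b * g x).
Proof.
move=> fu gu e e0.
pose c := `|a| + `|b| + 1.
have c0 : 0 < c by rewrite /c ltr_wpDl // addr_ge0.
have [d1 d10 h1] := fu (e / c) (divr_gt0 e0 c0).
have [d2 d20 h2] := gu (e / c) (divr_gt0 e0 c0).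
exists (Num.min d1 d2); first by rewrite lt_min d10.
move=> x y; rewrite lt_min => /andP[/h1 {}h1 /h2 {}h2].
rewrite opprD addrACA -!mulrBr (le_trans (ler_normD _ _)) // !normrM.
have H1 := ler_wpM2l (normr_ge0 a) h1.
have H2 := ler_wpM2l (normr_ge0 b) h2.
apply: le_trans (lerD H1 H2) _; rewrite -mulrDl mulrCA ler_piMr ?(ltW e0) //.
by rewrite ler_pdivrMr // mul1r /c lerDl.
Qed.

Lemma pder_vanish (f : V -> R) (A : R) (i : 'I_N) x :
  (forall x, A < `|x| -> f x = 0) -> A < `|x| -> pder i f x = 0.
Proof.
move=> f0 Ax; rewrite /pder -(derive_cst (0 : R) x (evec R i)).
apply: near_eq_derive.
have : \forall y \near x, A < `|y|.
  apply: (@cvgr_gt _ _ _ (nbhs_filter x) (fun y : V => `|y|) `|x|) => //.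
  exact: norm_continuous.
by apply: filterS => y /f0.
Qed.

Lemma line_MVT (g : V -> R) (i : 'I_N) y s :
  (forall x, derivable g x (evec R i)) -> 0 < s ->
  exists2 c, 0 <= c <= s &
    g (s *: evec R i + y) - g y = s * pder i g (c *: evec R i + y).
Proof.
move=> gd s0.
have := @MVT_segment R (fun t => g (t *: evec R i + y))
  (fun t => pder i g (t *: evec R i + y)) 0 s (ltW s0).
case.
- by move=> t _; apply: line_is_derive; exact: gd.
- apply: derivable_within_continuous => t _.
  have D := @line_is_derive g y (evec R i) t (gd _).
  exact: (@ex_derive _ _ _ _ _ _ _ D).
move=> c; rewrite in_itv /= scale0r add0r subr0 mulrC => cs E.
by exists c.
Qed.

(* By translation invariance the difference quotients of [g] integrate to 0, and
   they converge uniformly: no exchange of the order of integration is needed. *)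
Lemma iter_int_pder A (g : V -> R) (i : 'I_N) : 0 <= A -> continuous g ->
  (forall x, A < `|x| -> g x = 0) -> (forall x, derivable g x (evec R i)) ->
  continuous (pder i g) -> iter_int N (pder i g) 0 = 0.
Proof.
move=> A0 gc g0 gd dc.
(* One unit of room: translates by steps [s <= 1] vanish outside the same ball. *)
pose B := A + 1.
have B0 : 0 <= B by rewrite /B; lra.
have AB : A < B by rewrite /B; lra.
have gu := continuous_cpt_ucont gc g0.
have d0 x : A < `|x| -> pder i g x = 0 by exact: pder_vanish.
have du := continuous_cpt_ucont dc d0.
have gv : vanish B 0 g by apply/vanishP => // x Bx; apply: g0; exact: lt_trans Bx.
have dv : vanish B 0 (pder i g) by apply/vanishP => // x Bx; apply: d0; exact: lt_trans Bx.
have key e : 0 < e -> `|iter_int N (pder i g) 0| <= e * (2 * B) ^+ N.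
  move=> e0; have [d dp hd] := du e e0.
  pose s := Num.min (d / 2) 1.
  have s0 : 0 < s by rewrite lt_min; apply/andP; split; lra.
  have sd : s < d by rewrite gt_min; apply/orP; left; lra.
  have s1 : s <= 1 by rewrite ge_min lexx orbT.
  pose gs y := g (y + s *: evec R i).
  have gsu : ucont gs.
    move=> e' e'0; have [d' d'0 hd'] := gu e' e'0; exists d' => // x y xy.
    by apply: hd'; rewrite opprD addrACA subrr addr0.
  have gsv : vanish B 0 gs.
    apply/vanishP => // x Bx; apply: g0.
    rewrite ltNge; apply/negP => h; move: Bx; rewrite ltNge => /negP; apply.
    rewrite -[x](addrK (s *: evec R i)) (le_trans (ler_normB _ _)) // /B lerD //.
    by rewrite normrZ (gtr0_norm s0) (le_trans _ s1) // ler_piMr ?norm_evec // ltW.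
  pose h y := s^-1 * gs y + (- s^-1) * g y.
  have hu : ucont h by exact: ucont_lin.
  have hv : vanish B 0 h by move=> x k k0 hk; rewrite /h (gsv _ _ k0 hk) (gv _ _ k0 hk) !mulr0 addr0.
  have h0 : iter_int N h 0 = 0.
    rewrite /h (iter_int_lin _ _ _ B0) // (iter_int_shift _ _ _ B0) // ltn_ord.
    by rewrite mulNr subrr.
  (* Since the difference quotient [h] integrates to 0, it can be subtracted. By the mean value
     theorem [h y] is [pder i g] at a point within [s] of [y], so uniform continuity makes the new
     integrand at most [e]. *)
  have -> : iter_int N (pder i g) 0 = iter_int N (fun y => 1 * pder i g y + (-1) * h y) 0.
    by rewrite (iter_int_lin _ _ _ B0) // h0 mulr0 addr0 mul1r.
  apply: (@iter_int_bound _ _ B) => //.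
  - exact: ucont_lin.
  - by move=> x k k0 hk; rewrite (hv _ _ k0 hk) (dv _ _ k0 hk) !mulr0 addr0.
  move=> y.
  have [c /andP[c0 cs] Ec] := line_MVT y gd s0.
  have -> : h y = pder i g (c *: evec R i + y).
    rewrite /h /gs (addrC y) mulNr -mulrBr.
    by rewrite Ec mulrA mulVf ?mul1r // gt_eqF.
  rewrite mul1r mulN1r; apply: hd.
  rewrite opprD addrCA subrr addr0 normrN normrZ (ger0_norm c0).
  apply: le_lt_trans sd; apply: le_trans cs.
  by rewrite ler_piMr // norm_evec.
apply/eqP; rewrite -normr_eq0 eq_le normr_ge0 andbT.
apply/ler_addgt0Pl => e e0; rewrite addr0.
have P0 : 0 < (2 * B) ^+ N + 1 by rewrite ltr_wpDl // exprn_ge0 // mulr_ge0.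
apply: le_trans (key _ (divr_gt0 e0 P0)) _.
by rewrite mulrAC ler_pdivrMr // ler_wpM2l ?(ltW e0) //; lra.
Qed.

(** Monotone convergence, one variable at a time. The limit is prescribed only off the origin, which
    the first integration sees in at most one point of each line; this is the role of [0 < N]. *)
Lemma iint_lim (f : V -> R) (g : nat -> V -> R) (A : R) : 0 <= A -> (0 < N)%N ->
  (forall m, ucont (g m)) -> (forall m, vanish A 0 (g m)) ->
  (forall m x, 0 <= g m x) -> (forall m x, g m x <= g m.+1 x) ->
  (forall x, x != 0 -> \forall m \near \oo, g m x = f x) ->
  (iter_int N (g m) 0)%:E @[m --> \oo] --> iint N (EFin \o f) 0.
Proof.
move=> A0 N0 gu gv g0 grad2_val gf.
have mg n m x : (n < N)%N -> measurable_fun setT (fun t => (iter_int n (g m) (upd x n t))%:E).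
  move=> nN.
  have [hu _] := iter_int_good A0 (gu m) (gv m) (ltnW nN).
  have cs : continuous (fun t => iter_int n (g m) (upd x n t)) by exact: slice_continuous.
  by apply/measurable_EFinP; exact: continuous_measurable_fun.
have ndg n m x : (n <= N)%N -> iter_int n (g m) x <= iter_int n (g m.+1) x.
  by move=> nN; apply: (iter_int_le _ A0).
have nd n x : (n <= N)%N -> nondecreasing_seq (fun m => (iter_int n (g m) x)%:E).
  by move=> nN; apply/nondecreasing_seqP => m; rewrite lee_fin; exact: ndg.
have ge n m x : (n <= N)%N -> (0%E <= (iter_int n (g m) x)%:E)%E.
  move=> nN; rewrite lee_fin.
  rewrite -(@iter_int0 _ _ n x).
  by apply: (iter_int_le _ A0) => //; exact: ucont0.
have step n x (F : V -> \bar R) : (n < N)%N ->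
    (forall t, (iter_int n (g m) (upd x n t))%:E @[m --> \oo] --> F (upd x n t)) ->
    (iter_int n.+1 (g m) x)%:E @[m --> \oo] --> (\int[mu]_t F (upd x n t))%E.
  move=> nN hF.
  have -> : (fun m => (iter_int n.+1 (g m) x)%:E) =
      (fun m => (\int[mu]_t (iter_int n (g m) (upd x n t))%:E)%E).
    apply/funext => m /=.
    have [hu hv] := iter_int_good A0 (gu m) (gv m) (ltnW nN).
    rewrite /int_coord /Rintegral fineK//.
    apply: integrable_fin_num => //; exact: slice_integrable hu hv nN.
  have -> : (\int[mu]_t F (upd x n t) =
      \int[mu]_t limn (fun m => (iter_int n (g m) (upd x n t))%:E))%E.
    by apply: eq_integral => t _; apply/esym/cvg_lim => //; exact: hF.
  apply: cvg_monotone_convergence => //.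
  - by move=> m; exact: mg.
  - by move=> m t _; apply: ge; exact: ltnW.
  - by move=> t _; apply: nd; exact: ltnW.
(* At the origin the increasing sequence still has a limit in the extended reals. With this value
   [f'] is an everywhere pointwise limit of continuous functions, hence measurable along lines. *)
pose f' x := if x == 0 then limn (fun m => (g m x)%:E) else (f x)%:E.
have hf' x : (g m x)%:E @[m --> \oo] --> f' x.
  rewrite /f'; case: eqVneq => [->|x0].
    apply: ereal_nondecreasing_is_cvgn; exact: (nd 0%N).
  apply: cvg_near_cst.
  by have := gf x x0; apply: filterS => m ->.
have base x : (iter_int 1 (g m) x)%:E @[m --> \oo] --> iint 1 (EFin \o f) x.
  have -> : iint 1 (EFin \o f) x = (\int[mu]_t f' (upd x 0%N t))%E.
    (* For [t != 0] the point is off the origin, so [f] and [f'] differ on the line at most at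
       [t = 0], a null set. *)
    rewrite /=; have E t : t != 0 -> (f (upd x 0%N t))%:E = f' (upd x 0%N t).
      move=> t0; rewrite /f'; case: eqVneq => // u0.
      have := upd_coord x 0%N t (Ordinal N0).
      by rewrite u0 mxE eqxx => /esym/eqP; rewrite (negbTE t0).
    have mf' : measurable_fun setT (fun t => f' (upd x 0%N t)).
      apply: (@emeasurable_fun_cvg _ _ _ _ (fun m t => (g m (upd x 0%N t))%:E)).
        by move=> m; exact: (mg 0%N).
      by move=> t _; exact: hf'.
    have mD : measurable ([set: R] `\ 0) by exact: measurableD.
    rewrite -(@integral_setD1 _ _ 0) //; last first.
      apply: (@eq_measurable_fun _ _ _ _ _ (fun t => f' (upd x 0%N t))).
        by move=> t; rewrite inE /= => -[_ /eqP t0]; rewrite E.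
      exact: measurable_funS mf'.
    rewrite -[RHS](@integral_setD1 _ _ 0) //; last exact: measurable_funS mf'.
    by apply: eq_integral => t; rewrite inE /= => -[_ /eqP t0]; rewrite E.
  apply: step => // t; exact: hf'.
have main n x : (0 < n)%N -> (n <= N)%N ->
    (iter_int n (g m) x)%:E @[m --> \oo] --> iint n (EFin \o f) x.
  elim: n x => // -[_ x _ _|n IH x _ nN]; first exact: base.
  apply: (step _ _ (iint n.+1 (EFin \o f))) => // t.
  by apply: IH => //; exact: ltnW.
exact: main.
Qed.

End DivInt.

(** * Differential calculus away from the origin *)

Section SumLin.
Context {R : comNzRingType} {n : nat}.

Lemma sum_lin3 (c1 c2 c3 : R) (f1 f2 f3 : 'I_n -> R) :
  \sum_i (c1 * f1 i + c2 * f2 i + c3 * f3 i) =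
  c1 * (\sum_i f1 i) + c2 * (\sum_i f2 i) + c3 * (\sum_i f3 i).
Proof. by rewrite !big_split -!mulr_sumr. Qed.

Lemma sum_lin7 (c1 c2 c3 c4 c5 c6 c7 : R) (f1 f2 f3 f4 f5 f6 f7 : 'I_n -> R) :
  \sum_i (c1 * f1 i + c2 * f2 i + c3 * f3 i + c4 * f4 i + c5 * f5 i + c6 * f6 i + c7 * f7 i) =
  c1 * (\sum_i f1 i) + c2 * (\sum_i f2 i) + c3 * (\sum_i f3 i) + c4 * (\sum_i f4 i)
  + c5 * (\sum_i f5 i) + c6 * (\sum_i f6 i) + c7 * (\sum_i f7 i).
Proof. by rewrite !big_split -!mulr_sumr. Qed.

Lemma sum_lin10 (c1 c2 c3 c4 c5 c6 c7 c8 c9 c0 : R)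
  (f1 f2 f3 f4 f5 f6 f7 f8 f9 f0 : 'I_n -> R) :
  \sum_i (c1 * f1 i + c2 * f2 i + c3 * f3 i + c4 * f4 i + c5 * f5 i + c6 * f6 i
    + c7 * f7 i + c8 * f8 i + c9 * f9 i + c0 * f0 i) =
  c1 * (\sum_i f1 i) + c2 * (\sum_i f2 i) + c3 * (\sum_i f3 i) + c4 * (\sum_i f4 i)
  + c5 * (\sum_i f5 i) + c6 * (\sum_i f6 i) + c7 * (\sum_i f7 i)
  + c8 * (\sum_i f8 i) + c9 * (\sum_i f9 i) + c0 * (\sum_i f0 i).
Proof. by rewrite !big_split -!mulr_sumr. Qed.

Lemma sum_delta (c : 'I_n -> R) k : \sum_l c l * (l == k)%:R = c k.
Proof.
rewrite (bigD1 k) //= eqxx mulr1 big1 ?addr0 // => l /negbTE ->.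
by rewrite mulr0.
Qed.

Lemma sumr_delta (c : 'I_n -> R) k : \sum_l c l * (k == l)%:R = c k.
Proof. by rewrite -[RHS]sum_delta; apply: eq_bigr => l _; rewrite eq_sym. Qed.

End SumLin.

Section DerivRules.
Context {R : realType} {W : normedModType R}.
Implicit Types (f g : W -> R).

Lemma pdD (x v : W) f g (a b : R) : is_derive x v f a -> is_derive x v g b ->
  is_derive x v (fun y => f y + g y) (a + b).
Proof. exact: is_deriveD. Qed.

Lemma pdN (x v : W) f (a : R) : is_derive x v f a -> is_derive x v (fun y => - f y) (- a).
Proof. exact: is_deriveN. Qed.

Lemma pdM (x v : W) f g (a b : R) : is_derive x v f a -> is_derive x v g b ->
  is_derive x v (fun y => f y * g y) (f x * b + g x * a).
Proof. exact: is_deriveM. Qed.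

Lemma pdV (x v : W) f (a : R) : f x != 0 -> is_derive x v f a ->
  is_derive x v (fun y => (f y)^-1) (- (f x) ^- 2 * a).
Proof.
move=> fx h; apply: DeriveDef.
  by apply: derivableV => //; exact: (@ex_derive _ _ _ _ _ _ _ h).
by rewrite deriveV // (@derive_val _ _ _ _ _ _ _ h).
Qed.

Lemma pdC (x v : W) (c : R) : is_derive x v (fun=> c) 0.
Proof. exact: is_derive_cst. Qed.

Lemma pd_eq (x v : W) f (a b : R) : is_derive x v f a -> a = b -> is_derive x v f b.
Proof. by move=> h <-. Qed.

End DerivRules.

Section Calc.
Context {R : realType} {N : nat}.
Notation V := 'rV[R]_N.
Implicit Types (x y : V) (f g : V -> R) (i j : 'I_N).

(* Regularity is only required off the origin, where the radial weights 1 / r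
   and 1 / psi(r) are singular. *)
Definition C0 f := forall x, x != 0 -> {for x, continuous f}.

Definition C1 f := C0 f /\ forall i,
  (forall x, x != 0 -> derivable f x (evec R i)) /\ C0 (pder i f).

Lemma near_neq0 x : x != 0 -> \forall y \near x, y != 0.
Proof.
move=> x0; have : \forall y \near x, 0 < `|y|.
  apply: (@cvgr_gt _ _ _ (nbhs_filter x) (fun y : V => `|y|) `|x|).
    exact: norm_continuous.
  by rewrite normr_gt0.
by apply: filterS => y; rewrite normr_gt0.
Qed.

Lemma C0_ext f g : (forall x, x != 0 -> f x = g x) -> C0 f -> C0 g.
Proof.
move=> fg fc x x0; suff: g y @[y --> x] --> g x by [].
rewrite -(fg _ x0).
have h : {near x, f =1 g} by have := near_neq0 x0; apply: filterS => y /fg.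
exact: cvg_trans (near_eq_cvg h) (fc _ x0).
Qed.

Lemma continuous_C0 f : continuous f -> C0 f.
Proof. by move=> fc x _; exact: fc. Qed.

Lemma C0_cst (c : R) : C0 (fun=> c).
Proof. by move=> x _; exact: cst_continuous. Qed.

Lemma C0_add f g : C0 f -> C0 g -> C0 (fun x => f x + g x).
Proof. by move=> fc gc x x0; apply: continuousD; [exact: fc|exact: gc]. Qed.

Lemma C0_opp f : C0 f -> C0 (fun x => - f x).
Proof. by move=> fc x x0; apply: continuousN; exact: fc. Qed.

Lemma C0_mul f g : C0 f -> C0 g -> C0 (fun x => f x * g x).
Proof. by move=> fc gc x x0; apply: continuousM; [exact: fc|exact: gc]. Qed.

Lemma C0_sum (I : Type) (s : seq I) (F : I -> V -> R) : (forall k, C0 (F k)) ->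
  C0 (fun x => \sum_(k <- s) F k x).
Proof.
move=> Fc; elim: s => [|a s IH].
  by refine (C0_ext _ (@C0_cst 0)) => x _; rewrite big_nil.
by refine (C0_ext _ (C0_add (Fc a) IH)) => x _; rewrite big_cons.
Qed.

Lemma pdsum n x v (F : 'I_n -> V -> R) (d : 'I_n -> R) :
  (forall k, is_derive x v (F k) (d k)) ->
  is_derive x v (fun y => \sum_(k < n) F k y) (\sum_(k < n) d k).
Proof.
move=> h; have := is_derive_sum h.
by rewrite (_ : \sum_(k < n) F k = fun y => \sum_(k < n) F k y)//; apply/funext => y; rewrite fct_sumE.
Qed.

Lemma pdE x i f d : is_derive x (evec R i) f d -> pder i f x = d.
Proof. by move=> h; rewrite /pder derive_val. Qed.

Lemma coord_shift x i k t : (t *: evec R i + x) 0 k = t * (k == i)%:R + x 0 k.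
Proof. by rewrite !mxE eqxx. Qed.

Lemma pdline x v f d : is_derive (0 : R) 1 (fun t => f (t *: v + x)) d ->
  is_derive x v f d.
Proof.
move=> h; have E : (fun h : R => h^-1 *: ((f \o shift x) (h *: v) - f x))
   = (fun h : R => h^-1 *: (((fun t => f (t *: v + x)) \o shift 0) (h *: 1) - f (0 *: v + x))).
  apply/funext => t /=; congr (_ *: (f _ - f _)).
    by rewrite [t *: 1]mulr1 addr0.
  by rewrite scale0r add0r.
have dd : derivable (fun t : R => f (t *: v + x)) (0:R) 1 := @ex_derive _ _ _ _ _ _ _ h.
apply: DeriveDef; first by rewrite /derivable E.
by rewrite /derive E; rewrite -(@derive_val _ _ _ _ _ _ _ h).
Qed.

Lemma pdX x i k : is_derive x (evec R i) (fun y => y 0 k) (k == i)%:R.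
Proof.
apply: pdline.
rewrite (_ : (fun t => _) = (fun t : R => t * (k == i)%:R + x 0 k)); last first.
  by apply/funext => t; rewrite coord_shift.
have := @is_deriveD _ _ _ _ _ _ _ _ _ (@is_deriveM _ _ id (cst (k == i)%:R) (0:R) 1 _ _ (is_derive_id _ _) (is_derive_cst _ _ _)) (is_derive_cst (x 0 k) (0:R) (1:R)).
move=> h; apply: (is_derive_eq h).
by rewrite /= scaler0 add0r addr0 [_ *: 1]mulr1.
Qed.

Lemma C0_coord k : C0 (fun x => x 0 k).
Proof. by apply: continuous_C0; exact: coord_continuous. Qed.

Definition sqn x := \sum_k x 0 k ^+ 2.

Lemma sqn_ge0 x : 0 <= sqn x.
Proof. by apply: sumr_ge0 => k _; exact: sqr_ge0. Qed.

Lemma sqn_gt0 x : x != 0 -> 0 < sqn x.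
Proof.
move=> x0; rewrite lt_def sqn_ge0 andbT; apply: contra_neq x0 => s0.
apply/rowP => k; rewrite mxE; apply/eqP; rewrite -sqrf_eq0; apply/eqP.
by have /psumr_eq0P := s0; apply => // j _; exact: sqr_ge0.
Qed.

Lemma geod_r2 x : geod_r x ^+ 2 = sqn x.
Proof. by rewrite /geod_r sqr_sqrtr ?sqn_ge0. Qed.

Lemma geod_r_ge0 x : 0 <= geod_r x. Proof. exact: sqrtr_ge0. Qed.

Lemma geod_r_gt0 x : x != 0 -> 0 < geod_r x.
Proof. by move=> x0; rewrite /geod_r sqrtr_gt0; exact: sqn_gt0. Qed.

Lemma continuous_sqn : continuous sqn.
Proof.
rewrite /sqn; elim: (index_enum _) => [|a s IH].
  under eq_fun do rewrite big_nil.
  exact: cst_continuous.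
have -> : (fun x : V => \sum_(k <- a :: s) x 0 k ^+ 2) =
    (fun x : V => x 0 a * x 0 a + \sum_(k <- s) x 0 k ^+ 2).
  by apply/funext => x; rewrite big_cons.
move=> x; pose f1 := fun x : V => x 0 a * x 0 a.
pose f2 := fun x : V => \sum_(k <- s) x 0 k ^+ 2.
have h : {for x, continuous (f1 + f2)}.
  apply: continuousD; last exact: IH.
  by apply: continuousM; exact: coord_continuous.
exact: h.
Qed.

Lemma continuous_geod_r : continuous (@geod_r R N).
Proof.
move=> x; apply: (@continuous_comp _ _ _ sqn Num.sqrt); first exact: continuous_sqn.
exact: sqrt_continuous.
Qed.

Lemma pdr x i : x != 0 -> is_derive x (evec R i) (@geod_r R N) (x 0 i / geod_r x).
Proof.
move=> x0; apply: pdline.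
(* Along a coordinate line r^2 is a quadratic polynomial in t, so only the one-variable derivative
   of the square root is needed. *)
pose q : R -> R := fun t => t ^+ 2 + (2 * x 0 i) * t + sqn x.
have qE t : sqn (t *: evec R i + x) = q t.
  rewrite /q /sqn (bigD1 i) //= [in RHS](bigD1 i) //= coord_shift eqxx.
  under eq_bigr => k ki do rewrite coord_shift (negbTE ki) mulr0 add0r.
  by rewrite mulr1; ring.
rewrite (_ : (fun t => _) = Num.sqrt \o q); last first.
  by apply/funext => t; rewrite /geod_r /= -qE.
have q0 : q 0 = sqn x by rewrite /q; ring.
have dq : is_derive (0:R) 1 q (2 * x 0 i).
  rewrite /q.
  have h1 := @is_deriveX R R id 2 (0:R) 1 1 (is_derive_id (0:R) (1:R)).
  have h2 := @is_deriveZ R R R id (2 * x 0 i) (0:R) 1 1 (is_derive_id (0:R) (1:R)).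
  have h := is_deriveD (is_deriveD h1 h2) (is_derive_cst (sqn x) (0:R) (1:R)).
  apply: (is_derive_eq h).
  by rewrite /= expr1 mulr0 scale0r add0r addr0 [_ *: 1]mulr1.
have ds : is_derive (q 0) 1 Num.sqrt ((2 * Num.sqrt (q 0))^-1).
  by apply: is_derive1_sqrt; rewrite q0; exact: sqn_gt0.
have h := is_derive1_comp ds dq.
apply: (is_derive_eq h).
rewrite q0 -/(geod_r x); have := geod_r_gt0 x0; rewrite -/(geod_r x) => r0.
rewrite /geod_r -/(sqn x) in r0 *.
by field; rewrite gt_eqF.
Qed.

Definition rad (phi : R -> R) : V -> R := fun x => phi (geod_r x).

Definition C0p (phi : R -> R) := forall t, 0 < t -> {for t, continuous phi}.

Lemma C0_rad phi : C0p phi -> C0 (rad phi).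
Proof.
move=> pc x x0; apply: continuous_comp; first exact: continuous_geod_r.
exact/pc/geod_r_gt0.
Qed.

Lemma pdrad x i phi (d : R) : x != 0 -> is_derive (geod_r x) 1 phi d ->
  is_derive x (evec R i) (rad phi) (d * (x 0 i / geod_r x)).
Proof.
move=> x0 dphi; apply: pdline; rewrite /rad.
have h : is_derive (0:R) 1 (fun t : R => geod_r (t *: evec R i + x)) (x 0 i / geod_r x).
  have H := pdr i x0.
  have := @line_is_derive R N (@geod_r R N) x (evec R i) 0.
  rewrite scale0r add0r (@derive_val _ _ _ _ _ _ _ H) => /(_ (@ex_derive _ _ _ _ _ _ _ H)) //.
apply: (@is_derive1_comp _ phi (fun t : R => geod_r (t *: evec R i + x)) 0 _ _ _ h).
by rewrite scale0r add0r.
Qed.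

Lemma C1_rad (phi dphi : R -> R) : (forall t : R, 0 < t -> is_derive t 1 phi (dphi t)) ->
  C0p dphi -> C1 (rad phi).
Proof.
move=> h dc; have pc : C0p phi.
  by move=> t t0; apply/differentiable_continuous/derivable1_diffP; exact: (@ex_derive _ _ _ _ _ _ _ (h t t0)).
split; first exact: C0_rad.
have d x i : x != 0 -> is_derive x (evec R i) (rad phi) (dphi (geod_r x) * (x 0 i / geod_r x)).
  by move=> x0; apply: pdrad => //; apply: h; exact: geod_r_gt0.
move=> i; split; first by move=> x x0; exact: (@ex_derive _ _ _ _ _ _ _ (d x i x0)).
apply: (@C0_ext (fun x => dphi (geod_r x) * (x 0 i * (geod_r x)^-1))).
  by move=> x x0; rewrite (pdE (d x i x0)).
apply: C0_mul; first exact: C0_rad.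
apply: C0_mul; first exact: C0_coord.
apply: (@C0_rad (fun t => t^-1)) => t t0; apply: inv_continuous; exact: lt0r_neq0.
Qed.

Lemma C1_pd f i x : C1 f -> x != 0 -> is_derive x (evec R i) f (pder i f x).
Proof. by move=> [_ h] x0; apply: derivableP; exact: (h i).1. Qed.

Lemma C1_intro f (d : 'I_N -> V -> R) : C0 f ->
  (forall i x, x != 0 -> is_derive x (evec R i) f (d i x)) ->
  (forall i, C0 (d i)) -> C1 f.
Proof.
move=> fc fd dc; split=> // i; split.
  by move=> x x0; exact: (@ex_derive _ _ _ _ _ _ _ (fd i x x0)).
by refine (C0_ext _ (dc i)) => x x0; rewrite (pdE (fd i x x0)).
Qed.

Lemma C1_cst (c : R) : C1 (fun=> c).
Proof.
apply: (@C1_intro (fun=> c) (fun _ _ => 0)).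
- exact: C0_cst.
- by move=> i; exact: C0_cst.
Qed.

Lemma C1_coord k : C1 (fun x => x 0 k).
Proof.
apply: (@C1_intro (fun x => x 0 k) (fun i _ => (k == i)%:R)).
- exact: C0_coord.
- by move=> i x _; exact: pdX.
- by move=> i; exact: C0_cst.
Qed.

Lemma C1_add f g : C1 f -> C1 g -> C1 (fun x => f x + g x).
Proof.
move=> fc gc; apply: (@C1_intro _ (fun i x => pder i f x + pder i g x)).
- by apply: C0_add; [exact: fc.1|exact: gc.1].
- by move=> i x x0; apply: pdD; exact: C1_pd.
- by move=> i; apply: C0_add; [exact: (fc.2 i).2|exact: (gc.2 i).2].
Qed.

Lemma C1_opp f : C1 f -> C1 (fun x => - f x).
Proof.
move=> fc; apply: (@C1_intro _ (fun i x => - pder i f x)).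
- by apply: C0_opp; exact: fc.1.
- by move=> i x x0; apply: pdN; exact: C1_pd.
- by move=> i; apply: C0_opp; exact: (fc.2 i).2.
Qed.

Lemma C1_mul f g : C1 f -> C1 g -> C1 (fun x => f x * g x).
Proof.
move=> fc gc; apply: (@C1_intro _ (fun i x => f x * pder i g x + g x * pder i f x)).
- by apply: C0_mul; [exact: fc.1|exact: gc.1].
- by move=> i x x0; apply: pdM; exact: C1_pd.
- by move=> i; apply: C0_add; apply: C0_mul; solve [exact: fc.1|exact: gc.1|exact: (fc.2 i).2|exact: (gc.2 i).2].
Qed.

Lemma C1_sum n (F : 'I_n -> V -> R) : (forall k, C1 (F k)) ->
  C1 (fun x => \sum_(k < n) F k x).
Proof.
move=> Fc; apply: (@C1_intro _ (fun i x => \sum_(k < n) pder i (F k) x)).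
- by apply: C0_sum => k; exact: (Fc k).1.
- by move=> i x x0; apply: pdsum => k; exact: C1_pd.
- by move=> i; apply: C0_sum => k; exact: ((Fc k).2 i).2.
Qed.

End Calc.

(** * Symmetry of mixed derivatives *)

Section Schwarz.
Context {R : realType} {N : nat}.
Notation V := 'rV[R]_N.
Implicit Types (x y : V) (f g : V -> R) (i j : 'I_N).

(** The mean value theorem twice: in direction [i] for the increment of [f] in direction [j], then
    in direction [j] for [pder i f]. *)
Lemma second_difference f x i j (s : R) :
  (forall y, derivable f y (evec R i)) ->
  (forall y, derivable (pder i f) y (evec R j)) -> 0 < s ->
  exists c c' : R, [/\ 0 <= c <= s, 0 <= c' <= s &
    f (s *: evec R i + (s *: evec R j + x)) - f (s *: evec R j + x)
    - f (s *: evec R i + x) + f x =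
    s * s * pder j (pder i f) (c' *: evec R j + (c *: evec R i + x))].
Proof.
move=> fi fij s0.
pose g y := f (s *: evec R j + y) - f y.
have gP y : is_derive y (evec R i) g (pder i f (s *: evec R j + y) - pder i f y).
  apply: pdD; last by apply: pdN; exact: derivableP.
  have H : is_derive (s *: evec R j + y) (evec R i) f (pder i f (s *: evec R j + y)) by exact: derivableP.
  apply: pdline.
  rewrite (_ : (fun t => _) = (fun t : R => f (t *: evec R i + (s *: evec R j + y)))); last first.
    by apply/funext => t; rewrite addrCA.
  have := @line_is_derive R N f (s *: evec R j + y) (evec R i) 0.
  by rewrite scale0r add0r => /(_ (fi _)).
have gd y : derivable g y (evec R i) by exact: (@ex_derive _ _ _ _ _ _ _ (gP y)).
have [c cs Ec] := line_MVT x gd s0.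
have [c' c's Ec'] := line_MVT (c *: evec R i + x) fij s0.
exists c, c'; split => //.
rewrite -mulrA -Ec' -(pdE (gP _)) -Ec /g addrCA; ring.
Qed.

Lemma corner_dist x (k l : 'I_N) (a a' s : R) :
  0 <= a -> a <= s -> 0 <= a' -> a' <= s ->
  `|x - (a' *: evec R k + (a *: evec R l + x))| <= s + s.
Proof.
move=> a0 as_ a'0 a's.
have -> : x - (a' *: evec R k + (a *: evec R l + x)) = - (a' *: evec R k + a *: evec R l).
  by rewrite addrA opprD addrCA subrr addr0.
rewrite normrN (le_trans (ler_normD _ _)) // !normrZ !ger0_norm //.
by apply: lerD; [apply: le_trans a's|apply: le_trans as_];
  rewrite ler_piMr // norm_evec.
Qed.

(** The second difference is symmetric in [i] and [j], so the two mixed derivatives take a common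
    value at points within [2 s] of [x]; continuity at [x] concludes. *)
Lemma pder_comm f i j :
  (forall y, derivable f y (evec R i)) -> (forall y, derivable f y (evec R j)) ->
  (forall y, derivable (pder i f) y (evec R j)) ->
  (forall y, derivable (pder j f) y (evec R i)) ->
  continuous (pder j (pder i f)) -> continuous (pder i (pder j f)) ->
  pder j (pder i f) =1 pder i (pder j f).
Proof.
move=> fi fj fij fji cij cji x.
apply/eqP; rewrite -subr_eq0 -normr_eq0 eq_le normr_ge0 andbT.
apply/ler_addgt0Pl => e e0; rewrite addr0.
have e20 : 0 < e / 2 by rewrite divr_gt0.
have /cvgrPdist_le /(_ _ e20) /nbhs_normP [d1 /= d10 h1] := cij x.
have /cvgrPdist_le /(_ _ e20) /nbhs_normP [d2 /= d20 h2] := cji x.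
pose s := Num.min d1 d2 / 3.
have d0 : 0 < Num.min d1 d2 by rewrite lt_min d10.
have sd : s + s < Num.min d1 d2.
  by rewrite /s; move: (Num.min d1 d2) d0 => m m0; lra.
have s0 : 0 < s by rewrite divr_gt0.
have [c [c' [/andP[c0 cs] /andP[c'0 c's] E1]]] := second_difference x fi fij s0.
have [b [b' [/andP[b0 bs] /andP[b'0 b's] E2]]] := second_difference x fj fji s0.
have EE : pder j (pder i f) (c' *: evec R j + (c *: evec R i + x)) =
   pder i (pder j f) (b' *: evec R i + (b *: evec R j + x)).
  have ss : s * s != 0 by rewrite mulf_neq0 // gt_eqF.
  apply: (mulfI ss); apply: (etrans (esym E1)); apply: (etrans _ E2).
  by congr (_ + _); rewrite (addrCA (s *: evec R i)) addrAC.
have N1 := le_lt_trans (corner_dist x j i c0 cs c'0 c's) sd.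
have N2 := le_lt_trans (corner_dist x i j b0 bs b'0 b's) sd.
move: N1 N2; rewrite !lt_min => /andP[/h1 N1 _] /andP[_ /h2 N2].
apply: le_trans (ler_distD (pder j (pder i f) (c' *: evec R j + (c *: evec R i + x))) _ _) _.
by rewrite [leRHS]splitr; apply: lerD; [exact: N1|rewrite EE distrC; exact: N2].
Qed.

Section Smooth.
Variable u : V -> R.
Hypothesis su : smooth u.

Lemma smooth_C1 (l : seq 'I_N) : C1 (pder_seq l u).
Proof.
split; first by apply: continuous_C0; exact: (su l).1.
move=> i; split; first by move=> x _; exact: (su l).2.
by apply: continuous_C0; exact: (su (i :: l)).1.
Qed.

Lemma smooth_comm (l : seq 'I_N) i j x :
  pder j (pder i (pder_seq l u)) x = pder i (pder j (pder_seq l u)) x.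
Proof.
apply: pder_comm => [y|y|y|y||].
- exact: (su l).2.
- exact: (su l).2.
- exact: (su (i :: l)).2.
- exact: (su (j :: l)).2.
- exact: (su (j :: i :: l)).1.
- exact: (su (i :: j :: l)).1.
Qed.

End Smooth.

End Schwarz.

(** * The divergence theorem for fields cut off at the pole *)

Section Divergence.
Context {R : realType} {N : nat}.
Notation V := 'rV[R]_N.
Implicit Types (x y : V) (f g : V -> R) (i j : 'I_N).

Lemma continuous_of_C0 f (rho : R) : 0 < rho -> C0 f ->
  (forall x, `|x| < rho -> f x = 0) -> continuous f.
Proof.
move=> rho0 fc f0 x; have [->|x0] := eqVneq x 0; last exact: fc.
have h : {near (0:V), (fun=> 0) =1 f}.
  have : \forall y \near (0:V), `|y| < rho.
    by apply/nbhs_normP; exists rho => //= y /=; rewrite sub0r normrN.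
  by apply: filterS => y /f0.
have h0 : f 0 = 0 by rewrite f0 // normr0.
suff : f y @[y --> (0:V)] --> f 0 by [].
rewrite h0; apply: cvg_trans (near_eq_cvg h) _; exact: cvg_cst.
Qed.

Lemma iter_int_pder_C1 (A rho : R) (g : V -> R) i : 0 <= A -> 0 < rho -> C1 g ->
  (forall x, A < `|x| -> g x = 0) -> (forall x, `|x| < rho -> g x = 0) ->
  continuous (pder i g) /\ iter_int N (pder i g) 0 = 0.
Proof.
move=> A0 rho0 gc gA grho.
have near0 x : `|x| < rho -> {near x, cst 0 =1 g}.
  move=> xr; have : \forall y \near x, `|y| < rho.
    by apply: (@cvgr_lt _ _ _ (nbhs_filter x) (fun y : V => `|y|) `|x|) => //; exact: norm_continuous.
  by apply: filterS => y /grho.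
have dc : continuous (pder i g).
  apply: (continuous_of_C0 rho0 (gc.2 i).2) => x /near0 h.
  by rewrite /pder -(near_eq_derive _ h) derive_cst.
split => //; apply: (iter_int_pder A0) => //.
- exact: (continuous_of_C0 rho0 gc.1).
- move=> x; have [xr|xr] := ltP `|x| rho.
    exact: (near_eq_derivable (near0 x xr)).
  apply: (gc.2 i).1; apply: contraTneq xr => ->.
  by rewrite normr0 -ltNge.
Qed.

Lemma iter_int_sum (A : R) n (F : 'I_n -> V -> R) x : 0 <= A ->
  (forall k, ucont (F k)) -> (forall k, vanish A 0 (F k)) ->
  [/\ ucont (fun y => \sum_k F k y), vanish A 0 (fun y => \sum_k F k y) &
   iter_int N (fun y => \sum_k F k y) x = \sum_k iter_int N (F k) x].
Proof.
move=> A0 Fu Fv; elim: n F Fu Fv => [|n IH] F Fu Fv.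
  have -> : (fun y => \sum_(k < 0) F k y) = (fun=> 0).
    by apply/funext => y; rewrite big_ord0.
  by rewrite big_ord0 iter_int0; split => //; exact: ucont0.
have [u1 v1 E1] := IH (fun k => F (lift ord0 k)) (fun k => Fu _) (fun k => Fv _).
have -> : (fun y => \sum_k F k y) =
    (fun y => 1 * F ord0 y + 1 * \sum_k F (lift ord0 k) y).
  by apply/funext => y; rewrite big_ord_recl !mul1r.
split; first exact: ucont_lin.
  by move=> y k k0 hk; rewrite (Fv _ _ _ k0 hk) (v1 _ _ k0 hk) !mulr0 addr0.
by rewrite (iter_int_lin _ _ _ A0) // E1 !mul1r big_ord_recl.
Qed.

(** Vanishing on a ball around the origin turns regularity off the origin into global regularity,
    after which each partial derivative integrates to 0. *)
Lemma iter_int_div (A rho : R) (F : 'I_N -> V -> R) : 0 <= A -> 0 < rho ->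
  (forall i, C1 (F i)) ->
  (forall i x, A < `|x| -> F i x = 0) -> (forall i x, `|x| < rho -> F i x = 0) ->
  [/\ ucont (fun x => \sum_i pder i (F i) x),
     vanish A 0 (fun x => \sum_i pder i (F i) x) &
     iter_int N (fun x => \sum_i pder i (F i) x) 0 = 0].
Proof.
move=> A0 rho0 Fc FA Frho.
have h i := iter_int_pder_C1 i A0 rho0 (Fc i) (FA i) (Frho i).
have d0 i x : A < `|x| -> pder i (F i) x = 0 by move=> xA; apply: (pder_vanish _ (FA i)).
have [uS vS ->] := @iter_int_sum A N (fun i => pder i (F i)) 0 A0
  (fun i => continuous_cpt_ucont (h i).1 (d0 i)) (fun i => (vanishP _ A0).1 (d0 i)).
by split => //; rewrite big1 // => i _; exact: (h i).2.
Qed.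

End Divergence.

Section Deriv.
Context {R : realType} {N : nat}.
Notation V := 'rV[R]_N.
Implicit Types (x y : V) (f g : V -> R) (i j k : 'I_N) (a : 'I_N -> R).

Definition Dv a f x := \sum_i a i * pder i f x.

(* The direction [a] is frozen at [x]: a = x gives the Euler field r d/dr, and
   a = sph_grad u x the derivative along the spherical gradient of [u]. *)
Definition hasD a x f (d : R) := C1 f /\ Dv a f x = d.

Variables (a : 'I_N -> R) (x : V).
Hypothesis x0 : x != 0.

Lemma hasD_eq f d d' : hasD a x f d -> d = d' -> hasD a x f d'.
Proof. by move=> h <-. Qed.

Lemma hasD_cst (c : R) : hasD a x (fun=> c) 0.
Proof.
split; first exact: C1_cst.
by rewrite /Dv big1 // => i _; rewrite (pdE (pdC x (evec R i) c)) mulr0.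
Qed.

Lemma hasD_add f g df dg : hasD a x f df -> hasD a x g dg ->
  hasD a x (fun y => f y + g y) (df + dg).
Proof.
move=> [fc <-] [gc <-]; split; first exact: C1_add.
rewrite /Dv -big_split; apply: eq_bigr => i _ /=.
by rewrite (pdE (pdD (C1_pd i fc x0) (C1_pd i gc x0))) mulrDr.
Qed.

Lemma hasD_opp f df : hasD a x f df -> hasD a x (fun y => - f y) (- df).
Proof.
move=> [fc <-]; split; first exact: C1_opp.
rewrite /Dv -sumrN; apply: eq_bigr => i _ /=.
by rewrite (pdE (pdN (C1_pd i fc x0))) mulrN.
Qed.

Lemma hasD_mul f g df dg : hasD a x f df -> hasD a x g dg ->
  hasD a x (fun y => f y * g y) (f x * dg + g x * df).
Proof.
move=> [fc <-] [gc <-]; split; first exact: C1_mul.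
rewrite /Dv !mulr_sumr -big_split; apply: eq_bigr => i _ /=.
by rewrite (pdE (pdM (C1_pd i fc x0) (C1_pd i gc x0))); ring.
Qed.

Lemma hasD_rad (phi dphi : R -> R) :
  (forall t : R, 0 < t -> is_derive t 1 phi (dphi t)) -> C0p dphi ->
  hasD a x (rad phi) (dphi (geod_r x) / geod_r x * \sum_i a i * x 0 i).
Proof.
move=> h dc; split; first exact: (C1_rad h).
rewrite /Dv mulr_sumr; apply: eq_bigr => i _.
by rewrite (pdE (pdrad i x0 (h _ (geod_r_gt0 x0)))); ring.
Qed.

End Deriv.

(** * Contractions of the derivatives of u *)

Section Euclid.
Context {R : realType} {N : nat}.
Notation V := 'rV[R]_N.
Implicit Types (x y : V) (f g : V -> R) (i j k l m : 'I_N) (a : 'I_N -> R).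
Variable u : V -> R.
Hypothesis su : smooth u.

(* In terms of p = grad u, H = Hess u and the third derivatives:
   ue = x.p, uP = |p|^2, uHp = H p, uHx = H x, uh1 = x.Hx, uh2 = p.Hx,
   uh3 = |Hx|^2, uh4 = tr H, uh5 = |H|^2; ugx, ugp, utr, uw are the contractions
   of the third derivatives with x, with p, with the identity and with x twice,
   and ug1, .., ug4 are p.utr, x.utr, p.uw, x.uw. *)
Definition hess j k := pder j (pder k u).
Definition third i j k := pder i (hess j k).

Lemma pder_C1 k : C1 (pder k u). Proof. exact: (smooth_C1 su [:: k]). Qed.
Lemma hess_C1 j k : C1 (hess j k). Proof. exact: (smooth_C1 su [:: j; k]). Qed.

Lemma hess_sym j k x : hess j k x = hess k j x.
Proof. exact: (smooth_comm su [::]). Qed.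

Lemma third_sym12 i j k x : third i j k x = third j i k x.
Proof. exact: (smooth_comm su [:: k]). Qed.

Lemma third_sym23 i j k x : third i j k x = third i k j x.
Proof.
by rewrite /third; have -> : hess j k = hess k j by apply/funext => y; exact: hess_sym.
Qed.

Definition ue x := \sum_k x 0 k * pder k u x.
Definition uP x := \sum_k pder k u x * pder k u x.
Definition uHp k x := \sum_l hess k l x * pder l u x.
Definition uHx k x := \sum_l hess k l x * x 0 l.
Definition uh1 x := \sum_k x 0 k * uHx k x.
Definition uh2 x := \sum_k pder k u x * uHx k x.
Definition uh3 x := \sum_k uHx k x * uHx k x.
Definition uh4 x := \sum_k hess k k x.
Definition uh5 x := \sum_k \sum_l hess k l x * hess k l x.
Definition ugx i k x := \sum_m third i k m x * x 0 m.
Definition ugp i k x := \sum_m third i k m x * pder m u x.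
Definition utr i x := \sum_k third i k k x.
Definition uw i x := \sum_k x 0 k * ugx i k x.
Definition ug1 x := \sum_k pder k u x * utr k x.
Definition ug2 x := \sum_k x 0 k * utr k x.
Definition ug3 x := \sum_k pder k u x * uw k x.
Definition ug4 x := \sum_k x 0 k * uw k x.

Lemma Hp_x x : \sum_k x 0 k * uHp k x = uh2 x.
Proof.
rewrite /uh2 /uHp /uHx.
under eq_bigr do rewrite mulr_sumr.
rewrite exchange_big /=; apply: eq_bigr => l _; rewrite mulr_sumr.
by apply: eq_bigr => k _; rewrite (hess_sym l k); ring.
Qed.

Lemma gx_x k x : \sum_i x 0 i * ugx i k x = uw k x.
Proof.
have E i : ugx i k x = ugx k i x.
  rewrite /ugx.
  apply: eq_bigr => m _.
  rewrite (third_sym12 i k m).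
  by [].
apply: eq_bigr => i _.
rewrite E.
by [].
Qed.

(** Full symmetry of [third] turns the trace over the first two indices into a derivative of [uh4].
    This is the commutation behind the Bochner formula; in the flat chart it produces no curvature
    term. *)
Lemma gp_tr x : \sum_k ugp k k x = ug1 x.
Proof.
rewrite /ugp /ug1 exchange_big /=; apply: eq_bigr => m _.
rewrite /utr mulr_sumr; apply: eq_bigr => k _.
by rewrite third_sym23 third_sym12 mulrC.
Qed.

Lemma gx_tr x : \sum_k ugx k k x = ug2 x.
Proof.
rewrite /ugx /ug2 exchange_big /=; apply: eq_bigr => m _.
rewrite /utr mulr_sumr; apply: eq_bigr => k _.
by rewrite third_sym23 third_sym12 mulrC.
Qed.

Lemma Hx_C1 k : C1 (uHx k).
Proof. by apply: C1_sum => l; apply: C1_mul; [exact: hess_C1|exact: C1_coord]. Qed.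
Lemma Hp_C1 k : C1 (uHp k).
Proof. by apply: C1_sum => l; apply: C1_mul; [exact: hess_C1|exact: pder_C1]. Qed.
Lemma e_C1 : C1 ue.
Proof. by apply: C1_sum => l; apply: C1_mul; [exact: C1_coord|exact: pder_C1]. Qed.
Lemma P_C1 : C1 uP.
Proof. by apply: C1_sum => l; apply: C1_mul; exact: pder_C1. Qed.
Lemma h1_C1 : C1 uh1.
Proof. by apply: C1_sum => l; apply: C1_mul; [exact: C1_coord|exact: Hx_C1]. Qed.
Lemma h2_C1 : C1 uh2.
Proof. by apply: C1_sum => l; apply: C1_mul; [exact: pder_C1|exact: Hx_C1]. Qed.
Lemma h4_C1 : C1 uh4.
Proof. by apply: C1_sum => l; exact: hess_C1. Qed.

Lemma sqn_C1 : C1 (@sqn R N).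
Proof. by apply: C1_sum => l; apply: C1_mul; exact: C1_coord. Qed.

Section AtPoint.
Variable x : V.
Hypothesis x0 : x != 0.

Lemma pd_p i k : is_derive x (evec R i) (pder k u) (hess i k x).
Proof. exact: (C1_pd i (pder_C1 k) x0). Qed.

Lemma pd_hess i j k : is_derive x (evec R i) (hess j k) (third i j k x).
Proof. exact: (C1_pd i (hess_C1 j k) x0). Qed.

Lemma pd_sqn i : is_derive x (evec R i) (@sqn R N) (2 * x 0 i).
Proof.
apply: (pd_eq (pdsum (fun k => pdM (pdX x i k) (pdX x i k)))).
rewrite big_split /= sum_delta; ring.
Qed.

Lemma pd_e i : is_derive x (evec R i) ue (pder i u x + uHx i x).
Proof.
apply: (pd_eq (pdsum (fun k => pdM (pdX x i k) (pd_p i k)))).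
rewrite big_split /= sum_delta addrC; congr (_ + _).
by apply: eq_bigr => k _; rewrite mulrC.
Qed.

Lemma pd_P i : is_derive x (evec R i) uP (2 * uHp i x).
Proof.
apply: (pd_eq (pdsum (fun k => pdM (pd_p i k) (pd_p i k)))).
rewrite /uHp mulr_sumr; apply: eq_bigr => k _; ring.
Qed.

Lemma pd_Hx i k : is_derive x (evec R i) (uHx k) (ugx i k x + hess k i x).
Proof.
apply: (pd_eq (pdsum (fun l => pdM (pd_hess i k l) (pdX x i l)))).
rewrite big_split /= sum_delta addrC; congr (_ + _).
by apply: eq_bigr => l _; rewrite mulrC.
Qed.

Lemma pd_Hp i k : is_derive x (evec R i) (uHp k)
  (ugp i k x + \sum_l hess k l x * hess i l x).
Proof.
apply: (pd_eq (pdsum (fun l => pdM (pd_hess i k l) (pd_p i l)))).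
rewrite big_split /= addrC; congr (_ + _).
by apply: eq_bigr => l _; rewrite mulrC.
Qed.

Lemma pd_h1 i : is_derive x (evec R i) uh1 (2 * uHx i x + uw i x).
Proof.
apply: (pd_eq (pdsum (fun k => pdM (pdX x i k) (pd_Hx i k)))).
rewrite big_split /= sum_delta.
under eq_bigr do rewrite mulrDr.
rewrite big_split /= -/(uw i x).
have -> : \sum_k x 0 k * hess k i x = uHx i x.
  by apply: eq_bigr => k _; rewrite hess_sym mulrC.
ring.
Qed.

Lemma pd_h2 i : is_derive x (evec R i) uh2
  (\sum_k hess i k x * uHx k x + \sum_k pder k u x * ugx i k x + uHp i x).
Proof.
apply: (pd_eq (pdsum (fun k => pdM (pd_p i k) (pd_Hx i k)))).
rewrite big_split /= addrC -addrA; congr (_ + _).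
  by apply: eq_bigr => k _; rewrite mulrC.
rewrite /uHp -big_split; apply: eq_bigr => k _ /=; rewrite (hess_sym k i); ring.
Qed.

Lemma pd_h4 i : is_derive x (evec R i) uh4 (utr i x).
Proof. exact: (pdsum (fun k => pd_hess i k k)). Qed.

Section Dir.
Variable a : 'I_N -> R.
Notation "<< b >>" := (\sum_i a i * b i).

Lemma hasD_pd f (d : 'I_N -> R) : C1 f ->
  (forall i, is_derive x (evec R i) f (d i)) -> hasD a x f (<< d >>).
Proof.
by move=> fc h; split => //; apply: eq_bigr => i _; rewrite (pdE (h i)).
Qed.

Lemma hasD_sqn : hasD a x (@sqn R N) (2 * \sum_i a i * x 0 i).
Proof.
apply: (hasD_eq (hasD_pd sqn_C1 pd_sqn)).
by rewrite mulr_sumr; apply: eq_bigr => i _; ring.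
Qed.

Lemma hasD_e : hasD a x ue (\sum_i a i * pder i u x + \sum_i a i * uHx i x).
Proof.
apply: (hasD_eq (hasD_pd e_C1 pd_e)).
by rewrite -big_split; apply: eq_bigr => i _ /=; ring.
Qed.

Lemma hasD_P : hasD a x uP (2 * \sum_i a i * uHp i x).
Proof.
apply: (hasD_eq (hasD_pd P_C1 pd_P)).
by rewrite mulr_sumr; apply: eq_bigr => i _ /=; ring.
Qed.

Lemma hasD_h1 : hasD a x uh1 (2 * \sum_i a i * uHx i x + \sum_i a i * uw i x).
Proof.
apply: (hasD_eq (hasD_pd h1_C1 pd_h1)).
by rewrite mulr_sumr -big_split; apply: eq_bigr => i _ /=; ring.
Qed.

Lemma hasD_h4 : hasD a x uh4 (\sum_i a i * utr i x).
Proof. exact: (hasD_pd h4_C1 pd_h4). Qed.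

End Dir.

Notation xc := (fun i => x 0 i).

Lemma E_sqn : hasD xc x (@sqn R N) (2 * sqn x).
Proof. exact: hasD_sqn. Qed.
Lemma E_e : hasD xc x ue (ue x + uh1 x).
Proof. exact: hasD_e. Qed.
Lemma E_P : hasD xc x uP (2 * uh2 x).
Proof. by apply: (hasD_eq (hasD_P xc)); rewrite Hp_x. Qed.
Lemma E_h1 : hasD xc x uh1 (2 * uh1 x + ug4 x).
Proof. exact: hasD_h1. Qed.
Lemma E_h2 : hasD xc x uh2 (uh3 x + ug3 x + uh2 x).
Proof.
apply: (hasD_eq (hasD_pd xc h2_C1 pd_h2)).
under eq_bigr do rewrite !mulrDr.
rewrite !big_split /= Hp_x; congr (_ + _ + _).
  under eq_bigr do rewrite mulr_sumr.
  rewrite exchange_big /=; apply: eq_bigr => k _.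
  rewrite /uHx mulr_suml; apply: eq_bigr => i _.
  by rewrite (hess_sym k i); ring.
under eq_bigr do rewrite mulr_sumr.
rewrite exchange_big /=; apply: eq_bigr => k _.
rewrite -gx_x mulr_sumr; apply: eq_bigr => i _; ring.
Qed.

(* r^2 times the component of grad u orthogonal to x. *)
Definition sph_grad i x := sqn x * pder i u x + - (x 0 i * ue x).

Notation Yc := (fun i => sph_grad i x).

Lemma sph_grad_sum (b : 'I_N -> R) : \sum_i sph_grad i x * b i =
  sqn x * (\sum_i pder i u x * b i) - ue x * (\sum_i x 0 i * b i).
Proof.
rewrite !mulr_sumr -sumrB; apply: eq_bigr => i _; rewrite /sph_grad; ring.
Qed.

Lemma x_sph_grad : \sum_i sph_grad i x * x 0 i = 0.
Proof.
rewrite sph_grad_sum; have -> : \sum_i pder i u x * x 0 i = ue x.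
  by apply: eq_bigr => i _; rewrite mulrC.
have -> : \sum_i x 0 i * x 0 i = sqn x by [].
ring.
Qed.

Lemma Yd_sqn : hasD Yc x (@sqn R N) 0.
Proof. by apply: (hasD_eq (hasD_sqn Yc)); rewrite x_sph_grad mulr0. Qed.
Lemma Yd_e : hasD Yc x ue (sqn x * (uP x + uh2 x) - ue x * (ue x + uh1 x)).
Proof. by apply: (hasD_eq (hasD_e Yc)); rewrite !sph_grad_sum -/(ue x) -/(uh1 x) -/(uP x) -/(uh2 x); ring. Qed.
Lemma Yd_h1 : hasD Yc x uh1 (sqn x * (2 * uh2 x + ug3 x) - ue x * (2 * uh1 x + ug4 x)).
Proof. by apply: (hasD_eq (hasD_h1 Yc)); rewrite !sph_grad_sum -/(ug3 x) -/(ug4 x) -/(uh1 x) -/(uh2 x); ring. Qed.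
Lemma Yd_h4 : hasD Yc x uh4 (sqn x * ug1 x - ue x * ug2 x).
Proof. by apply: (hasD_eq (hasD_h4 Yc)); rewrite sph_grad_sum. Qed.

End AtPoint.
End Euclid.

Ltac C1_atom h := lazymatch h with
  | @sqn _ _ => exact: sqn_C1
  | ?k => lazymatch goal with su : smooth _ |- _ => lazymatch k with
    | ue _ => exact (e_C1 su) | uP _ => exact (P_C1 su)
    | uHp _ _ => exact (Hp_C1 su _) | uHx _ _ => exact (Hx_C1 su _)
    | uh1 _ => exact (h1_C1 su) | uh2 _ => exact (h2_C1 su) | uh4 _ => exact (h4_C1 su)
    | pder _ _ => exact (pder_C1 su _)
    | _ => assumption end end
  end.

Ltac C1_auto := repeat lazymatch goal with
  | |- C1 (fun _ => ?c) => exact (C1_cst c)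
  | |- C1 (fun y => fun_of_matrix y _ ?k) => exact (C1_coord k)
  | |- C1 (fun y => @?f y + @?g y) => apply (@C1_add _ _ f g)
  | |- C1 (fun y => - @?f y) => apply (@C1_opp _ _ f)
  | |- C1 (fun y => @?f y * @?g y) => apply (@C1_mul _ _ f g)
  | |- C1 (fun y => ?h y) => C1_atom h
  | |- C1 ?h => C1_atom h
  end.

(** * Spherical operators and the Bochner field *)

Section Div.
Context {R : realType} {N : nat}.
Notation V := 'rV[R]_N.
Implicit Types (x y : V) (f g : V -> R) (i j k l m : 'I_N) (a : 'I_N -> R).

(** The product rule div (f W) = f div W + W . grad f. The last term only needs the value of [W] at
    [x], which is why [hasD] freezes its direction. *)
Lemma div_scal f (W : 'I_N -> V -> R) x (dW df : R) : x != 0 ->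
  (forall i, C1 (W i)) -> \sum_i pder i (W i) x = dW ->
  hasD (fun i => W i x) x f df ->
  \sum_i pder i (fun y => f y * W i y) x = f x * dW + df.
Proof.
move=> x0 Wc <- [fc <-]; rewrite mulr_sumr -big_split; apply: eq_bigr => i _ /=.
by rewrite (pdE (pdM (C1_pd i fc x0) (C1_pd i (Wc i) x0))).
Qed.

Lemma div_add (W W' : 'I_N -> V -> R) x : x != 0 ->
  (forall i, C1 (W i)) -> (forall i, C1 (W' i)) ->
  \sum_i pder i (fun y => W i y + W' i y) x =
  \sum_i pder i (W i) x + \sum_i pder i (W' i) x.
Proof.
move=> x0 Wc Wc'; rewrite -big_split; apply: eq_bigr => i _ /=.
by rewrite (pdE (pdD (C1_pd i (Wc i) x0) (C1_pd i (Wc' i) x0))).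
Qed.

Lemma div_opp (W : 'I_N -> V -> R) x : x != 0 -> (forall i, C1 (W i)) ->
  \sum_i pder i (fun y => - W i y) x = - \sum_i pder i (W i) x.
Proof.
move=> x0 Wc; rewrite -sumrN; apply: eq_bigr => i _ /=.
by rewrite (pdE (pdN (C1_pd i (Wc i) x0))).
Qed.

Lemma div_coord x : \sum_i pder i (fun y => y 0 i) x = N%:R.
Proof.
transitivity (\sum_(i < N) (1 : R)).
  by apply: eq_bigr => i _; rewrite (pdE (pdX x i i)) eqxx.
by rewrite big_const_ord iter_addr_0.
Qed.

Variable u : V -> R.
Hypothesis su : smooth u.

Notation nr := (N%:R - 1 : R).

(* Scale-invariant spherical quantities: sph_lap = Delta_S u,
   sph_grad2 = |grad_S u|^2 and sph_Gam = <grad_S u, grad_S E u> with E = x.grad.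
   The field sph_lap * sph_grad - 1/2 grad_S sph_grad2 is that of the Bochner
   formula on the sphere. *)
Definition sph_lap x := sqn x * uh4 u x + - (nr * ue u x) + - uh1 u x.
Definition sph_grad2 x := sqn x * uP u x + - (ue u x * ue u x).
Definition sph_Gam x := sqn x * (uP u x + uh2 u x) + - (ue u x * (ue u x + uh1 u x)).
Definition half_grad_sph_grad2 k x := x 0 k * uP u x + sqn x * uHp u k x +
  - (ue u x * (pder k u x + uHx u k x)).
Definition bochner_field k x := sph_lap x * sph_grad u k x +
  - (sqn x * half_grad_sph_grad2 k x + - (sph_Gam x * x 0 k)).

Lemma sph_lap_C1 : C1 sph_lap. Proof. rewrite /sph_lap; C1_auto. Qed.
Lemma sph_grad2_C1 : C1 sph_grad2. Proof. rewrite /sph_grad2; C1_auto. Qed.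
Lemma sph_Gam_C1 : C1 sph_Gam. Proof. rewrite /sph_Gam; C1_auto. Qed.
Lemma half_grad_C1 k : C1 (half_grad_sph_grad2 k). Proof. rewrite /half_grad_sph_grad2; C1_auto. Qed.
Lemma sph_grad_C1 k : C1 (sph_grad u k). Proof. rewrite /sph_grad; C1_auto. Qed.
Lemma bochner_field_C1 k : C1 (bochner_field k).
Proof.
apply: C1_add; first by apply: C1_mul; [exact: sph_lap_C1|exact: sph_grad_C1].
apply: C1_opp; apply: C1_add.
  by apply: C1_mul; [exact: sqn_C1|exact: half_grad_C1].
by apply: C1_opp; apply: C1_mul; [exact: sph_Gam_C1|exact: C1_coord].
Qed.

Section AtPoint.
Variable x : V.
Hypothesis x0 : x != 0.
Notation xc := (fun i => x 0 i).
Notation Yc := (fun i => sph_grad u i x).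

(** The field is tangent to the spheres, so its Euclidean divergence is its divergence along each
    sphere; the factor r^2 in [sph_grad] rescales that to the unit sphere. *)
Lemma div_sph_grad : \sum_i pder i (sph_grad u i) x = sph_lap x.
Proof.
have D i : is_derive x (evec R i) (sph_grad u i)
    (sqn x * hess u i i x + pder i u x * (2 * x 0 i) -
     (x 0 i * (pder i u x + uHx u i x) + ue u x * 1)).
  apply: pdD; first by apply: pdM; [exact: pd_sqn|exact: pd_p].
  apply: pdN; apply: pdM; last exact: pd_e.
  by apply: (pd_eq (pdX x i i)); rewrite eqxx.
under eq_bigr => i _ do rewrite (pdE (D i)).
transitivity (sqn x * uh4 u x + ue u x * 2 - (ue u x + uh1 u x + N%:R * ue u x)); last first.
  by rewrite /sph_lap; ring.
rewrite sumrB !big_split /=; congr (_ + _ - _).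
- by rewrite mulr_sumr.
- by rewrite /ue mulr_suml; apply: eq_bigr => i _; ring.
congr (_ + _); first by under eq_bigr do rewrite mulrDr; rewrite big_split.
by rewrite big_const_ord iter_addr_0 mulr1 mulr_natl.
Qed.

Lemma x_half_grad : \sum_i x 0 i * half_grad_sph_grad2 i x = sph_Gam x.
Proof.
have -> : \sum_i x 0 i * half_grad_sph_grad2 i x = \sum_i (uP u x * (x 0 i * x 0 i) +
   sqn x * (x 0 i * uHp u i x) + - (ue u x * (x 0 i * pder i u x))
   + - (ue u x * (x 0 i * uHx u i x))).
  by apply: eq_bigr => i _; rewrite /half_grad_sph_grad2; ring.
rewrite !big_split /= !sumrN -!mulr_sumr Hp_x // -/(ue u x) -/(uh1 u x).
have -> : \sum_i x 0 i * x 0 i = sqn x by [].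
rewrite /sph_Gam; ring.
Qed.

Lemma sum_q2 : \sum_i (pder i u x + uHx u i x) * (pder i u x + uHx u i x)
  = uP u x + 2 * uh2 u x + uh3 u x.
Proof.
rewrite /uP /uh2 /uh3 mulr_sumr -!big_split; apply: eq_bigr => i _ /=; ring.
Qed.

(** The field is half the Euclidean gradient of [sph_grad2], so this is half a Laplacian; it brings
    in |Hess u|^2 as [uh5]. *)
Lemma div_half_grad : \sum_i pder i (half_grad_sph_grad2 i) x =
  N%:R * uP u x + 4 * uh2 u x + sqn x * (ug1 u x + uh5 u x)
  - (uP u x + 2 * uh2 u x + uh3 u x) - ue u x * (2 * uh4 u x + ug2 u x).
Proof.
have D i : is_derive x (evec R i) (half_grad_sph_grad2 i)
    (x 0 i * (2 * uHp u i x) + uP u x * 1 +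
     (sqn x * (ugp u i i x + \sum_l hess u i l x * hess u i l x) + uHp u i x * (2 * x 0 i)) -
     (ue u x * (hess u i i x + (ugx u i i x + hess u i i x))
      + (pder i u x + uHx u i x) * (pder i u x + uHx u i x))).
  apply: pdD; first apply: pdD.
  - apply: pdM; last exact: pd_P.
    by apply: (pd_eq (pdX x i i)); rewrite eqxx.
  - by apply: pdM; [exact: pd_sqn|exact: pd_Hp].
  - apply: pdN; apply: pdM; first exact: pd_e.
    by apply: pdD; [exact: pd_p|exact: pd_Hx].
under eq_bigr => i _ do rewrite (pdE (D i)).
transitivity (4 * (\sum_i x 0 i * uHp u i x) + uP u x * (\sum_(i < N) 1)
   + sqn x * (\sum_i ugp u i i x) + sqn x * (\sum_i \sum_l hess u i l x * hess u i l x)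
   + - (2 * ue u x) * (\sum_i hess u i i x) + - ue u x * (\sum_i ugx u i i x)
   + - 1 * (\sum_i (pder i u x + uHx u i x) * (pder i u x + uHx u i x))).
  rewrite -sum_lin7; apply: eq_bigr => i _.
  move: (uHp u i x) (uP u x) (ugp u i i x) (\sum_l _) (hess u i i x) (ugx u i i x)
    (uHx u i x) (pder i u x) (ue u x) (sqn x) (x 0 i) => *; ring.
rewrite (Hp_x su) (gp_tr su) (gx_tr su) sum_q2.
rewrite big_const_ord iter_addr_0 -[N%:R in RHS]/(1 *+ N).
rewrite -/(uh5 u x) -/(uh4 u x); ring.
Qed.

Lemma E_sph_grad2 : hasD xc x sph_grad2 (2 * sph_Gam x).
Proof.
apply: hasD_eq.
  apply: hasD_add => //; first by apply: hasD_mul => //; [exact: E_sqn|exact: E_P].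
  by apply: hasD_opp => //; apply: hasD_mul => //; exact: E_e.
rewrite /sph_Gam; ring.
Qed.

(** |grad_S e|^2 for e = [ue u], that is e = r u_r, since grad e = p + Hx. *)
Definition Gam_e_e := sqn x * (uP u x + 2 * uh2 u x + uh3 u x)
  - (ue u x + uh1 u x) * (ue u x + uh1 u x).

(** The product of grad_S u and grad_S (E e), where E e = e + x.Hx is the second Euler derivative of
    u. *)
Definition Gam_u_Ee := sqn x * (uP u x + 3 * uh2 u x + ug3 u x)
  - ue u x * (ue u x + 3 * uh1 u x + ug4 u x).

Lemma E_sph_Gam : hasD xc x sph_Gam (Gam_e_e + Gam_u_Ee).
Proof.
apply: hasD_eq.
  apply: hasD_add => //.
    apply: hasD_mul => //; first exact: E_sqn.
    by apply: hasD_add => //; [exact: E_P|exact: E_h2].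
  apply: hasD_opp => //; apply: hasD_mul => //; first exact: E_e.
  by apply: hasD_add => //; [exact: E_e|exact: E_h1].
rewrite /Gam_e_e /Gam_u_Ee; ring.
Qed.

Definition Gam_u_sph_lap := sqn x * (2 * ue u x * uh4 u x + sqn x * ug1 u x)
  - sqn x * (nr * uP u x + (N%:R + 1) * uh2 u x + ug3 u x)
  - ue u x * (2 * sqn x * uh4 u x + sqn x * ug2 u x - nr * ue u x - (N%:R + 1) * uh1 u x - ug4 u x).

Lemma Yd_sph_lap : hasD Yc x sph_lap Gam_u_sph_lap.
Proof.
apply: hasD_eq.
  apply: hasD_add => //.
    apply: hasD_add => //.
      apply: hasD_mul => //; [exact: Yd_sqn|exact: Yd_h4].
    apply: hasD_opp => //; apply: hasD_mul => //; [exact: hasD_cst|exact: Yd_e].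
  by apply: hasD_opp => //; exact: Yd_h1.
rewrite /Gam_u_sph_lap; ring.
Qed.

(** The raw outcome of the product rule. Its reduction to (Delta_S u)^2 - |Hess_S u|^2 - (N - 2) T
    takes place inside [pointwise_identity]. *)
Definition div_bochner_field := sph_lap x * sph_lap x + Gam_u_sph_lap - (sqn x * (N%:R * uP u x + 4 * uh2 u x + sqn x * (ug1 u x + uh5 u x)
  - (uP u x + 2 * uh2 u x + uh3 u x) - ue u x * (2 * uh4 u x + ug2 u x))
  - (N%:R - 2) * sph_Gam x - (Gam_e_e + Gam_u_Ee)).

Lemma div_bochner_field_eq : \sum_i pder i (bochner_field i) x = div_bochner_field.
Proof.
have tc := half_grad_C1; have Yc1 := sph_grad_C1; have Cc := sph_lap_C1; have Gc := sph_Gam_C1.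
have c1Y i : C1 (fun y => sph_lap y * sph_grad u i y) by exact: (C1_mul Cc (Yc1 i)).
have c1a i : C1 (fun y => sqn y * half_grad_sph_grad2 i y) by exact: (C1_mul sqn_C1 (tc i)).
have c1b i : C1 (fun y => sph_Gam y * y 0 i) by exact: (C1_mul Gc (C1_coord i)).
have c1b' i : C1 (fun y => - (sph_Gam y * y 0 i)) by exact: (C1_opp (c1b i)).
have c1ab i : C1 (fun y => sqn y * half_grad_sph_grad2 i y + - (sph_Gam y * y 0 i)) by exact: (C1_add (c1a i) (c1b' i)).
have c1ab' i : C1 (fun y => - (sqn y * half_grad_sph_grad2 i y + - (sph_Gam y * y 0 i))) by exact: (C1_opp (c1ab i)).
rewrite div_add // div_opp // div_add // div_opp //.
rewrite (div_scal x0 Yc1 div_sph_grad Yd_sph_lap).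
rewrite (div_scal x0 tc div_half_grad (hasD_sqn x _)).
rewrite (div_scal x0 (@C1_coord R N) (div_coord x) E_sph_Gam).
have -> : \sum_i half_grad_sph_grad2 i x * x 0 i = sph_Gam x by rewrite -x_half_grad; apply: eq_bigr => i _; rewrite mulrC.
rewrite /div_bochner_field; ring.
Qed.

Lemma x_bochner_field : \sum_i bochner_field i x * x 0 i = 0.
Proof.
transitivity (sph_lap x * (\sum_i sph_grad u i x * x 0 i) + - sqn x * (\sum_i x 0 i * half_grad_sph_grad2 i x)
    + sph_Gam x * (\sum_i x 0 i * x 0 i)).
  rewrite -sum_lin3; apply: eq_bigr => i _; rewrite /bochner_field.
  move: (sph_lap x) (sph_grad u i x) (sqn x) (half_grad_sph_grad2 i x) (sph_Gam x) (x 0 i) => *; ring.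
rewrite x_sph_grad // x_half_grad -/(sqn x).
move: (sph_lap x) (sqn x) (sph_Gam x) => *; ring.
Qed.

End AtPoint.
End Div.

(** * The flux *)

Section Field.
Context {R : realType} {N : nat}.
Notation V := 'rV[R]_N.
Implicit Types (x y : V) (i j k l m : 'I_N).
Notation nr := (N%:R - 1 : R).

Variables psi psi1 psi2 : R -> R.
Hypothesis dpsi : forall t : R, 0 < t -> is_derive t 1 psi (psi1 t).
Hypothesis dpsi1 : forall t : R, 0 < t -> is_derive t 1 psi1 (psi2 t).
Hypothesis cpsi2 : C0p psi2.
Hypothesis psi_gt0 : forall t : R, 0 < t -> 0 < psi t.

Lemma is_derive_C0p (f df : R -> R) :
  (forall t : R, 0 < t -> is_derive t 1 f (df t)) -> C0p f.
Proof.
move=> h t t0; apply/differentiable_continuous/derivable1_diffP.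
exact: (@ex_derive _ _ _ _ _ _ _ (h t t0)).
Qed.

Lemma C0p_mul (f g : R -> R) : C0p f -> C0p g -> C0p (fun t => f t * g t).
Proof. by move=> fc gc t t0; apply: continuousM; [exact: fc|exact: gc]. Qed.
Lemma C0p_add (f g : R -> R) : C0p f -> C0p g -> C0p (fun t => f t + g t).
Proof. by move=> fc gc t t0; apply: continuousD; [exact: fc|exact: gc]. Qed.
Lemma C0p_opp (f : R -> R) : C0p f -> C0p (fun t => - f t).
Proof. by move=> fc t t0; apply: continuousN; exact: fc. Qed.
Lemma C0p_inv (f : R -> R) : (forall t : R, 0 < t -> f t != 0) -> C0p f ->
  C0p (fun t => (f t)^-1).
Proof. by move=> f0 fc t t0; apply: continuousV; [exact: f0|exact: fc]. Qed.
Lemma C0p_id : C0p (fun t : R => t).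
Proof. by move=> t _; exact: cvg_id. Qed.

Lemma C0p_psi : C0p psi. Proof. exact: is_derive_C0p dpsi. Qed.
Lemma C0p_psi1 : C0p psi1. Proof. exact: is_derive_C0p dpsi1. Qed.
Lemma psi_neq0 (t : R) : 0 < t -> psi t != 0.
Proof. by move=> /psi_gt0; exact: lt0r_neq0. Qed.
Lemma C0p_psiV : C0p (fun t => (psi t)^-1).
Proof. by apply: C0p_inv; [exact: psi_neq0|exact: C0p_psi]. Qed.

Lemma C0p_V : C0p (fun t : R => t^-1).
Proof. by apply: C0p_inv; [move=> t; exact: lt0r_neq0|exact: C0p_id]. Qed.

Definition inv_r : V -> R := rad (fun t => t^-1).
Definition inv_psi : V -> R := rad (fun t => (psi t)^-1).
(** The Euler derivative of log psi: the scale-invariant form of psi' / psi, which stays bounded at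
    the pole. *)
Definition kappa : V -> R := rad (fun t => t * psi1 t * (psi t)^-1).

Definition d_inv_r (t : R) := - (t^-1 * t^-1).
Definition d_inv_psi (t : R) := - (psi1 t * ((psi t)^-1 * (psi t)^-1)).
Definition d_kappa (t : R) := psi1 t * (psi t)^-1 + t * psi2 t * (psi t)^-1
  + - (t * psi1 t * (psi1 t * ((psi t)^-1 * (psi t)^-1))).

Lemma D_inv_r (t : R) : 0 < t -> is_derive t 1 (fun t : R => t^-1) (d_inv_r t).
Proof.
move=> t0; have n0 := lt0r_neq0 t0.
apply: (pd_eq (pdV n0 (is_derive_id t (1 : R)))).
by rewrite /d_inv_r mulr1 expr2 invfM.
Qed.

Lemma D_inv_psi (t : R) : 0 < t -> is_derive t 1 (fun t : R => (psi t)^-1) (d_inv_psi t).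
Proof.
move=> t0; have n0 := psi_neq0 t0.
apply: (pd_eq (pdV n0 (dpsi t0))).
by rewrite /d_inv_psi expr2 invfM mulNr mulrC.
Qed.

Lemma D_kappa (t : R) : 0 < t ->
  is_derive t 1 (fun t : R => t * psi1 t * (psi t)^-1) (d_kappa t).
Proof.
move=> t0.
apply: (pd_eq (pdM (pdM (is_derive_id t (1:R)) (dpsi1 t0)) (D_inv_psi t0))).
rewrite /d_kappa /d_inv_psi /=; ring.
Qed.

Lemma C0p_d_inv_r : C0p d_inv_r.
Proof. by apply: C0p_opp; apply: C0p_mul; exact: C0p_V. Qed.
Lemma C0p_d_inv_psi : C0p d_inv_psi.
Proof.
apply: C0p_opp; apply: C0p_mul; first exact: C0p_psi1.
by apply: C0p_mul; exact: C0p_psiV.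
Qed.
Lemma C0p_d_kappa : C0p d_kappa.
Proof.
have h := C0p_psiV; have h1 := C0p_psi1; have h2 := C0p_mul h h.
have hi := C0p_id.
apply: C0p_add; first apply: C0p_add.
- exact: C0p_mul.
- exact: (C0p_mul (C0p_mul hi cpsi2) h).
exact: (C0p_opp (C0p_mul (C0p_mul hi h1) (C0p_mul h1 h2))).
Qed.

Lemma inv_r_C1 : C1 inv_r. Proof. exact: (C1_rad D_inv_r C0p_d_inv_r). Qed.
Lemma inv_psi_C1 : C1 inv_psi. Proof. exact: (C1_rad D_inv_psi C0p_d_inv_psi). Qed.
Lemma kappa_C1 : C1 kappa. Proof. exact: (C1_rad D_kappa C0p_d_kappa). Qed.

Section At.
Variable x : V.
Hypothesis x0 : x != 0.
Notation xc := (fun i => x 0 i).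

Lemma E_rad (phi dphi : R -> R) :
  (forall t : R, 0 < t -> is_derive t 1 phi (dphi t)) -> C0p dphi ->
  hasD xc x (rad phi) (geod_r x * dphi (geod_r x)).
Proof.
move=> h c; apply: (hasD_eq (hasD_rad _ x0 h c)).
have -> : \sum_i x 0 i * x 0 i = geod_r x ^+ 2 by rewrite geod_r2.
have := geod_r_gt0 x0; move: (geod_r x) => r r0.
by field; rewrite gt_eqF.
Qed.

Lemma tan_rad (a : 'I_N -> R) (phi dphi : R -> R) :
  \sum_i a i * x 0 i = 0 ->
  (forall t : R, 0 < t -> is_derive t 1 phi (dphi t)) -> C0p dphi ->
  hasD a x (rad phi) 0.
Proof.
by move=> a0 h c; apply: (hasD_eq (hasD_rad _ x0 h c)); rewrite a0 mulr0.
Qed.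

Definition mu_r := geod_r x ^+ 2 * psi2 (geod_r x) * inv_psi x.

Lemma E_inv_r : hasD xc x inv_r (- inv_r x).
Proof.
apply: (hasD_eq (E_rad D_inv_r C0p_d_inv_r)); rewrite /inv_r /rad /d_inv_r.
have := geod_r_gt0 x0; move: (geod_r x) => r r0.
by field; rewrite gt_eqF.
Qed.

Lemma E_inv_psi : hasD xc x inv_psi (- (kappa x * inv_psi x)).
Proof.
apply: (hasD_eq (E_rad D_inv_psi C0p_d_inv_psi)); rewrite /inv_psi /kappa /rad /d_inv_psi; ring.
Qed.

Lemma E_kappa : hasD xc x kappa (kappa x + mu_r - kappa x * kappa x).
Proof.
apply: (hasD_eq (E_rad D_kappa C0p_d_kappa)); rewrite /mu_r /inv_psi /kappa /rad /d_kappa; ring.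
Qed.

End At.

Variable u : V -> R.
Hypothesis su : smooth u.

(* radial_lap = u_rr + (N - 1) (psi' / psi) u_r. *)
Definition radial_lap x := inv_r x * inv_r x * (uh1 u x + nr * kappa x * ue u x).

(** The coefficient of x, hence the radial component divided by r. The first summand corresponds to
    (1 / r + (N - 1) psi' / psi) u_r^2 / 2, which turns L^2 into (u_rr - q u_r)^2 up to a multiple
    of u_r^2. The second moves a radial derivative off grad_S u_rr, which appears when the cross
    term 2 L D / psi^2 is integrated by parts on the sphere. The weight in the third makes the
    [sph_Gam] terms fit a complete square. *)
Definition flux_rad x :=
  1 / 2 * (1 + nr * kappa x) * (inv_r x * inv_r x) * (inv_r x * inv_r x) * (ue u x * ue u x)
  + - (inv_r x * inv_r x * (inv_psi x * inv_psi x) * (2 * sph_Gam u x))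
  + inv_r x * inv_r x * (inv_psi x * inv_psi x) * (1 + - (nr * kappa x)) * sph_grad2 u x.

(** Write C = Delta_S u and B = C^2 - |Hess_S u|^2 - (N - 2) T for the Bochner divergence. With c =
    (N - 1) / (N - 2), one has C^2 - (N - 1) T = c (|Hess_S u|^2 - C^2 / (N - 1)) + c B: this
    multiple of B leaves exactly the traceless Hessian. *)
Definition flux_coef : R := nr / (N%:R - 2).

Definition flux i x := flux_rad x * x 0 i + 2 * (inv_psi x * inv_psi x) * radial_lap x * sph_grad u i x
  + flux_coef * (inv_psi x * inv_psi x) * (inv_psi x * inv_psi x) * bochner_field u i x.

Lemma radial_lap_C1 : C1 radial_lap.
Proof.
have r := inv_r_C1; have k := kappa_C1.
have c := @C1_cst R N nr.
exact: (C1_mul (C1_mul r r) (C1_add (h1_C1 su) (C1_mul (C1_mul c k) (e_C1 su)))).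
Qed.

Lemma flux_rad_C1 : C1 flux_rad.
Proof.
have r := inv_r_C1; have k := kappa_C1; have s := inv_psi_C1.
have r2 := C1_mul r r; have s2 := C1_mul s s; have e := e_C1 su; have e2 := C1_mul e e.
have c1 := @C1_cst R N 1; have cn := @C1_cst R N nr; have c2 := @C1_cst R N 2; have ch := @C1_cst R N (1/2 : R).
have nk := C1_mul cn k.
apply: C1_add; first apply: C1_add.
- exact: (C1_mul (C1_mul (C1_mul (C1_mul ch (C1_add c1 nk)) r2) r2) e2).
- exact: (C1_opp (C1_mul (C1_mul r2 s2) (C1_mul c2 (sph_Gam_C1 su)))).
- exact: (C1_mul (C1_mul (C1_mul r2 s2) (C1_add c1 (C1_opp nk))) (sph_grad2_C1 su)).
Qed.

Lemma sph_grad_coef_C1 : C1 (fun x => 2 * (inv_psi x * inv_psi x) * radial_lap x).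
Proof.
have s2 := C1_mul inv_psi_C1 inv_psi_C1.
exact: (C1_mul (C1_mul (@C1_cst R N 2) s2) radial_lap_C1).
Qed.

Lemma bochner_coef_C1 : C1 (fun x => flux_coef * (inv_psi x * inv_psi x) * (inv_psi x * inv_psi x)).
Proof.
have s2 := C1_mul inv_psi_C1 inv_psi_C1.
exact: (C1_mul (C1_mul (@C1_cst R N flux_coef) s2) s2).
Qed.

Lemma flux_C1 i : C1 (flux i).
Proof.
exact: (C1_add (C1_add (C1_mul flux_rad_C1 (C1_coord i)) (C1_mul sph_grad_coef_C1 (sph_grad_C1 su i)))
  (C1_mul bochner_coef_C1 (bochner_field_C1 su i))).
Qed.

Section At2.
Variable x : V.
Hypothesis x0 : x != 0.
Notation xc := (fun i => x 0 i).
Notation Yc := (fun i => sph_grad u i x).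
Notation Zc := (fun i => bochner_field u i x).
Notation rho := (inv_r x).
Notation sig := (inv_psi x).
Notation kap := (kappa x).
Notation mu := (mu_r x).

Definition E_kappa_val := kap + mu - kap * kap.

Definition E_flux_rad_val :=
  (1 / 2 * (nr * E_kappa_val) - 2 * (1 + nr * kap)) * rho ^+ 4 * (ue u x) ^+ 2
  + (1 + nr * kap) * rho ^+ 4 * (ue u x * (ue u x + uh1 u x))
  + 2 * (1 + kap) * rho ^+ 2 * sig ^+ 2 * (2 * sph_Gam u x)
  - rho ^+ 2 * sig ^+ 2 * (2 * (Gam_e_e u x + Gam_u_Ee u x))
  + (- (2 * (1 + kap) * (1 - nr * kap)) - nr * E_kappa_val) * rho ^+ 2 * sig ^+ 2 * sph_grad2 u x
  + rho ^+ 2 * sig ^+ 2 * (1 - nr * kap) * (2 * sph_Gam u x).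

Lemma E_flux_rad : hasD xc x flux_rad E_flux_rad_val.
Proof.
have r := E_inv_r x0; have s := E_inv_psi x0; have k := E_kappa x0.
have M := @hasD_mul R N xc x x0.
have A := @hasD_add R N xc x x0.
have O := @hasD_opp R N xc x x0.
have C := @hasD_cst R N xc x.
have r2 := M _ _ _ _ r r; have s2 := M _ _ _ _ s s.
have e := E_e su x0; have e2 := M _ _ _ _ e e.
have nk := M _ _ _ _ (C nr) k.
have rs := M _ _ _ _ r2 s2.
apply: (hasD_eq (A _ _ _ _ (A _ _ _ _
  (M _ _ _ _ (M _ _ _ _ (M _ _ _ _ (M _ _ _ _ (C (1/2)) (A _ _ _ _ (C 1) nk)) r2) r2) e2)
  (O _ _ (M _ _ _ _ rs (M _ _ _ _ (C 2) (E_sph_Gam su x0)))))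
  (M _ _ _ _ (M _ _ _ _ rs (A _ _ _ _ (C 1) (O _ _ nk))) (E_sph_grad2 su x0)))).
rewrite /E_flux_rad_val /E_kappa_val.
move: (Gam_e_e u x) (Gam_u_Ee u x) (sph_Gam u x) (sph_grad2 u x) (ue u x) (uh1 u x) rho sig kap mu => *.
by field.
Qed.

Definition Gam_radial_lap := rho ^+ 2 * ((sqn x * (2 * uh2 u x + ug3 u x) - ue u x * (2 * uh1 u x + ug4 u x))
   + nr * kap * sph_Gam u x).

Lemma Yd_sph_grad_coef : hasD Yc x (fun x => 2 * (inv_psi x * inv_psi x) * radial_lap x) (2 * sig ^+ 2 * Gam_radial_lap).
Proof.
have Yx := x_sph_grad u x.
have r := tan_rad x0 Yx D_inv_r C0p_d_inv_r; have s := tan_rad x0 Yx D_inv_psi C0p_d_inv_psi.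
have k := tan_rad x0 Yx D_kappa C0p_d_kappa.
have M := @hasD_mul R N Yc x x0.
have A := @hasD_add R N Yc x x0.
have C := @hasD_cst R N Yc x.
have r2 := M _ _ _ _ r r; have s2 := M _ _ _ _ s s.
apply: (hasD_eq (M _ _ _ _ (M _ _ _ _ (C 2) s2)
  (M _ _ _ _ r2 (A _ _ _ _ (Yd_h1 su x0) (M _ _ _ _ (M _ _ _ _ (C nr) k) (Yd_e su x0)))))).
rewrite /Gam_radial_lap /sph_Gam /inv_r /inv_psi /kappa.
move: (uP u x) (uh2 u x) (ug3 u x) (ug4 u x) (sqn x) (ue u x) (uh1 u x) => *; ring.
Qed.

Lemma Zd_bochner_coef : hasD Zc x (fun x => flux_coef * (inv_psi x * inv_psi x) * (inv_psi x * inv_psi x)) 0.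
Proof.
have Zx := x_bochner_field su x.
have s := tan_rad x0 Zx D_inv_psi C0p_d_inv_psi.
have M := @hasD_mul R N Zc x x0.
have s2 := M _ _ _ _ s s.
apply: (hasD_eq (M _ _ _ _ (M _ _ _ _ (@hasD_cst R N Zc x flux_coef) s2) s2)); ring.
Qed.

Definition div_flux_val := N%:R * flux_rad x + E_flux_rad_val + (2 * sig ^+ 2 * radial_lap x * sph_lap u x + 2 * sig ^+ 2 * Gam_radial_lap)
  + flux_coef * sig ^+ 4 * div_bochner_field u x.

Lemma div_flux : \sum_i pder i (flux i) x = div_flux_val.
Proof.
have g := flux_rad_C1; have b2 := sph_grad_coef_C1; have b4 := bochner_coef_C1.
have cG i : C1 (fun y => flux_rad y * y 0 i) by exact: (C1_mul g (C1_coord i)).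
have cY i : C1 (fun y => 2 * (inv_psi y * inv_psi y) * radial_lap y * sph_grad u i y) by exact: (C1_mul b2 (sph_grad_C1 su i)).
have cZ i : C1 (fun y => flux_coef * (inv_psi y * inv_psi y) * (inv_psi y * inv_psi y) * bochner_field u i y) by exact: (C1_mul b4 (bochner_field_C1 su i)).
have cGY i : C1 (fun y => flux_rad y * y 0 i + 2 * (inv_psi y * inv_psi y) * radial_lap y * sph_grad u i y) by exact: (C1_add (cG i) (cY i)).
rewrite /flux (div_add x0 cGY cZ) (div_add x0 cG cY).
rewrite (div_scal x0 (@C1_coord R N) (div_coord x) E_flux_rad).
rewrite (div_scal x0 (sph_grad_C1 su) (div_sph_grad su x0) Yd_sph_grad_coef).
rewrite (div_scal x0 (bochner_field_C1 su) (div_bochner_field_eq su x0) Zd_bochner_coef).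
rewrite /div_flux_val; move: (flux_rad x) E_flux_rad_val (radial_lap x) (sph_lap u x) Gam_radial_lap (div_bochner_field u x) sig flux_coef => *; ring.
Qed.

Lemma x_flux : \sum_i flux i x * x 0 i = sqn x * flux_rad x.
Proof.
transitivity (flux_rad x * (\sum_i x 0 i * x 0 i)
  + 2 * (inv_psi x * inv_psi x) * radial_lap x * (\sum_i sph_grad u i x * x 0 i)
  + flux_coef * (inv_psi x * inv_psi x) * (inv_psi x * inv_psi x) * (\sum_i bochner_field u i x * x 0 i)).
  rewrite -sum_lin3; apply: eq_bigr => i _; rewrite /flux.
  move: (flux_rad x) (inv_psi x) (radial_lap x) (sph_grad u i x) (bochner_field u i x) (x 0 i) => *; ring.
rewrite (x_bochner_field su x) (x_sph_grad u x) -/(sqn x).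
move: (flux_rad x) (inv_psi x) (radial_lap x) (sqn x) flux_coef => *; ring.
Qed.

(** The gradient of a radial weight meets only the radial part of the flux, the other two parts
    being tangential. The weight is arbitrary here; it is later a cutoff times the volume
    density. *)
Lemma div_weighted_flux (cutoff dcutoff : R -> R) :
  (forall t : R, 0 < t -> is_derive t 1 cutoff (dcutoff t)) -> C0p dcutoff ->
  \sum_i pder i (fun y => rad cutoff y * flux i y) x =
  cutoff (geod_r x) * div_flux_val + geod_r x * dcutoff (geod_r x) * flux_rad x.
Proof.
move=> h c; rewrite (div_scal x0 flux_C1 div_flux (hasD_rad _ x0 h c)) x_flux -geod_r2.
congr (_ + _); have := geod_r_gt0 x0; move: (geod_r x) (flux_rad x) => r G r0.
by field; rewrite gt_eqF.
Qed.

End At2.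
End Field.

(** * The algebraic identity behind the pointwise inequality *)

Section Alg.
Context {R : realFieldType}.

(** The Euler derivative of the logarithm of the volume density is [(N - 1) * (kap - 1)], so
    [DIV + (N - 1) * (kap - 1) * G] is the Riemannian divergence of the field. The number [hh] is
    |Hess_S u|^2: the spherical Hessian is r^2 P H P - e P, with P the projection orthogonal to
    x. *)
Lemma pointwise_identity (N rho sig kap mu e P h1 h2 h3 h4 h5 g1 g2 g3 g4 s T Gam Gee GuE C GuC dZ L G Ek EG GuL DIV hh : R) :
  N - 1 != 0 -> N - 2 != 0 -> rho != 0 -> s = rho^-1 ^+ 2 ->
  T = s * P - e * e -> Gam = s * (P + h2) - e * (e + h1) ->
  Gee = s * (P + 2 * h2 + h3) - (e + h1) * (e + h1) ->
  GuE = s * (P + 3 * h2 + g3) - e * (e + 3 * h1 + g4) ->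
  C = s * h4 - (N - 1) * e - h1 ->
  GuC = s * (2 * e * h4 + s * g1) - s * ((N - 1) * P + (N + 1) * h2 + g3)
    - e * (2 * s * h4 + s * g2 - (N - 1) * e - (N + 1) * h1 - g4) ->
  dZ = C * C + GuC - (s * (N * P + 4 * h2 + s * (g1 + h5) - (P + 2 * h2 + h3)
      - e * (2 * h4 + g2)) - (N - 2) * Gam - (Gee + GuE)) ->
  L = rho * rho * (h1 + (N - 1) * kap * e) ->
  G = 1 / 2 * (1 + (N - 1) * kap) * (rho * rho) * (rho * rho) * (e * e)
    - rho * rho * (sig * sig) * (2 * Gam)
    + rho * rho * (sig * sig) * (1 - (N - 1) * kap) * T ->
  Ek = kap + mu - kap * kap ->
  EG = (1 / 2 * ((N - 1) * Ek) - 2 * (1 + (N - 1) * kap)) * rho ^+ 4 * e ^+ 2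
    + (1 + (N - 1) * kap) * rho ^+ 4 * (e * (e + h1))
    + 2 * (1 + kap) * rho ^+ 2 * sig ^+ 2 * (2 * Gam)
    - rho ^+ 2 * sig ^+ 2 * (2 * (Gee + GuE))
    + (- (2 * (1 + kap) * (1 - (N - 1) * kap)) - (N - 1) * Ek) * rho ^+ 2 * sig ^+ 2 * T
    + rho ^+ 2 * sig ^+ 2 * (1 - (N - 1) * kap) * (2 * Gam) ->
  GuL = rho ^+ 2 * ((s * (2 * h2 + g3) - e * (2 * h1 + g4)) + (N - 1) * kap * Gam) ->
  DIV = N * G + EG + (2 * sig ^+ 2 * L * C + 2 * sig ^+ 2 * GuL)
    + (N - 1) / (N - 2) * sig ^+ 4 * dZ ->
  hh = s ^+ 2 * h5 - 2 * s * h3 + h1 ^+ 2 - 2 * e * (s * h4 - h1) + (N - 1) * e ^+ 2 ->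
  (L + sig ^+ 2 * C) ^+ 2 -
  (((N - 1) / 2) ^+ 2 + 1 / 4 * rho ^+ 2 + (N ^+ 2 - 1) / 4 * sig ^+ 2) *
    (rho ^+ 2 * e ^+ 2 + sig ^+ 2 * T)
  - (DIV + (N - 1) * (kap - 1) * G) =
  (rho ^+ 2 * (h1 - (1 - (N - 1) * kap) / 2 * e)) ^+ 2
  + 2 * sig ^+ 2 * rho ^+ 2 * (Gee - 2 * ((1 - (N - 3) * kap) / 2) * Gam
      + ((1 - (N - 3) * kap) / 2) ^+ 2 * T)
  + (N - 1) / (N - 2) * sig ^+ 4 * (hh - C ^+ 2 / (N - 1))
  + e ^+ 2 * rho ^+ 2 * ((N ^+ 2 - 1) / 4 * (kap ^+ 2 * rho ^+ 2)
      - (N - 1) / 2 * (mu * rho ^+ 2) - ((N - 1) / 2) ^+ 2 - (N ^+ 2 - 1) / 4 * sig ^+ 2)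
  + T * sig ^+ 2 * ((N - 1) * (mu * rho ^+ 2)
      + (N ^+ 2 - 4 * N - 1) / 2 * (kap ^+ 2 * rho ^+ 2) + (N - 1) * sig ^+ 2
      - ((N - 1) / 2) ^+ 2 - (N ^+ 2 - 1) / 4 * sig ^+ 2 + 1 / 4 * rho ^+ 2).
Proof.
move=> n1 n2 r0 Es ET EGam EGee EGuE EC EGuC EdZ EL EG_ EEk EEG EGuL EDIV Ehh.
(* The Bochner formula on the sphere, whose Ricci curvature is N - 2; all third derivatives drop
   out. *)
have dZE : dZ = C ^+ 2 - hh - (N - 2) * T.
  rewrite EdZ EGuC Ehh EGee EGuE EGam ET EC; ring.
have sr : s * rho ^+ 2 = 1 by rewrite Es; field.
rewrite EDIV dZE.
(* the s-dependence of the sig^2 part cancels through s * rho^2 = 1 *)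
suff H : (L + sig ^+ 2 * C) ^+ 2 -
  (((N - 1) / 2) ^+ 2 + 1 / 4 * rho ^+ 2 + (N ^+ 2 - 1) / 4 * sig ^+ 2) *
    (rho ^+ 2 * e ^+ 2 + sig ^+ 2 * T)
  - (N * G + EG + (2 * sig ^+ 2 * L * C + 2 * sig ^+ 2 * GuL)
   + (N - 1) * (kap - 1) * G) =
  (rho ^+ 2 * (h1 - (1 - (N - 1) * kap) / 2 * e)) ^+ 2
  + 2 * sig ^+ 2 * rho ^+ 2 * (Gee - 2 * ((1 - (N - 3) * kap) / 2) * Gam
      + ((1 - (N - 3) * kap) / 2) ^+ 2 * T)
  + sig ^+ 4 * (C ^+ 2 - (N - 1) * T)
  + e ^+ 2 * rho ^+ 2 * ((N ^+ 2 - 1) / 4 * (kap ^+ 2 * rho ^+ 2)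
      - (N - 1) / 2 * (mu * rho ^+ 2) - ((N - 1) / 2) ^+ 2 - (N ^+ 2 - 1) / 4 * sig ^+ 2)
  + T * sig ^+ 2 * ((N - 1) * (mu * rho ^+ 2)
      + (N ^+ 2 - 4 * N - 1) / 2 * (kap ^+ 2 * rho ^+ 2) + (N - 1) * sig ^+ 2
      - ((N - 1) / 2) ^+ 2 - (N ^+ 2 - 1) / 4 * sig ^+ 2 + 1 / 4 * rho ^+ 2).
  apply: (@addIr _ (- ((N - 1) / (N - 2) * sig ^+ 4 * (C ^+ 2 - hh - (N - 2) * T)))).
  transitivity ((L + sig ^+ 2 * C) ^+ 2 -
  (((N - 1) / 2) ^+ 2 + 1 / 4 * rho ^+ 2 + (N ^+ 2 - 1) / 4 * sig ^+ 2) *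
    (rho ^+ 2 * e ^+ 2 + sig ^+ 2 * T)
  - (N * G + EG + (2 * sig ^+ 2 * L * C + 2 * sig ^+ 2 * GuL)
   + (N - 1) * (kap - 1) * G) - 2 * ((N - 1) / (N - 2) * sig ^+ 4 * (C ^+ 2 - hh - (N - 2) * T))).
    clear; ring.
  rewrite H; clear H; clear -n1 n2; field; by rewrite n1 n2.
have GuLE : GuL = 2 * h2 + g3 - rho ^+ 2 * e * (2 * h1 + g4) + (N - 1) * kap * rho ^+ 2 * Gam.
  rewrite EGuL; transitivity (s * rho ^+ 2 * (2 * h2 + g3) - rho ^+ 2 * e * (2 * h1 + g4) + (N - 1) * kap * rho ^+ 2 * Gam).
    ring.
  by rewrite sr mul1r.
have GuEE : rho ^+ 2 * GuE = P + 3 * h2 + g3 - rho ^+ 2 * e * (e + 3 * h1 + g4).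
  rewrite EGuE; transitivity (s * rho ^+ 2 * (P + 3 * h2 + g3) - rho ^+ 2 * e * (e + 3 * h1 + g4)).
    ring.
  by rewrite sr mul1r.
have GE : rho ^+ 2 * Gam = P + h2 - rho ^+ 2 * e * (e + h1).
  rewrite EGam; transitivity (s * rho ^+ 2 * (P + h2) - rho ^+ 2 * e * (e + h1)).
    ring.
  by rewrite sr mul1r.
(* The remaining third derivatives sit in [GuL] and [GuE]. By this relation the [GuE] term of
   [2 * sig ^+ 2 * GuL] cancels the one in [EG]. *)
have -> : GuL = rho ^+ 2 * GuE + (N - 1) * kap * (rho ^+ 2 * Gam) - rho ^+ 2 * Gam.
  apply/eqP; rewrite -subr_eq0; apply/eqP.
  transitivity (rho ^+ 2 * Gam - (P + h2 - rho ^+ 2 * e * (e + h1))).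
    by rewrite GuEE GuLE; ring.
  by rewrite GE subrr.
rewrite EEG EG_ EL EEk.
clear; by field.
Qed.

End Alg.

(** * The pointwise inequality *)

Section Coefs.
Context {R : realFieldType}.

(** Here k, w, s stand for psi'^2 / psi^2, psi'' / psi and 1 / psi^2, so that [1 <= w] and
    [s + w <= k] are the two curvature conditions. Both are equalities for psi = sinh, and then the
    coefficient is 0. *)
Lemma radial_coef_ge0 (n k w s : R) : 5 <= n -> 1 <= w -> s + w <= k ->
  0 <= (n ^+ 2 - 1) / 4 * k - (n - 1) / 2 * w - ((n - 1) / 2) ^+ 2 - (n ^+ 2 - 1) / 4 * s.
Proof.
move=> n5 w1 kge.
have -> : (n ^+ 2 - 1) / 4 * k - (n - 1) / 2 * w - ((n - 1) / 2) ^+ 2 - (n ^+ 2 - 1) / 4 * s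
  = (n - 1) * (n + 1) / 4 * (k - (s + w)) + (n - 1) ^+ 2 / 4 * (w - 1) by field.
by apply: addr_ge0; apply: mulr_ge0; try lra; apply: mulr_ge0; try lra;
  rewrite ?sqr_ge0 //; apply: mulr_ge0; lra.
Qed.

(** With [k] replaced by its lower bound [s + w], the coefficient of [s] is (n - 5)(n + 1) / 4,
    nonnegative because [5 <= n]; [p] stands for 1 / r^2. *)
Lemma tangential_coef_ge0 (n k w s p : R) : 5 <= n -> 0 <= s -> 0 <= p ->
  1 <= w -> s + w <= k ->
  0 <= (n - 1) * w + (n ^+ 2 - 4 * n - 1) / 2 * k + (n - 1) * s
   - ((n - 1) / 2) ^+ 2 - (n ^+ 2 - 1) / 4 * s + 1 / 4 * p.
Proof.
move=> n5 s0 p0 w1 kge.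
have -> : (n - 1) * w + (n ^+ 2 - 4 * n - 1) / 2 * k + (n - 1) * s
   - ((n - 1) / 2) ^+ 2 - (n ^+ 2 - 1) / 4 * s + 1 / 4 * p =
  (n * (n - 5) + (n - 1)) / 2 * (k - (s + w))
  + ((n - 5) * (n + 1) / 4) * s
  + ((n - 3) * (n + 1) / 2 * (w - 1) + ((n - 5) * (n + 3) + 8) / 4) + 1 / 4 * p by field.
have h1 : 0 <= n * (n - 5) by apply: mulr_ge0; lra.
have h2 : 0 <= (n - 5) * (n + 1) by apply: mulr_ge0; lra.
have h3 : 0 <= (n - 3) * (n + 1) by apply: mulr_ge0; lra.
have h4 : 0 <= (n - 5) * (n + 3) by apply: mulr_ge0; lra.
have g1 : 0 <= (n * (n - 5) + (n - 1)) / 2 * (k - (s + w)) by apply: mulr_ge0; lra.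
have g2 : 0 <= ((n - 5) * (n + 1) / 4) * s by apply: mulr_ge0; lra.
have g3 : 0 <= (n - 3) * (n + 1) / 2 * (w - 1) by apply: mulr_ge0; lra.
lra.
Qed.

End Coefs.

Section Gram.
Context {R : realFieldType} {n : nat}.
Implicit Types (x a : 'I_n -> R).

(** Cauchy-Schwarz, read off from the squared length of the part of [a] orthogonal to [x]. *)
Lemma gram_ge0 x a : 0 < \sum_i x i * x i ->
  0 <= (\sum_i x i * x i) * (\sum_i a i * a i) - (\sum_i x i * a i) ^+ 2.
Proof.
set s := \sum_i x i * x i; set d := \sum_i x i * a i; set A := \sum_i a i * a i.
move=> s0; have : 0 <= \sum_i (s * a i - d * x i) ^+ 2.
  by apply: sumr_ge0 => i _; exact: sqr_ge0.
have -> : \sum_i (s * a i - d * x i) ^+ 2 = s * (s * A - d ^+ 2).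
  transitivity (s ^+ 2 * A + (- 2 * s * d) * d + d ^+ 2 * s); last by ring.
  rewrite -sum_lin3; apply: eq_bigr => i _; ring.
by rewrite pmulr_rge0.
Qed.

(* The trace inequality tr(A)^2 <= (n - 1) |A|^2 for s times the compression P H P
   of H to the hyperplane orthogonal to x. *)
Lemma tangential_trace_le (H : 'I_n -> 'I_n -> R) x (s h1 h3 h4 h5 : R) :
  (1 < n)%N -> (forall i j, H i j = H j i) -> 0 < s ->
  s = \sum_i x i * x i ->
  h1 = \sum_i x i * \sum_j H i j * x j ->
  h3 = \sum_i (\sum_j H i j * x j) * (\sum_j H i j * x j) ->
  h4 = \sum_i H i i -> h5 = \sum_i \sum_j H i j * H i j ->
  (s * h4 - h1) ^+ 2 <= (n%:R - 1) * (s ^+ 2 * h5 - 2 * s * h3 + h1 ^+ 2).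
Proof.
move=> n1 Hs s0 Es E1 E3 E4 E5.
pose y i := \sum_j H i j * x j.
pose z i := \sum_j H i j * y j.
have n0 : 0 < n%:R - 1 :> R by rewrite subr_gt0 ltr1n.
(* [c] is the trace of s P H P divided by tr P = n - 1. The coefficients [al] and [be] are such that
   s^2 H + al y + be x - c s Id is s times the traceless matrix s P H P - c P; the sum of the
   squares of its entries is the quantity sought. *)
pose c := (s * h4 - h1) / (n%:R - 1).
pose al i := - s * x i.
pose be i := - s * y i + (h1 + c) * x i.
have Ey1 : \sum_j y j * x j = h1 by rewrite E1; apply: eq_bigr => i _; rewrite mulrC.
have Ey2 : \sum_j y j * y j = h3 by rewrite E3.
have xz : \sum_i x i * z i = h3.
  rewrite -Ey2 /z.
  transitivity (\sum_i \sum_j (x i * H i j) * y j).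
    by apply: eq_bigr => i _; rewrite mulr_sumr; apply: eq_bigr => j _; rewrite mulrA.
  rewrite exchange_big /=; apply: eq_bigr => j _; rewrite -mulr_suml; congr (_ * _).
  by rewrite /y; apply: eq_bigr => i _; rewrite (Hs j i) mulrC.
have row i : \sum_j (s ^+ 2 * H i j + al i * y j + be i * x j - c * s * (i == j)%:R) ^+ 2 =
   s ^+ 4 * (\sum_j H i j * H i j) + al i ^+ 2 * h3 + be i ^+ 2 * s + c ^+ 2 * s ^+ 2
   + 2 * s ^+ 2 * al i * z i + 2 * s ^+ 2 * be i * y i - 2 * c * s ^+ 3 * H i i
   + 2 * al i * be i * h1 - 2 * c * s * al i * y i - 2 * c * s * be i * x i.
  transitivity (s ^+ 4 * (\sum_j H i j * H i j) + al i ^+ 2 * (\sum_j y j * y j)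
    + be i ^+ 2 * (\sum_j x j * x j) + (c * s) ^+ 2 * (\sum_j 1 * (i == j)%:R)
    + 2 * s ^+ 2 * al i * (\sum_j H i j * y j) + 2 * s ^+ 2 * be i * (\sum_j H i j * x j)
    + - 2 * c * s ^+ 3 * (\sum_j H i j * (i == j)%:R) + 2 * al i * be i * (\sum_j y j * x j)
    + - 2 * c * s * al i * (\sum_j y j * (i == j)%:R)
    + - 2 * c * s * be i * (\sum_j x j * (i == j)%:R)).
    rewrite -sum_lin10; apply: eq_bigr => j _.
    have : (i == j)%:R * (i == j)%:R = (i == j)%:R :> R by rewrite -natrM mulnb andbb.
    move: ((i == j)%:R : R) (H i j) (al i) (be i) (y j) (x j) => d h a b yy xx dd.
    transitivity ((s ^+ 2 * h + a * yy + b * xx) ^+ 2 + (c * s) ^+ 2 * (d * d)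
      - 2 * (s ^+ 2 * h + a * yy + b * xx) * (c * s * d)); first ring.
    by rewrite dd; ring.
  rewrite !sumr_delta Ey1 Ey2 -Es -/(z i) -/(y i); ring.
have M0 : 0 <= \sum_i \sum_j (s ^+ 2 * H i j + al i * y j + be i * x j - c * s * (i == j)%:R) ^+ 2.
  by apply: sumr_ge0 => i _; apply: sumr_ge0 => j _; exact: sqr_ge0.
have tot : \sum_i \sum_j (s ^+ 2 * H i j + al i * y j + be i * x j - c * s * (i == j)%:R) ^+ 2 =
   s ^+ 4 * h5 - 2 * s ^+ 3 * h3 + s ^+ 2 * h1 ^+ 2 - 2 * c * s ^+ 2 * (s * h4 - h1)
   + c ^+ 2 * s ^+ 2 * (n%:R - 1).
  under eq_bigr do rewrite row.
  transitivity (s ^+ 4 * (\sum_i \sum_j H i j * H i j)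
    + (s ^+ 2 * h3 + s * (h1 + c) ^+ 2 - 2 * s * (h1 + c) * h1 - 2 * c * s * (h1 + c)) * (\sum_i x i * x i)
    + (s ^+ 3 - 2 * s ^+ 3) * (\sum_i y i * y i)
    + (- 2 * s ^+ 2 * (h1 + c) + 2 * s ^+ 2 * (h1 + c) + 2 * s ^+ 2 * h1 + 2 * c * s ^+ 2 + 2 * c * s ^+ 2) * (\sum_i y i * x i)
    + c ^+ 2 * s ^+ 2 * (\sum_(i < n) 1)
    + (- 2 * s ^+ 3) * (\sum_i x i * z i)
    + (- 2 * c * s ^+ 3) * (\sum_i H i i)).
    rewrite -sum_lin7; apply: eq_bigr => i _; rewrite /al /be.
    move: (\sum_j _) (x i) (y i) (z i) (H i i) => *; ring.
  rewrite Ey1 Ey2 xz -Es -E4 -E5 big_const_ord iter_addr_0; ring.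
move: M0; rewrite tot.
have -> : s ^+ 4 * h5 - 2 * s ^+ 3 * h3 + s ^+ 2 * h1 ^+ 2 - 2 * c * s ^+ 2 * (s * h4 - h1)
   + c ^+ 2 * s ^+ 2 * (n%:R - 1) =
   s ^+ 2 * (s ^+ 2 * h5 - 2 * s * h3 + h1 ^+ 2 - (s * h4 - h1) ^+ 2 / (n%:R - 1)).
  by rewrite /c; field; rewrite gt_eqF.
rewrite pmulr_rge0 ?exprn_gt0 // subr_ge0 ler_pdivrMr // => h.
by rewrite [leRHS]mulrC.
Qed.

End Gram.

Section Pointwise.
Context {R : realType} {N : nat}.
Notation V := 'rV[R]_N.
Notation nr := (N%:R - 1 : R).
Variables psi psi1 psi2 : R -> R.
Variable u : V -> R.
Hypothesis su : smooth u.
Hypothesis N5 : (5 <= N)%N.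
Variable x : V.
Hypothesis x0 : x != 0.
Notation r := (geod_r x).
Hypothesis psi_gt0 : 0 < psi r.
Hypothesis psi2_ge : psi r <= psi2 r.
Hypothesis psi1_ge : 1 + psi r * psi2 r <= psi1 r ^+ 2.

Lemma sph_grad2_ge0 : 0 <= sph_grad2 u x.
Proof.
have := @gram_ge0 R N (fun i => x 0 i) (fun i => pder i u x) (sqn_gt0 x0).
by rewrite -/(sqn x) -/(ue u x) -/(uP u x) /sph_grad2 expr2.
Qed.

(** This is |grad_S (e - q u)|^2 with q held constant: the Gram determinant of x and grad e - q grad
    u. *)
Lemma Gam_quad_ge0 (q : R) : 0 <= Gam_e_e u x - 2 * q * sph_Gam u x + q ^+ 2 * sph_grad2 u x.
Proof.
have := @gram_ge0 R N (fun i => x 0 i)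
  (fun i => pder i u x + uHx u i x - q * pder i u x) (sqn_gt0 x0).
have -> : \sum_i (pder i u x + uHx u i x - q * pder i u x) *
     (pder i u x + uHx u i x - q * pder i u x) =
   (1 - q) ^+ 2 * uP u x + 2 * (1 - q) * uh2 u x + 1 * uh3 u x.
  rewrite -sum_lin3; apply: eq_bigr => i _.
  move: (pder i u x) (uHx u i x) => *; ring.
have -> : \sum_i x 0 i * (pder i u x + uHx u i x - q * pder i u x) =
   (1 - q) * ue u x + 1 * uh1 u x + 0 * uh1 u x.
  rewrite -sum_lin3; apply: eq_bigr => i _.
  move: (pder i u x) (uHx u i x) (x 0 i) => *; ring.
rewrite -/(sqn x) /Gam_e_e /sph_Gam /sph_grad2 => h; apply: le_trans h _.
move: (sqn x) (uP u x) (uh1 u x) (uh2 u x) (uh3 u x) (ue u x) => *.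
by rewrite le_eqVlt; apply/orP; left; apply/eqP; ring.
Qed.

Notation hh := (sqn x ^+ 2 * uh5 u x - 2 * sqn x * uh3 u x + uh1 u x ^+ 2
  - 2 * ue u x * (sqn x * uh4 u x - uh1 u x) + nr * ue u x ^+ 2).

(** Subtracting e P from r^2 P H P does not change its traceless part, so [tangential_trace_le] for
    the Euclidean Hessian gives the trace inequality for the spherical one. *)
Lemma sph_lap_sq_le : 0 <= hh - sph_lap u x ^+ 2 / nr.
Proof.
have N1 : (1 < N)%N by apply: leq_trans N5.
have n0 : 0 < nr by rewrite subr_gt0 ltr1n.
have := @tangential_trace_le R N (fun i j => hess u i j x) (fun i => x 0 i)
  (sqn x) (uh1 u x) (uh3 u x) (uh4 u x) (uh5 u x) N1 (fun i j => hess_sym su i j x) (sqn_gt0 x0)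
  (erefl _) (erefl _) (erefl _) (erefl _) (erefl _).
rewrite subr_ge0 ler_pdivrMr // /sph_lap.
move: (uh1 u x) (uh3 u x) (uh4 u x) (uh5 u x) (ue u x) (sqn x) => h1 h3 h4 h5 e s H.
rewrite -subr_ge0 in H; rewrite -subr_ge0; apply: le_trans H _.
by rewrite le_eqVlt; apply/orP; left; apply/eqP; ring.
Qed.

Lemma pointwise_ineq :
  div_flux_val psi psi1 psi2 u x + nr * (kappa psi psi1 x - 1) * flux_rad psi psi1 u x <=
  (radial_lap psi psi1 u x + inv_psi psi x ^+ 2 * sph_lap u x) ^+ 2 -
  ((nr / 2) ^+ 2 + 1 / 4 * inv_r x ^+ 2 + (N%:R ^+ 2 - 1) / 4 * inv_psi psi x ^+ 2) *
    (inv_r x ^+ 2 * ue u x ^+ 2 + inv_psi psi x ^+ 2 * sph_grad2 u x).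
Proof.
have N1 : (1 < N)%N by apply: leq_trans N5.
have n0 : 0 < nr by rewrite subr_gt0 ltr1n.
have n5 : 5 <= N%:R :> R by rewrite (ler_nat R 5).
have n2 : 0 < N%:R - 2 :> R by move: (N%:R : R) n5 => n ?; lra.
have r0 := geod_r_gt0 x0.
have rho0 : 0 < inv_r x by rewrite /inv_r /rad invr_gt0.
have Es : sqn x = (inv_r x)^-1 ^+ 2 by rewrite /inv_r /rad invrK geod_r2.
rewrite -subr_ge0.
rewrite (@pointwise_identity R N%:R (inv_r x) (inv_psi psi x) (kappa psi psi1 x) (mu_r psi psi2 x)
  (ue u x) (uP u x) (uh1 u x) (uh2 u x) (uh3 u x) (uh4 u x) (uh5 u x)
  (ug1 u x) (ug2 u x) (ug3 u x) (ug4 u x) (sqn x) (sph_grad2 u x) (sph_Gam u x) (Gam_e_e u x) (Gam_u_Ee u x)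
  (sph_lap u x) (Gam_u_sph_lap u x) (div_bochner_field u x) (radial_lap psi psi1 u x) (flux_rad psi psi1 u x) (E_kappa_val psi psi1 psi2 x)
  (E_flux_rad_val psi psi1 psi2 u x) (Gam_radial_lap psi psi1 u x) (div_flux_val psi psi1 psi2 u x) hh
  (lt0r_neq0 n0) (lt0r_neq0 n2) (lt0r_neq0 rho0) Es); last first.
all: try by [].
have T0 := sph_grad2_ge0; have Q0 := Gam_quad_ge0 ((1 - (N%:R - 3) * kappa psi psi1 x) / 2).
have C0' := sph_lap_sq_le.
set w := psi2 r * inv_psi psi x.
have sig0 : 0 < inv_psi psi x by rewrite /inv_psi /rad invr_gt0.
have w1 : 1 <= w by rewrite /w /inv_psi /rad ler_pdivlMr // mul1r.
have muE : mu_r psi psi2 x * inv_r x ^+ 2 = w.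
  rewrite /mu_r /inv_r /w /rad; move: (psi2 _) (inv_psi _ _) r0 => a b; move: r => t t0.
  by field; rewrite gt_eqF.
have kapE : kappa psi psi1 x ^+ 2 * inv_r x ^+ 2 = psi1 r ^+ 2 * inv_psi psi x ^+ 2.
  rewrite /kappa /inv_r /inv_psi /rad; move: (psi1 _) (psi _)^-1 r0 => a b; move: r => t t0.
  by field; rewrite gt_eqF.
have kap_ge : inv_psi psi x ^+ 2 + w <= psi1 r ^+ 2 * inv_psi psi x ^+ 2.
  have -> : inv_psi psi x ^+ 2 + w = (1 + psi r * psi2 r) * inv_psi psi x ^+ 2.
    rewrite /w /inv_psi /rad; move: (psi2 _) psi_gt0 => b; move: (psi _) => t t0.
    by field; rewrite gt_eqF.
  by rewrite ler_pM2r // exprn_gt0.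
rewrite muE kapE.
set k2 := psi1 r ^+ 2 * inv_psi psi x ^+ 2 in kap_ge *.
have s2 : 0 < inv_psi psi x ^+ 2 by rewrite exprn_gt0.
have rho2 : 0 < inv_r x ^+ 2 by rewrite exprn_gt0.
have c1 := radial_coef_ge0 n5 w1 kap_ge.
have c2 := tangential_coef_ge0 n5 (ltW s2) (ltW rho2) w1 kap_ge.
apply: addr_ge0; last by rewrite mulr_ge0 // mulr_ge0 // ltW.
apply: addr_ge0; last first.
  by apply: mulr_ge0 => //; apply: mulr_ge0; [exact: sqr_ge0|exact: ltW].
apply: addr_ge0; last first.
  apply: mulr_ge0 => //; apply: mulr_ge0; first by rewrite divr_ge0 // ltW.
  by rewrite exprn_ge0 // ltW.
apply: addr_ge0; first exact: sqr_ge0.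
apply: mulr_ge0 => //; apply: mulr_ge0; last exact: ltW.
by apply: mulr_ge0 => //; exact: ltW.
Qed.

End Pointwise.

(** * The model metric in Cartesian coordinates *)

Section RankOne.
Context {F : fieldType} {n : nat}.
Implicit Types (x : 'rV[F]_n) (b c : F).

(** Two block triangular factorisations of one bordered matrix: the first exhibits the rank one
    perturbation, the second its scalar Schur complement. *)
Lemma det_scalar_rank1 b c x : b != 0 ->
  \det (b%:M + c *: (x^T *m x)) = (1 + c / b * (x *m x^T) 0 0) * b ^+ n.
Proof.
move=> b0.
pose M := block_mx (1%:M : 'M[F]_1) x (- c *: x^T) (b%:M : 'M[F]_n).
have E1 : M = block_mx 1%:M 0 (- c *: x^T) 1%:M *m
     block_mx 1%:M x 0 (b%:M + c *: (x^T *m x)).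
  rewrite mulmx_block !mul1mx !mulmx1 !mul0mx ?mulmx0 !addr0 -scalemxAl.
  by rewrite /M; congr block_mx; rewrite scaleNr addrC addrK.
have E2 : M = block_mx (1%:M + (c / b) *: (x *m x^T)) (b^-1 *: x) 0 1%:M *m
     block_mx 1%:M 0 (- c *: x^T) b%:M.
  rewrite mulmx_block !mulmx1 !mul1mx !mul0mx ?mulmx0 !add0r.
  rewrite mul_mx_scalar scalerA mulfV // scale1r.
  rewrite -scalemxAr -scalemxAl scalerA -addrA -scalerDl.
  by rewrite /M; congr block_mx; rewrite mulNr subrr scale0r addr0.
have := congr1 (fun A => \det A) E1; rewrite {1}E2 !det_mulmx.
rewrite !det_ublock !det_lblock !det1 !mul1r !mulr1 det_mx11 !mxE eqxx det_scalar.
by move=> <-.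
Qed.

End RankOne.

Section Metric.
Context {R : realType} {N : nat}.
Notation V := 'rV[R]_N.
Implicit Types (x y : V) (i j k l m : 'I_N).
Notation nr := (N%:R - 1 : R).
Hypothesis N5 : (5 <= N)%N.
Variables psi psi1 psi2 : R -> R.
Hypothesis dpsi : forall t : R, 0 < t -> is_derive t 1 psi (psi1 t).
Hypothesis dpsi1 : forall t : R, 0 < t -> is_derive t 1 psi1 (psi2 t).
Hypothesis cpsi2 : C0p psi2.
Hypothesis psi_gt0 : forall t : R, 0 < t -> 0 < psi t.

(** A density against the Lebesgue measure of the chart, hence the division of psi^(N-1) by
    r^(N-1). *)
Definition voldens (t : R) := (psi t * t^-1) ^+ N.-1.

Section At.
Variable x : V.
Hypothesis x0 : x != 0.
Notation r := (geod_r x).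

(** The eigenvalue of the metric on the N - 1 directions orthogonal to x; along x the eigenvalue is
    1. *)
Let b := (psi r / r) ^+ 2.

Lemma xxT00 : (x *m x^T) 0 0 = sqn x.
Proof. by rewrite mxE; apply: eq_bigr => i _; rewrite mxE expr2. Qed.

Lemma b_gt0 : 0 < b.
Proof. by rewrite exprn_gt0 // divr_gt0 ?psi_gt0 // geod_r_gt0. Qed.

Lemma model_metricE : model_metric psi x =
  b%:M + ((1 - b) / sqn x) *: (x^T *m x).
Proof.
apply/matrixP => i j; rewrite !mxE (negbTE x0) big_ord1 !mxE geod_r2 /b.
rewrite expr_div_n geod_r2 -[X in _ = X + _]mulr_natr.
move: ((i == j)%:R : R) (sqn_gt0 x0); move: (sqn x) (psi r) (x 0 i) (x 0 j) => s p a c d s0.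
by field; rewrite gt_eqF.
Qed.

Lemma det_metric : \det (model_metric psi x) = b ^+ N.-1.
Proof.
have b0 : b != 0 by rewrite gt_eqF // b_gt0.
rewrite model_metricE det_scalar_rank1 // xxT00.
have E : b ^+ N = b * b ^+ N.-1 by rewrite -exprS prednK //; apply: leq_trans N5.
rewrite E; have := sqn_gt0 x0; move: (sqn x) (b ^+ N.-1) => s B s0.
by field; rewrite b0 gt_eqF.
Qed.

Lemma vol_densityE : vol_density psi x = rad voldens x.
Proof.
rewrite /vol_density det_metric /b -exprM mulnC exprM sqrtr_sqr ger0_norm //.
by rewrite exprn_ge0 // divr_ge0 ?geod_r_ge0 // ltW // psi_gt0 // geod_r_gt0.
Qed.

Lemma inv_metricE i j : inv_metric psi x i j =
  b^-1 * (i == j)%:R + (1 - b^-1) / sqn x * (x 0 i * x 0 j).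
Proof.
have b0 : b != 0 by rewrite gt_eqF // b_gt0.
have s0 := lt0r_neq0 (sqn_gt0 x0).
pose B := (b^-1)%:M + ((1 - b^-1) / sqn x) *: (x^T *m x).
have AB : model_metric psi x *m B = 1%:M.
  have XX : (x^T *m x) *m (x^T *m x) = sqn x *: (x^T *m x).
    rewrite mulmxA -(mulmxA x^T x) [x *m x^T]mx11_scalar xxT00 mul_mx_scalar.
    by rewrite -scalemxAl.
  rewrite model_metricE mulmxDl !mulmxDr -!scalemxAl -!scalemxAr XX.
  rewrite -scalar_mxM mulfV // mul_scalar_mx mul_mx_scalar !scalerA -addrA -!scalerDl.
  rewrite -[RHS]addr0; congr (_ + _); rewrite [X in X *: _](_ : _ = 0) ?scale0r //.
  by field; rewrite b0 s0.
have [uA uB] := mulmx1_unit AB.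
have -> : inv_metric psi x = B.
  by rewrite /inv_metric -[RHS](mulKmx uA) AB mulmx1.
by rewrite !mxE big_ord1 !mxE mulr_natr.
Qed.

End At.

Variable u : V -> R.
Hypothesis su : smooth u.

Lemma inv_grad x i : x != 0 -> \sum_j inv_metric psi x i j * pder j u x =
  inv_psi psi x ^+ 2 * sph_grad u i x + inv_r x ^+ 2 * ue u x * x 0 i.
Proof.
move=> x0; have r0 := geod_r_gt0 x0; have p0 := psi_gt0 r0.
under eq_bigr do rewrite inv_metricE //.
transitivity (((psi (geod_r x) / geod_r x) ^+ 2)^-1 * (\sum_j pder j u x * (i == j)%:R)
   + (1 - ((psi (geod_r x) / geod_r x) ^+ 2)^-1) / sqn x * x 0 i * (\sum_j x 0 j * pder j u x)
   + 0 * (\sum_(j < N) 0)).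
  rewrite -sum_lin3; apply: eq_bigr => j _.
  move: (pder j u x) (x 0 i) (x 0 j) ((i == j)%:R : R) (_^-1) => *; ring.
rewrite sumr_delta -/(ue u x) /sph_grad /inv_psi /inv_r /rad -geod_r2 mul0r addr0.
move: (ue u x) (pder i u x) (x 0 i) => e p a.
move: p0 r0; move: (psi _) => f; move: (geod_r x) => r f0 r0.
by field; rewrite !gt_eqF.
Qed.

Lemma grad_norm2E x : x != 0 -> grad_norm2 psi u x =
  inv_r x ^+ 2 * ue u x ^+ 2 + inv_psi psi x ^+ 2 * sph_grad2 u x.
Proof.
move=> x0; rewrite /grad_norm2.
transitivity (\sum_i (inv_psi psi x ^+ 2 * sph_grad u i x + inv_r x ^+ 2 * ue u x * x 0 i) * pder i u x).
  apply: eq_bigr => i _; rewrite -inv_grad // mulr_suml.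
  by apply: eq_bigr => j _; rewrite mulrAC.
transitivity (inv_psi psi x ^+ 2 * (\sum_i sph_grad u i x * pder i u x)
  + inv_r x ^+ 2 * ue u x * (\sum_i x 0 i * pder i u x) + 0 * (\sum_(j < N) 0)).
  rewrite -sum_lin3; apply: eq_bigr => j _.
  move: (pder j u x) (x 0 j) (sph_grad u j x) => *; ring.
rewrite sph_grad_sum -/(ue u x) -/(uP u x) /sph_grad2.
move: (sqn x) (uP u x) (ue u x) => *; ring.
Qed.

Definition dvol (t : R) := (N.-1)%:R * ((psi t * t^-1) ^+ N.-2 *
  (psi1 t * t^-1 + - (psi t * (t^-1 * t^-1)))).

Lemma D_vol (t : R) : 0 < t -> is_derive t 1 voldens (dvol t).
Proof.
move=> t0.
have h := pdM (dpsi t0) (D_inv_r t0).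
have := @is_deriveX R R (fun t => psi t * t^-1) N.-1 t 1 _ h.
have -> : ((fun t => psi t * t^-1) ^+ N.-1 : R -> R) = voldens.
  by apply/funext => z; rewrite exprfctE.
move=> H; apply: (is_derive_eq H); rewrite /dvol /d_inv_r.
have scE (a b : R) : a *: b = a * b by [].
by rewrite scE; move: (_ ^+ N.-2) => q; ring.
Qed.

Lemma C0p_dvol : C0p dvol.
Proof.
have hp := C0p_psi dpsi; have h1 := C0p_psi1 dpsi1; have hv := @C0p_V R.
have hq := C0p_mul hp hv.
have hn (k : nat) : C0p (fun t : R => (psi t * t^-1) ^+ k).
  elim: k => [|k IH]; first by move=> t _; exact: cst_continuous.
  have -> : (fun t : R => (psi t * t^-1) ^+ k.+1) =
      (fun t => psi t * t^-1 * (psi t * t^-1) ^+ k).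
    by apply/funext => z; rewrite exprS.
  exact: (C0p_mul hq IH).
have hc : C0p (fun _ : R => (N.-1)%:R : R) by move=> t _; exact: cst_continuous.
exact: (C0p_mul hc (C0p_mul (hn N.-2) (C0p_add (C0p_mul h1 hv) (C0p_opp (C0p_mul hp (C0p_mul hv hv)))))).
Qed.

Lemma natr_pred : (N.-1)%:R = nr :> R.
Proof. by rewrite -subn1 natrB //; apply: leq_trans N5. Qed.

Lemma t_dvol (t : R) : 0 < t ->
  t * dvol t = nr * (t * psi1 t * (psi t)^-1 - 1) * voldens t.
Proof.
move=> t0; have p0 := psi_gt0 t0.
rewrite /dvol /voldens natr_pred.
have -> : N.-1 = N.-2.+1 by case: (N) N5 => [|[|]].
rewrite exprS; move: (_ ^+ N.-2) => q.
by field; rewrite !gt_eqF.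
Qed.

Lemma vol_C1 : C1 (rad voldens : V -> R).
Proof. exact: (C1_rad D_vol C0p_dvol). Qed.

Lemma E_vol x : x != 0 ->
  hasD (fun i => x 0 i) x (rad voldens) (nr * (kappa psi psi1 x - 1) * rad voldens x).
Proof.
move=> x0; apply: (hasD_eq (E_rad x0 D_vol C0p_dvol)).
by rewrite t_dvol // geod_r_gt0.
Qed.

Lemma lap_gE x : x != 0 ->
  lap_g psi u x = radial_lap psi psi1 u x + inv_psi psi x ^+ 2 * sph_lap u x.
Proof.
move=> x0; rewrite /lap_g.
pose A y := rad voldens y * (inv_r y * inv_r y) * ue u y.
pose B y := rad voldens y * (inv_psi psi y * inv_psi psi y).
have vc := vol_C1; have rc := @inv_r_C1 R N; have ec := e_C1 su.
have sc := inv_psi_C1 dpsi dpsi1 psi_gt0.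
have Ac : C1 A by exact: (C1_mul (C1_mul vc (C1_mul rc rc)) ec).
have Bc : C1 (B : V -> R) by exact: (C1_mul vc (C1_mul (sc N) (sc N))).
(* The closed forms of density and inverse metric hold off the origin only, so the differentiated
   functions are compared near [x]. *)
have near_eq i : pder i (fun y => vol_density psi y * \sum_j inv_metric psi y i j * pder j u y) x
    = pder i (fun y => A y * y 0 i + B y * sph_grad u i y) x.
  apply: near_eq_derive; have := near_neq0 x0; apply: filterS => y y0.
  rewrite vol_densityE // inv_grad // /A /B.
  move: (rad voldens y) (inv_psi psi y) (inv_r y) (sph_grad u i y) (ue u y) (y 0 i) => *; ring.
under eq_bigr do rewrite near_eq.
have cA i : C1 (fun y => A y * y 0 i) by exact: (C1_mul Ac (C1_coord i)).
have cB i : C1 (fun y => B y * sph_grad u i y) by exact: (C1_mul Bc (sph_grad_C1 su i)).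
rewrite (div_add x0 cA cB).
have M := @hasD_mul R N (fun i => x 0 i) x x0.
have EA := M _ _ _ _ (M _ _ _ _ (E_vol x0) (M _ _ _ _ (E_inv_r x0) (E_inv_r x0))) (E_e su x0).
have Yx := x_sph_grad u x.
have MY := @hasD_mul R N (fun i => sph_grad u i x) x x0.
have ts := tan_rad x0 Yx (D_inv_psi dpsi psi_gt0) (C0p_d_inv_psi dpsi dpsi1 psi_gt0).
have tv := tan_rad x0 Yx D_vol C0p_dvol.
have EB := MY _ _ _ _ tv (MY _ _ _ _ ts ts).
rewrite (div_scal x0 (@C1_coord R N) (div_coord x) EA).
rewrite (div_scal x0 (sph_grad_C1 su) (div_sph_grad su x0) EB).
rewrite vol_densityE //.
have v0 : rad voldens x != 0.
  by rewrite /rad /voldens expf_neq0 // mulf_neq0 ?invr_eq0 // gt_eqF // ?psi_gt0 ?geod_r_gt0.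
rewrite /radial_lap /A /B /inv_psi.
move: (inv_r x) (kappa psi psi1 x) (ue u x) (uh1 u x) (sph_lap u x) v0.
move: (rad voldens x) (rad _ x) => v s rho k e h c v0.
by field.
Qed.

End Metric.

(** * Passage to the limit in the extended reals *)

Section Ereal.
Context {R : realType}.

(** Only [B] is known to be finite, through the bound [M]; the other limits may be infinite. The
    limit is therefore taken in additive form and [c1 * B] subtracted at the end. *)
Lemma ereal_limit_ineq (a b c d : nat -> R) (A B C D : \bar R) (c1 c2 c3 K M : R) :
  0 <= c1 -> 0 <= c2 -> 0 <= c3 ->
  (forall m, 0 <= b m) -> (forall m, 0 <= c m) -> (forall m, 0 <= d m) ->
  (a m)%:E @[m --> \oo] --> A -> (b m)%:E @[m --> \oo] --> B ->
  (c m)%:E @[m --> \oo] --> C -> (d m)%:E @[m --> \oo] --> D ->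
  (forall m, b m <= M) ->
  (forall m, c1 * b m + (c2 * c m + c3 * d m) <= a m + K * m.+1%:R^-1) ->
  (c2%:E * C + c3%:E * D <= A - c1%:E * B)%E.
Proof.
move=> c10 c20 c30 b0 c0 d0 aA bB cC dD bM H.
have B0 : (0 <= B)%E by apply: (cvge_ge _ bB); apply: nearW => m; rewrite lee_fin.
have C0 : (0 <= C)%E by apply: (cvge_ge _ cC); apply: nearW => m; rewrite lee_fin.
have D0 : (0 <= D)%E by apply: (cvge_ge _ dD); apply: nearW => m; rewrite lee_fin.
have BM : (B <= M%:E)%E by apply: (cvge_le _ bB); apply: nearW => m; rewrite lee_fin.
have Bfin : B \is a fin_num.
  by rewrite ge0_fin_numE // (le_lt_trans BM) // ltry.
have Z (q : R) (f : nat -> R) (F : \bar R) : (f m)%:E @[m --> \oo] --> F ->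
    (q * f m)%:E @[m --> \oo] --> (q%:E * F)%E.
  by move=> fF; under eq_fun do rewrite EFinM; apply: cvgeZl.
have L1 : (c1 * b m + (c2 * c m + c3 * d m))%:E @[m --> \oo] -->
   (c1%:E * B + (c2%:E * C + c3%:E * D))%E.
  under eq_fun do rewrite EFinD.
  apply: cvgeD; [|exact: Z|].
    by apply: ge0_adde_def; rewrite inE ?adde_ge0 // mule_ge0 // lee_fin.
  under eq_fun do rewrite EFinD.
  apply: cvgeD; [|exact: Z|exact: Z].
  by apply: ge0_adde_def; rewrite inE mule_ge0 // lee_fin.
have L2 : (a m + K * m.+1%:R^-1)%:E @[m --> \oo] --> (A + 0)%E.
  under eq_fun do rewrite EFinD.
  apply: cvgeD; first by rewrite fin_num_adde_defl.
    exact: aA.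
  apply/cvg_EFin; first by apply: nearW => m.
  have := @cvg_harmonic R; rewrite /harmonic => h.
  rewrite -[X in _ --> X](mulr0 K).
  by apply: cvgM; [exact: cvg_cst|exact: h].
have le : (c1%:E * B + (c2%:E * C + c3%:E * D) <= A + 0)%E.
  rewrite -(cvg_lim _ L1) // -(cvg_lim _ L2) //.
  apply: lee_lim; [by apply/cvg_ex; eexists; exact: L1|by apply/cvg_ex; eexists; exact: L2|].
  by apply: nearW => m; rewrite lee_fin.
rewrite leeBrDl; last by rewrite fin_numM.
by rewrite -[A]adde0.
Qed.

End Ereal.

(** * Cutoff at the pole *)

Section Cutoff.
Context {R : realType}.
Implicit Types t : R.

Definition pos_sq t : R := Num.max t 0 * Num.max t 0.

Lemma is_derive_pos_sq t : is_derive t 1 pos_sq (2 * Num.max t 0).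
Proof.
have [t0|t0|->] := ltgtP t 0.
- have h : {near t, cst 0 =1 pos_sq}.
    have := lt_nbhsl t0; apply: filterS => y /= y0.
    by rewrite /pos_sq max_r ?mulr0 // ltW.
  apply: (near_eq_is_derive h).
  by rewrite mulr0; exact: is_derive_cst.
- have h : {near t, (fun y => y * y) =1 pos_sq}.
    have := lt_nbhsr t0; apply: filterS => y /= y0.
    by rewrite /pos_sq max_l // ltW.
  apply: (near_eq_is_derive h).
  apply: (pd_eq (pdM (is_derive_id t (1 : R)) (is_derive_id t (1:R)))).
  by ring.
have cv : (fun h : R => h^-1 *: ((pos_sq \o shift 0) (h *: 1) - pos_sq 0)) @ 0^' --> (0 : R).
  apply/cvgr0Pnorm_le => e e0; near=> h.
  rewrite /= addr0 [h *: 1]mulr1 /pos_sq maxxx mulr0 subr0.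
  have h0 : h != 0 by near: h; exact: nbhs_dnbhs_neq.
  have he : `|h| <= e by near: h; exact: dnbhs0_le.
  have scE (a b : R) : a *: b = a * b by [].
  rewrite scE; have [hp|hn] := leP h 0; first by rewrite !mulr0 normr0 ltW.
  by rewrite mulrA mulVf // mul1r.
apply: DeriveDef; first by apply/cvg_ex; exists 0.
by rewrite mulr0; apply/cvg_lim.
Unshelve. all: by end_near. Qed.

Lemma continuous_max0 : continuous (fun t => Num.max t 0).
Proof.
move=> t; have -> : (fun t => Num.max t 0) = (fun t : R => 2^-1 * (t + `|t|)).
  apply/funext => y; have [y0|y0] := leP y 0.
    by rewrite ler0_norm // subrr mulr0.
  by rewrite gtr0_norm //; field.
apply: cvgM; first exact: cvg_cst.
by apply: cvgD; [exact: cvg_id|exact: norm_continuous].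
Qed.

(* The integral of a hat function supported in [1, 2]. *)
Definition theta t : R :=
  2 * (pos_sq (t - 1) - 2 * pos_sq (t - 3 / 2) + pos_sq (t - 2)).

Definition dtheta t : R :=
  4 * (Num.max (t - 1) 0 - 2 * Num.max (t - 3 / 2) 0 + Num.max (t - 2) 0).

Lemma is_derive_theta t : is_derive t 1 theta (dtheta t).
Proof.
have sh (c : R) : is_derive t 1 (fun t => pos_sq (t - c)) (2 * Num.max (t - c) 0).
  have := @is_derive1_comp _ pos_sq (fun t => t - c) t _ _ (is_derive_pos_sq (t - c))
    (pdD (is_derive_id t (1 : R)) (pdC t (1 : R) (- c))).
  by move=> h; apply: (is_derive_eq h); rewrite addr0 mulr1.
apply: (pd_eq (pdM (pdC t 1 2) (pdD (pdD (sh 1) (pdN (pdM (pdC t 1 2) (sh (3 / 2))))) (sh 2)))).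
rewrite /dtheta; move: (Num.max _ _) (Num.max _ _) (Num.max _ _) => a b c; ring.
Qed.

Lemma theta0 t : t <= 1 -> theta t = 0.
Proof. by move=> t1; rewrite /theta /pos_sq !max_r; lra. Qed.

Lemma theta1 t : 2 <= t -> theta t = 1.
Proof. by move=> t1; rewrite /theta /pos_sq !max_l; try lra; field. Qed.

Lemma dtheta0 t : t <= 1 -> dtheta t = 0.
Proof. by move=> t1; rewrite /dtheta !max_r; lra. Qed.

Lemma dtheta1 t : 2 <= t -> dtheta t = 0.
Proof. by move=> t1; rewrite /dtheta !max_l; try lra; field. Qed.

Lemma dtheta_ge0 t : 0 <= dtheta t.
Proof.
rewrite /dtheta; have [h1|h1] := leP (t - 1) 0; have [h2|h2] := leP (t - 3 / 2) 0;
  have [h3|h3] := leP (t - 2) 0; lra.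
Qed.

Lemma dtheta_le t : dtheta t <= 2.
Proof.
rewrite /dtheta; have [h1|h1] := leP (t - 1) 0; have [h2|h2] := leP (t - 3 / 2) 0;
  have [h3|h3] := leP (t - 2) 0; lra.
Qed.

Lemma continuous_dtheta : continuous dtheta.
Proof.
have c (a : R) : continuous (fun t => Num.max (t - a) 0).
  move=> t; apply: (@continuous_comp _ _ _ (fun t => t - a) (fun t => Num.max t 0)).
    by apply: cvgD; [exact: cvg_id|exact: cvg_cst].
  exact: continuous_max0.
move=> t; apply: cvgM; first exact: cvg_cst.
apply: cvgD; last exact: c.
apply: cvgB; first exact: c.
by apply: cvgM; [exact: cvg_cst|exact: c].
Qed.

Lemma theta_nd t s : t <= s -> theta t <= theta s.
Proof.
move=> ts.
have [||c _ E] := @MVT_segment R theta dtheta t s ts.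
- by move=> y _; exact: is_derive_theta.
- apply: derivable_within_continuous => y _.
  exact: (@ex_derive _ _ _ _ _ _ _ (is_derive_theta y)).
by rewrite -subr_ge0 E mulr_ge0 ?dtheta_ge0 // subr_ge0.
Qed.

Lemma theta_ge0 t : 0 <= theta t.
Proof.
have [t1|t1] := leP t 1; first by rewrite theta0.
by rewrite -(@theta0 1) // theta_nd // ltW.
Qed.

Lemma theta_le1 t : theta t <= 1.
Proof.
have [t1|t1] := leP 2 t; first by rewrite theta1.
by rewrite -(@theta1 2) // theta_nd // ltW.
Qed.

Definition cutoff (k t : R) := theta (k * t * t).
Definition dcutoff (k t : R) := dtheta (k * t * t) * (2 * k * t).

Lemma is_derive_cutoff k t : is_derive t 1 (cutoff k) (dcutoff k t).
Proof.
have := @is_derive1_comp _ theta (fun t => k * t * t) t _ _ (is_derive_theta _)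
  (pdM (pdM (pdC t 1 k) (is_derive_id t (1 : R))) (is_derive_id t (1:R))).
move=> h; apply: (is_derive_eq h); rewrite /dcutoff; move: (dtheta _) => a /=; ring.
Qed.

Lemma continuous_dcutoff k : continuous (dcutoff k).
Proof.
move=> t; apply: cvgM.
  apply: (@continuous_comp _ _ _ (fun t => k * t * t) dtheta).
    by apply: cvgM; [apply: cvgM; [exact: cvg_cst|exact: cvg_id]|exact: cvg_id].
  exact: continuous_dtheta.
by apply: cvgM; [exact: cvg_cst|exact: cvg_id].
Qed.

Lemma cutoff_nd k l t : k <= l -> cutoff k t <= cutoff l t.
Proof. by move=> kl; apply: theta_nd; rewrite -!mulrA ler_wpM2r // -expr2 sqr_ge0. Qed.

(** With q = k t^2 the quantity is 2 q theta'(q), independent of the scale; theta' is at most 2 and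
    vanishes for q >= 2, whence 8. *)
Lemma t_dcutoff_le k t : 0 <= k -> `|t * dcutoff k t| <= 8.
Proof.
move=> k0; rewrite /dcutoff.
have -> : t * (dtheta (k * t * t) * (2 * k * t)) = 2 * (k * t * t) * dtheta (k * t * t).
  by move: (dtheta _) => d; ring.
have : 0 <= k * t * t by rewrite -mulrA mulr_ge0 // -expr2 sqr_ge0.
move: (k * t * t) => q q0.
have [q2|q2] := leP 2 q; first by rewrite dtheta1 // mulr0 normr0.
have d0 := dtheta_ge0 q; have d2 := dtheta_le q.
by rewrite ger0_norm; nra.
Qed.

Lemma dcutoff_far k t : 2 <= k * t * t -> dcutoff k t = 0.
Proof. by move=> h; rewrite /dcutoff dtheta1 // mul0r. Qed.

Lemma dcutoff_near k t : k * t * t <= 1 -> dcutoff k t = 0.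
Proof. by move=> h; rewrite /dcutoff dtheta0 // mul0r. Qed.

End Cutoff.

(** * Consequences of the curvature conditions for psi *)

Section Psi.
Context {R : realType}.
Variable psi : R -> R.
Hypothesis psi_smooth : forall (n : nat) (t : R), derivable (derive1n n psi) t 1.
Hypothesis psi_gt0 : forall t : R, 0 < t -> 0 < psi t.
Hypothesis psi'0 : derive1n 1 psi 0 = 1.
Hypothesis psi_even0 : forall k : nat, derive1n (2 * k) psi 0 = 0.
Hypothesis K_le : forall r : R, 0 < r -> K_rad psi r <= -1.
Hypothesis H_le : forall r : R, 0 < r -> H_tan psi r <= K_rad psi r.
Implicit Types t : R.
Notation psi1 := (derive1n 1 psi).
Notation psi2 := (derive1n 2 psi).

Lemma D_psi n t : is_derive t 1 (derive1n n psi) (derive1n n.+1 psi t).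
Proof.
rewrite derive1nS derive1E; apply: derivableP; exact: psi_smooth.
Qed.

Lemma cont_psi n : continuous (derive1n n psi).
Proof. by move=> t; apply/differentiable_continuous/derivable1_diffP/psi_smooth. Qed.

Lemma psi0 : psi 0 = 0. Proof. exact: (psi_even0 0). Qed.

Lemma psi2_ge t : 0 < t -> psi t <= psi2 t.
Proof.
move=> t0; have := K_le t0; rewrite /K_rad lerN2 ler_pdivlMr ?psi_gt0 //.
by rewrite mul1r.
Qed.

Lemma psi1_sq_ge t : 0 < t -> 1 + psi t * psi2 t <= psi1 t ^+ 2.
Proof.
move=> t0; have p0 := psi_gt0 t0; have := H_le t0.
rewrite /H_tan /K_rad lerN2 ler_pdivlMr ?exprn_gt0 // => h.
rewrite addrC -lerBrDr (le_trans _ h) // expr2 mulrA divfK ?gt_eqF //.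
by rewrite mulrC.
Qed.

Lemma psi1_ge1 t : 0 <= t -> 1 <= psi1 t.
Proof.
move=> t0; have [||c /andP[c0 ct] E] := @MVT_segment R psi1 psi2 0 t t0.
- by move=> y _; exact: D_psi.
- apply: derivable_within_continuous => y _; exact: psi_smooth.
rewrite -psi'0 -subr_ge0 E mulr_ge0 ?subr_ge0 //.
have : 0 <= c by [].
rewrite le_eqVlt => /orP[/eqP <-|c0'].
  (* [psi2_ge] covers positive arguments only; at 0 the second derivative vanishes by the parity
     condition with k = 1. *)
  by rewrite (psi_even0 1).
by rewrite (le_trans _ (psi2_ge c0')) // ltW // psi_gt0.
Qed.

(** The slope of psi is at least 1. This comparison with flat space bounds 1 / psi by 1 / r near the
    pole. *)
Lemma psi_ge t : 0 <= t -> t <= psi t.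
Proof.
move=> t0; have [||c /andP[c0 ct] E] := @MVT_segment R psi psi1 0 t t0.
- by move=> y _; exact: (D_psi 0).
- apply: derivable_within_continuous => y _; exact: (@ex_derive _ _ _ _ _ _ _ (D_psi 0 y)).
move: E; rewrite psi0 !subr0 => ->; rewrite ler_peMl // psi1_ge1 //.
Qed.

Lemma psi_bounds (A : R) : 0 <= A -> exists2 M : R, 0 <= M &
  forall t, 0 <= t <= A -> psi t <= M * t /\ psi1 t <= M.
Proof.
move=> A0.
have [c _ hc] := @EVT_max R psi1 0 A A0 (continuous_subspaceT (@cont_psi 1)).
exists (Num.max 0 (psi1 c)); first by rewrite le_max lexx.
move=> t /andP[t0 tA].
have P1 y : 0 <= y <= A -> psi1 y <= Num.max 0 (psi1 c).
  by move=> h; rewrite le_max hc ?orbT // in_itv.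
split; last by apply: P1; rewrite t0.
have [||d /andP[d0 dt] E] := @MVT_segment R psi psi1 0 t t0.
- by move=> y _; exact: (D_psi 0).
- apply: derivable_within_continuous => y _; exact: (@ex_derive _ _ _ _ _ _ _ (D_psi 0 y)).
move: E; rewrite psi0 !subr0 => ->; rewrite ler_wpM2r // P1 //.
by rewrite (le_trans _ tA) // andbT.
Qed.

End Psi.

(** * Orders of magnitude at the pole *)

Section BigO.
Context {R : realType} {N : nat}.
Notation V := 'rV[R]_N.
Implicit Types (x : V) (f g : V -> R) (k l : int).
Variable Lam : R.
Hypothesis Lam1 : 1 <= Lam.

(* [f] is of order r^k on the ball r <= Lam, with k possibly negative. *)
Definition Ob k f := exists2 K : R, 0 <= K &
  forall x, x != 0 -> geod_r x <= Lam -> `|f x| <= K * geod_r x ^ k.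

Lemma Ob_add k f g : Ob k f -> Ob k g -> Ob k (fun x => f x + g x).
Proof.
move=> [K K0 hf] [L L0 hg]; exists (K + L); first exact: addr_ge0.
move=> x x0 xL; rewrite mulrDl (le_trans (ler_normD _ _)) //.
by apply: lerD; [exact: hf|exact: hg].
Qed.

Lemma Ob_opp k f : Ob k f -> Ob k (fun x => - f x).
Proof. by move=> [K K0 hf]; exists K => // x x0 xL; rewrite normrN hf. Qed.

Lemma Ob_mul k l f g : Ob k f -> Ob l g -> Ob (k + l) (fun x => f x * g x).
Proof.
move=> [K K0 hf] [L L0 hg]; exists (K * L); first exact: mulr_ge0.
move=> x x0 xL; rewrite normrM expfzDr ?gt_eqF ?geod_r_gt0 // mulrACA.
by apply: ler_pM => //; [exact: hf|exact: hg].
Qed.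

Lemma Ob_weak (n : nat) k f : Ob (k + n%:Z) f -> Ob k f.
Proof.
move=> [K K0 hf]; exists (K * Lam ^+ n).
  by rewrite mulr_ge0 // exprn_ge0 // (le_trans _ Lam1).
move=> x x0 xL; apply: (le_trans (hf x x0 xL)).
have r0 := geod_r_gt0 x0.
rewrite expfzDr ?gt_eqF // -mulrA [_ ^ k * _]mulrC ler_wpM2l //.
rewrite ler_wpM2r ?exprz_ge0 ?(ltW r0) //.
by rewrite -exprnP lerXn2r ?nnegrE ?(ltW r0) // (le_trans _ Lam1).
Qed.

Lemma Ob_bounded f (K : R) : (forall x, `|f x| <= K) -> Ob 0 f.
Proof.
move=> h; exists K; first by rewrite (le_trans _ (h 0)).
by move=> x _ _; rewrite expr0z mulr1.
Qed.

Lemma Ob_cst (c : R) : Ob 0 (fun=> c).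
Proof. exact: (@Ob_bounded _ `|c|). Qed.

Lemma Ob_sum n k (F : 'I_n -> V -> R) : (forall i, Ob k (F i)) ->
  Ob k (fun x => \sum_(i < n) F i x).
Proof.
elim: n F => [|n IH] F h.
  by exists 0 => // x x0 _; rewrite big_ord0 normr0 mul0r.
have [K K0 hK] := Ob_add (h ord0) (IH (fun i => F (lift ord0 i)) (fun i => h _)).
by exists K => // x x0 xL; rewrite big_ord_recl; exact: hK.
Qed.

Lemma coord_le_r x i : `|x 0 i| <= geod_r x.
Proof.
rewrite -sqrtr_sqr /geod_r ler_wsqrtr // (bigD1 i) //= lerDl.
by apply: sumr_ge0 => j _; exact: sqr_ge0.
Qed.

Lemma Ob_coord i : Ob 1 (fun x => x 0 i).
Proof. by exists 1 => // x _ _; rewrite expr1z mul1r coord_le_r. Qed.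

Lemma Ob_cpt A f : 0 <= A -> continuous f -> (forall x, A < `|x| -> f x = 0) -> Ob 0 f.
Proof.
move=> A0 fc f0.
have ne : [set x : V | `|x| <= A] !=set0 by exists 0; rewrite /= normr0.
have nc : {within [set x : V | `|x| <= A], continuous (fun x => `|f x|)}.
  apply: continuous_subspaceT => x.
  by apply: (@continuous_comp _ _ _ f (fun t : R => `|t|)); [exact: fc|exact: norm_continuous].
have [c _ hc] := EVT_max_rV ne (@compact_ball0 R N A) nc.
apply: (@Ob_bounded _ `|f c|) => x.
have [xA|xA] := leP `|x| A; first by apply: hc; rewrite inE.
by rewrite f0 // normr0.
Qed.

Section Bounds.
Variables psi psi1 : R -> R.
Variable M : R.
Hypothesis M0 : 0 <= M.
Hypothesis psi_ge : forall t : R, 0 <= t -> t <= psi t.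
Hypothesis psi_le : forall t : R, 0 <= t <= Lam -> psi t <= M * t.
Hypothesis psi1_le : forall t : R, 0 <= t <= Lam -> `|psi1 t| <= M.
Variable u : V -> R.
Hypothesis su : smooth u.
Variable A : R.
Hypothesis A0 : 0 <= A.
Hypothesis u0 : forall x, A < `|x| -> u x = 0.

Lemma pder_u_vanish i x : A < `|x| -> pder i u x = 0.
Proof. exact: pder_vanish. Qed.

Lemma hess_vanish i j x : A < `|x| -> hess u i j x = 0.
Proof. by apply: pder_vanish => y; exact: pder_u_vanish. Qed.

Lemma Ob_p i : Ob 0 (pder i u).
Proof. by apply: (Ob_cpt A0); [exact: (su [:: i]).1|exact: pder_u_vanish]. Qed.

Lemma Ob_hess i j : Ob 0 (hess u i j).
Proof. by apply: (Ob_cpt A0); [exact: (su [:: i; j]).1|exact: hess_vanish]. Qed.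

Lemma Ob_sqn : Ob 2 (@sqn R N).
Proof.
exists 1 => // x _ _; rewrite mul1r -geod_r2 ger0_norm ?sqr_ge0 //.
Qed.

Lemma Ob_e : Ob 1 (ue u).
Proof. by apply: Ob_sum => i; exact: (Ob_mul (Ob_coord i) (Ob_p i)). Qed.
Lemma Ob_P : Ob 0 (uP u).
Proof. by apply: Ob_sum => i; exact: (Ob_mul (Ob_p i) (Ob_p i)). Qed.
Lemma Ob_Hx i : Ob 1 (uHx u i).
Proof. by apply: Ob_sum => j; exact: (Ob_mul (Ob_hess i j) (Ob_coord j)). Qed.
Lemma Ob_h1 : Ob 2 (uh1 u).
Proof. by apply: Ob_sum => i; exact: (Ob_mul (Ob_coord i) (Ob_Hx i)). Qed.
Lemma Ob_h2 : Ob 1 (uh2 u).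
Proof. by apply: Ob_sum => i; exact: (Ob_mul (Ob_p i) (Ob_Hx i)). Qed.
Lemma Ob_sph_grad2 : Ob 2 (sph_grad2 u).
Proof.
apply: Ob_add; first exact: (Ob_mul Ob_sqn Ob_P).
exact: (Ob_opp (Ob_mul Ob_e Ob_e)).
Qed.
Lemma Ob_sph_Gam : Ob 2 (sph_Gam u).
Proof.
apply: Ob_add; first exact: (Ob_mul Ob_sqn (Ob_add Ob_P (@Ob_weak 1 0 _ Ob_h2))).
exact: (Ob_opp (Ob_mul Ob_e (Ob_add Ob_e (@Ob_weak 1 1 _ Ob_h1)))).
Qed.

Lemma Ob_inv_r : Ob (-1) (@inv_r R N).
Proof.
exists 1 => // x x0 _; rewrite mul1r /inv_r /rad exprN1 ger0_norm //.
by rewrite invr_ge0 geod_r_ge0.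
Qed.

Lemma psi_pos t : 0 < t -> 0 < psi t.
Proof. by move=> t0; apply: (lt_le_trans t0); apply: psi_ge; exact: ltW. Qed.

Lemma Ob_inv_psi : Ob (-1) (inv_psi psi : V -> R).
Proof.
exists 1 => // x x0 _; have r0 := geod_r_gt0 x0; have p0 := psi_pos r0.
rewrite mul1r /inv_psi /rad exprN1 ger0_norm ?invr_ge0 ?(ltW p0) //.
by rewrite lef_pV2 ?posrE // psi_ge // ltW.
Qed.

Lemma Ob_kappa : Ob 0 (kappa psi psi1 : V -> R).
Proof.
exists M => // x x0 xL; have r0 := geod_r_gt0 x0; have p0 := psi_pos r0.
rewrite expr0z mulr1 /kappa /rad !normrM (gtr0_norm r0) normfV (gtr0_norm p0).
rewrite ler_pdivrMr // mulrC; apply: ler_pM => //; first exact: ltW.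
  by apply: psi1_le; rewrite ltW.
by apply: psi_ge; exact: ltW.
Qed.

Lemma Ob_vol : Ob 0 (rad (@voldens R N psi) : V -> R).
Proof.
exists (M ^+ N.-1); first exact: exprn_ge0.
move=> x x0 xL; have r0 := geod_r_gt0 x0; have p0 := psi_pos r0.
rewrite expr0z mulr1 /rad /voldens normrX lerXn2r ?nnegrE ?normr_ge0 //.
rewrite normrM normfV (gtr0_norm r0) (gtr0_norm p0) ler_pdivrMr //.
by apply: psi_le; rewrite ltW.
Qed.

(** Each summand has four factors of order -1 and one of order 2, namely e^2, [sph_Gam] or
    [sph_grad2]. *)
Lemma Ob_flux_rad : Ob (-2) (flux_rad psi psi1 u).
Proof.
have r2 := Ob_mul Ob_inv_r Ob_inv_r; have s2 := Ob_mul Ob_inv_psi Ob_inv_psi.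
have nk := Ob_mul (@Ob_cst (N%:R - 1)) Ob_kappa.
have e2 := Ob_mul Ob_e Ob_e.
apply: Ob_add; first apply: Ob_add.
- exact: (Ob_mul (Ob_mul (Ob_mul (Ob_mul (@Ob_cst (1/2)) (Ob_add (@Ob_cst 1) nk)) r2) r2) e2).
- exact: (Ob_opp (Ob_mul (Ob_mul r2 s2) (Ob_mul (@Ob_cst 2) Ob_sph_Gam))).
- exact: (Ob_mul (Ob_mul (Ob_mul r2 s2) (Ob_add (@Ob_cst 1) (Ob_opp nk))) Ob_sph_grad2).
Qed.

Lemma Ob_grad : Ob 0 (fun x => (inv_r x ^+ 2 * ue u x ^+ 2 + inv_psi psi x ^+ 2 * sph_grad2 u x) * rad (@voldens R N psi) x).
Proof.
have r2 := Ob_mul Ob_inv_r Ob_inv_r; have s2 := Ob_mul Ob_inv_psi Ob_inv_psi.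
have e2 := Ob_mul Ob_e Ob_e.
exact: (Ob_mul (Ob_add (Ob_mul r2 e2) (Ob_mul s2 Ob_sph_grad2)) Ob_vol).
Qed.

Lemma sums_vanish x : A < `|x| -> [/\ ue u x = 0 /\ sph_grad2 u x = 0, sph_lap u x = 0,
  radial_lap psi psi1 u x = 0, flux_rad psi psi1 u x = 0 & forall i, flux psi psi1 u i x = 0].
Proof.
move=> xA.
have e0 : ue u x = 0 by apply: big1 => i _; rewrite pder_u_vanish // mulr0.
have P0 : uP u x = 0 by apply: big1 => i _; rewrite pder_u_vanish // mulr0.
have Hx0 i : uHx u i x = 0 by apply: big1 => j _; rewrite hess_vanish // mul0r.
have h10 : uh1 u x = 0 by apply: big1 => i _; rewrite Hx0 // mulr0.
have h20 : uh2 u x = 0 by apply: big1 => i _; rewrite Hx0 // mulr0.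
have h40 : uh4 u x = 0 by apply: big1 => i _; rewrite hess_vanish.
have T0 : sph_grad2 u x = 0 by rewrite /sph_grad2 e0 P0 !mulr0 subrr.
have C0' : sph_lap u x = 0 by rewrite /sph_lap h40 e0 h10 !mulr0 !subr0.
have G0 : sph_Gam u x = 0 by rewrite /sph_Gam P0 h20 e0 h10 !addr0 !mulr0 subrr.
have L0 : radial_lap psi psi1 u x = 0 by rewrite /radial_lap h10 e0 !mulr0 addr0 mulr0.
have g0 : flux_rad psi psi1 u x = 0 by rewrite /flux_rad e0 G0 T0 !mulr0 subrr addr0.
split => // i.
have Y0 : sph_grad u i x = 0 by rewrite /sph_grad pder_u_vanish // e0 !mulr0 subrr.
have Hp0 : uHp u i x = 0 by apply: big1 => j _; rewrite pder_u_vanish // mulr0.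
rewrite /flux /bochner_field g0 L0 C0' G0 Y0 /half_grad_sph_grad2 P0 e0 Hp0.
by rewrite !(mulr0, mul0r, addr0, subrr, oppr0).
Qed.

End Bounds.
End BigO.

(** * The inequality with a cutoff *)

Section Final.
Context {R : realType} {N : nat}.
Notation V := 'rV[R]_N.
Implicit Types (x y : V) (f g : V -> R) (k t : R).
Notation nr := (N%:R - 1 : R).
Hypothesis N5 : (5 <= N)%N.
Variables psi psi1 psi2 : R -> R.
Hypothesis dpsi : forall t : R, 0 < t -> is_derive t 1 psi (psi1 t).
Hypothesis dpsi1 : forall t : R, 0 < t -> is_derive t 1 psi1 (psi2 t).
Hypothesis cpsi2 : C0p psi2.
Hypothesis psi_ge : forall t : R, 0 <= t -> t <= psi t.
Hypothesis psi2_ge : forall t : R, 0 < t -> psi t <= psi2 t.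
Hypothesis psi1_sq : forall t : R, 0 < t -> 1 + psi t * psi2 t <= psi1 t ^+ 2.
Variable u : V -> R.
Hypothesis su : smooth u.
Variable A : R.
Hypothesis A0 : 0 <= A.
Hypothesis u0 : forall x, A < `|x| -> u x = 0.

Let pgt (t : R) : 0 < t -> 0 < psi t.
Proof. by move=> t0; apply: (lt_le_trans t0); apply: psi_ge; exact: ltW. Qed.

Notation rho := (@inv_r R N).
Notation sig := (inv_psi psi : V -> R).
Notation v := (rad (@voldens R N psi) : V -> R).
Notation G := (flux_rad psi psi1 u).

Definition lap_val x := radial_lap psi psi1 u x + inv_psi psi x ^+ 2 * sph_lap u x.
Definition grad2_val x := inv_r x ^+ 2 * ue u x ^+ 2 + inv_psi psi x ^+ 2 * sph_grad2 u x.
Definition eta k x := rad (cutoff k) x.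

Lemma sqn_le_norm x : sqn x <= N%:R * `|x| ^+ 2.
Proof.
have -> : N%:R * `|x| ^+ 2 = \sum_(i < N) `|x| ^+ 2.
  by rewrite big_const_ord iter_addr_0 mulr_natl.
apply: ler_sum => i _.
by rewrite -real_normK ?num_real // lerXn2r ?nnegrE // rV_coord_le.
Qed.

Lemma near0_cut k : 0 < k -> exists2 d : R, 0 < d &
  forall x, `|x| < d -> k * geod_r x * geod_r x <= 1.
Proof.
(* The norm is the sup norm, so r^2 <= N |x|^2, and for |x| < 1 / q the product k r^2 is at most (q
   - 1) / q^2 <= 1. *)
move=> k0; pose q := k * N%:R + 1.
have n0 : 0 <= N%:R :> R by exact: ler0n.
have q0 : 0 < q by rewrite /q ltr_wpDl // mulr_ge0 // ltW.
exists q^-1; first by rewrite invr_gt0.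
move=> x xq; rewrite -mulrA -expr2 geod_r2.
apply: (@le_trans _ _ (k * (N%:R * q^-1 ^+ 2))).
  rewrite ler_wpM2l ?(ltW k0) // (le_trans (sqn_le_norm x)) // ler_wpM2l //.
  by rewrite lerXn2r ?nnegrE ?invr_ge0 // ltW.
have -> : k * (N%:R * q^-1 ^+ 2) = (q - 1) / q ^+ 2.
  by rewrite /q exprVn mulrA addrK.
rewrite ler_pdivrMr ?exprn_gt0 // mul1r.
have : 1 <= q by rewrite /q lerDr mulr_ge0 // ltW.
have sq (z : R) : 1 <= z -> z - 1 <= z ^+ 2 by move=> z1; nra.
exact: sq.
Qed.

Lemma cut_good (w : R -> R) k f : 0 < k -> continuous w ->
  (forall t, k * t * t <= 1 -> w t = 0) ->
  C0 f -> (forall x, A < `|x| -> f x = 0) ->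
  ucont (fun x => w (geod_r x) * f x) /\ vanish A 0 (fun x => w (geod_r x) * f x).
Proof.
(* Local names: [flux_coef] is here the continuity of [w], and [lap2_dens] the vanishing of [f]
   beyond [A]. *)
move=> k0 flux_coef w0 fc lap2_dens.
have gA x : A < `|x| -> w (geod_r x) * f x = 0 by move=> /lap2_dens ->; rewrite mulr0.
split; last exact/vanishP.
apply: (continuous_cpt_ucont _ gA).
have [d d0 hd] := near0_cut k0.
apply: (continuous_of_C0 d0).
  apply: C0_mul => //; apply: (@C0_rad _ _ w) => t _; exact: flux_coef.
by move=> x /hd /w0 ->; rewrite mul0r.
Qed.

Lemma continuous_cutoff k : continuous (cutoff k).
Proof.
move=> t; apply/differentiable_continuous/derivable1_diffP.
exact: (@ex_derive _ _ _ _ _ _ _ (is_derive_cutoff k t)).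
Qed.

Lemma cutoff_near k t : k * t * t <= 1 -> cutoff k t = 0.
Proof. by move=> h; rewrite /cutoff theta0. Qed.

Lemma vol_C0 : C0 v. Proof. exact: (vol_C1 dpsi dpsi1).1. Qed.
Lemma lap_val_C0 : C0 lap_val.
Proof.
have s : C0 sig := (inv_psi_C1 dpsi dpsi1 pgt).1.
exact: (C0_add (radial_lap_C1 dpsi dpsi1 cpsi2 pgt su).1 (C0_mul (C0_mul s s) (sph_lap_C1 su).1)).
Qed.
Lemma grad2_val_C0 : C0 grad2_val.
Proof.
have s : C0 sig := (inv_psi_C1 dpsi dpsi1 pgt).1; have r := (@inv_r_C1 R N).1.
have e := (e_C1 su).1.
exact: (C0_add (C0_mul (C0_mul r r) (C0_mul e e)) (C0_mul (C0_mul s s) (sph_grad2_C1 su).1)).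
Qed.

Definition lap2_dens x := lap_val x ^+ 2 * v x.
Definition grad2_dens x := grad2_val x * v x.
Definition grad2_r_dens x := grad2_val x * rho x ^+ 2 * v x.
Definition grad2_psi_dens x := grad2_val x * sig x ^+ 2 * v x.
Definition flux_dens x := v x * G x.

Lemma dens_C0 : [/\ C0 lap2_dens, C0 grad2_dens, C0 grad2_r_dens, C0 grad2_psi_dens & C0 flux_dens].
Proof.
have s : C0 sig := (inv_psi_C1 dpsi dpsi1 pgt).1; have r := (@inv_r_C1 R N).1.
have vc := vol_C0; have lc := lap_val_C0; have gc := grad2_val_C0.
split.
- exact: (C0_mul (C0_mul lc lc) vc).
- exact: (C0_mul gc vc).
- exact: (C0_mul (C0_mul gc (C0_mul r r)) vc).
- exact: (C0_mul (C0_mul gc (C0_mul s s)) vc).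
- exact: (C0_mul vc (flux_rad_C1 dpsi dpsi1 cpsi2 pgt su).1).
Qed.

Lemma dens_vanish x : A < `|x| -> [/\ lap2_dens x = 0, grad2_dens x = 0, grad2_r_dens x = 0, grad2_psi_dens x = 0 & flux_dens x = 0].
Proof.
move=> xA; have [[e0 T0] C0' L0 g0 _] := sums_vanish psi psi1 u0 xA.
have gn0 : grad2_val x = 0 by rewrite /grad2_val e0 T0 expr0n !mulr0 addr0.
split; rewrite /lap2_dens /grad2_dens /grad2_r_dens /grad2_psi_dens /flux_dens ?gn0 ?mul0r //.
- by rewrite /lap_val L0 C0' mulr0 addr0 expr0n mul0r.
- by rewrite g0 mulr0.
Qed.

Lemma vol_ge0 x : 0 <= v x.
Proof.
rewrite /rad /voldens exprn_ge0 // divr_ge0 ?geod_r_ge0 //.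
by rewrite (le_trans _ (psi_ge (geod_r_ge0 x))) // geod_r_ge0.
Qed.

Lemma grad2_val_ge0 x : x != 0 -> 0 <= grad2_val x.
Proof.
move=> x0; apply: addr_ge0; first by rewrite mulr_ge0 // sqr_ge0.
by rewrite mulr_ge0 ?sqr_ge0 // sph_grad2_ge0.
Qed.

Lemma cutoff_at0 k : eta k 0 = 0.
Proof. by rewrite /eta /rad cutoff_near // /geod_r big1 ?sqrtr0 ?mulr0 // => i _; rewrite mxE expr0n. Qed.

Notation I f := (iter_int N f 0).
Notation cut k f := (fun x => cutoff k (geod_r x) * f x).
(** The part of the divergence in which the derivative falls on the cutoff. *)
Definition cut_error k x := geod_r x * dcutoff k (geod_r x) * flux_dens x.

Lemma cut_good_cutoff k f : 0 < k -> C0 f -> (forall x, A < `|x| -> f x = 0) ->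
  ucont (cut k f) /\ vanish A 0 (cut k f).
Proof. by move=> k0 fc lap2_dens; apply: (@cut_good (cutoff k) k f k0 (@continuous_cutoff k) (@cutoff_near k)). Qed.

Lemma cut_error_good k : 0 < k -> ucont (cut_error k) /\ vanish A 0 (cut_error k).
Proof.
move=> k0; have [_ _ _ _ Ec] := dens_C0.
have Ev x : A < `|x| -> flux_dens x = 0 by move=> /dens_vanish[].
apply: (@cut_good (fun t => t * dcutoff k t) k) => //.
- move=> t; apply: cvgM; [exact: cvg_id|exact: continuous_dcutoff].
- by move=> t h; rewrite dcutoff_near // mulr0.
Qed.

(** The Euclidean divergence of v F is v times the Riemannian divergence of F, so the density is
    carried along with the cutoff. *)
Definition cutoff_vol k t := cutoff k t * voldens (N := N) psi t.
Definition dcutoff_vol k t := cutoff k t * dvol (N := N) psi psi1 t + voldens (N := N) psi t * dcutoff k t.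

Lemma D_cutoff_vol k t : 0 < t -> is_derive t 1 (cutoff_vol k) (dcutoff_vol k t).
Proof.
by move=> t0; apply: pdM; [exact: is_derive_cutoff|exact: D_vol].
Qed.

Lemma C0p_domv k : C0p (dcutoff_vol k).
Proof.
have co : C0p (cutoff k) by move=> t _; exact: continuous_cutoff.
have cd : C0p (dcutoff k) by move=> t _; exact: continuous_dcutoff.
have cv : C0p (voldens (N := N) psi) by exact: (is_derive_C0p (D_vol dpsi)).
exact: (C0p_add (C0p_mul co (C0p_dvol dpsi dpsi1)) (C0p_mul cv cd)).
Qed.

Definition cut_div k x := \sum_i pder i (fun y => rad (cutoff_vol k) y * flux psi psi1 u i y) x.

Lemma cut_div_int k : 0 < k ->
  [/\ ucont (cut_div k), vanish A 0 (cut_div k), I (cut_div k) = 0 & cut_div k 0 = 0].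
Proof.
move=> k0; have [d d0 hd] := near0_cut k0.
have Fc i : C1 (fun y => rad (cutoff_vol k) y * flux psi psi1 u i y).
  have h1 : C1 (rad (cutoff_vol k) : V -> R) := C1_rad (@D_cutoff_vol k) (@C0p_domv k).
  have h2 : C1 (flux psi psi1 u i) := flux_C1 dpsi dpsi1 cpsi2 pgt su i.
  exact: (C1_mul h1 h2).
have FA i x : A < `|x| -> rad (cutoff_vol k) x * flux psi psi1 u i x = 0.
  by move=> xA; have [_ _ _ _ ->] := sums_vanish psi psi1 u0 xA; rewrite mulr0.
have Fd i x : `|x| < d -> rad (cutoff_vol k) x * flux psi psi1 u i x = 0.
  by move=> /hd h; rewrite /rad /cutoff_vol cutoff_near // !mul0r.
have [h1 h2 h3] := iter_int_div A0 d0 Fc FA Fd; split => //.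
rewrite /cut_div big1 // => i _; rewrite /pder -(derive_cst (0 : R) (0 : V) (evec R i)).
apply: near_eq_derive.
have : \forall y \near (0:V), `|y| < d.
  by apply/nbhs_normP; exists d => //= y /=; rewrite sub0r normrN.
by apply: filterS => y /(Fd i).
Qed.

Definition cut_rhs k x := cutoff k (geod_r x) * lap2_dens x - ((nr / 2) ^+ 2 * (cutoff k (geod_r x) * grad2_dens x)
  + (1 / 4 * (cutoff k (geod_r x) * grad2_r_dens x) + (N%:R ^+ 2 - 1) / 4 * (cutoff k (geod_r x) * grad2_psi_dens x))) + cut_error k x.

Lemma cut_div_le k x : 0 < k -> cut_div k x <= cut_rhs k x.
Proof.
move=> k0; have [->|x0] := eqVneq x 0.
  (* [pointwise_ineq] excludes the pole, but the cutoff vanishes around it and both sides are 0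
     there. *)
  have [_ _ _ ->] := cut_div_int k0.
  have := cutoff_at0 k; rewrite /eta /rad /cut_rhs /cut_error => ->.
  have -> : geod_r (0 : V) = 0.
    by rewrite /geod_r big1 ?sqrtr0 // => i _; rewrite mxE expr0n.
  by rewrite !mul0r !mulr0 !addr0 subrr.
have r0 := geod_r_gt0 x0.
rewrite /cut_div (div_weighted_flux dpsi dpsi1 cpsi2 pgt su x0 (@D_cutoff_vol k) (@C0p_domv k)).
have E : geod_r x * dcutoff_vol k (geod_r x) = cutoff k (geod_r x) * (nr * (kappa psi psi1 x - 1) * v x)
   + v x * (geod_r x * dcutoff k (geod_r x)).
  rewrite /dcutoff_vol mulrDr mulrCA (t_dvol N5 psi1 pgt r0) /kappa /rad.
  by congr (_ + _); rewrite mulrCA.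
rewrite E.
have := pointwise_ineq su N5 x0 (pgt r0) (psi2_ge r0) (psi1_sq r0).
rewrite -/(lap_val x) -/(grad2_val x) => H.
have ev0 : 0 <= cutoff k (geod_r x) * v x by rewrite mulr_ge0 ?vol_ge0 // theta_ge0.
have := ler_wpM2l ev0 H; rewrite /cut_rhs /cut_error /lap2_dens /grad2_dens /grad2_r_dens /grad2_psi_dens /flux_dens /cutoff_vol.
have -> : voldens (N := N) psi (geod_r x) = v x by [].
move: (div_flux_val _ _ _ _ _) (kappa _ _ _) (flux_rad _ _ _ _) (lap_val x) (grad2_val x) (inv_r x) (inv_psi _ _).
move: (v x) (cutoff k (geod_r x)) (geod_r x * dcutoff k (geod_r x)) => vv o d D kp g l gg rr ss HH.
rewrite -subr_ge0 in HH; rewrite -subr_ge0; apply: le_trans HH _.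
by rewrite le_eqVlt; apply/orP; left; apply/eqP; field.
Qed.

Lemma cut_ineq k : 0 < k ->
  (nr / 2) ^+ 2 * I (cut k grad2_dens) + (1 / 4 * I (cut k grad2_r_dens) + (N%:R ^+ 2 - 1) / 4 * I (cut k grad2_psi_dens))
  <= I (cut k lap2_dens) + I (cut_error k).
Proof.
move=> k0; have [cA cB cC cD _] := dens_C0.
have [uA vA] := cut_good_cutoff k0 cA (fun x h => let: And5 a _ _ _ _ := dens_vanish h in a).
have [uB vB] := cut_good_cutoff k0 cB (fun x h => let: And5 _ a _ _ _ := dens_vanish h in a).
have [uC_ vC] := cut_good_cutoff k0 cC (fun x h => let: And5 _ _ a _ _ := dens_vanish h in a).
have [uD vD] := cut_good_cutoff k0 cD (fun x h => let: And5 _ _ _ a _ := dens_vanish h in a).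
have [uE vE] := cut_error_good k0.
have [uS vS IS _] := cut_div_int k0.
have lin (a b : R) f g : ucont f -> vanish A 0 f -> ucont g -> vanish A 0 g ->
   [/\ ucont (fun y => a * f y + b * g y), vanish A 0 (fun y => a * f y + b * g y) &
     I (fun y => a * f y + b * g y) = a * I f + b * I g].
  move=> fu fv gu gv; split; first exact: ucont_lin.
    by move=> y i i0 hi; rewrite (fv _ _ i0 hi) (gv _ _ i0 hi) !mulr0 addr0.
  exact: (iter_int_lin _ _ _ A0).
have [u1 v1 E1] := lin (1 / 4) ((N%:R ^+ 2 - 1) / 4) _ _ uC_ vC uD vD.
have [u2 v2 E2] := lin ((nr / 2) ^+ 2) 1 _ _ uB vB u1 v1.
have [u3 v3 E3] := lin 1 (-1) _ _ uA vA u2 v2.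
have [u4 v4 E4] := lin 1 1 _ _ u3 v3 uE vE.
have h : I (cut_div k) <= 1 * (1 * I (cut k lap2_dens) + -1 * ((nr / 2) ^+ 2 * I (cut k grad2_dens)
    + 1 * (1 / 4 * I (cut k grad2_r_dens) + (N%:R ^+ 2 - 1) / 4 * I (cut k grad2_psi_dens)))) + 1 * I (cut_error k).
  rewrite -E1 -E2 -E3 -E4; apply: (iter_int_le _ A0) => // y.
  apply: (le_trans (cut_div_le y k0)); rewrite /cut_rhs.
  by rewrite le_eqVlt; apply/orP; left; apply/eqP; ring.
rewrite IS in h; rewrite -subr_ge0; apply: le_trans h _.
move: (I (cut k lap2_dens)) (I (cut k grad2_dens)) (I (cut k grad2_r_dens)) (I (cut k grad2_psi_dens)) (I (cut_error k)) => a b c d e.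
by rewrite le_eqVlt; apply/orP; left; apply/eqP; ring.
Qed.

End Final.

(** * Removing the cutoff *)

Section Limits.
Context {R : realType} {N : nat}.
Notation V := 'rV[R]_N.
Implicit Types (x y : V) (f g : V -> R) (k t : R) (m : nat).
Notation I f := (iter_int N f 0).
Notation cut k f := (fun x => cutoff k (geod_r x) * f x).
(** Squared because [cutoff k] acts at scale k^(-1/2): the m-th cutoff acts at scale 1 / (m + 1). *)
Notation sq_succ m := (m.+1%:R ^+ 2 : R).

Lemma sq_succ_gt0 m : 0 < sq_succ m. Proof. by rewrite exprn_gt0. Qed.

Lemma geod_r0 : geod_r (0 : V) = 0.
Proof. by rewrite /geod_r big1 ?sqrtr0 // => i _; rewrite mxE expr0n. Qed.

(** [f] is a closed form whose continuity off the origin is known, [F] the integrand of the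
    statement; they need only agree off the origin. *)
Lemma lim_cut (A : R) f F : (0 < N)%N -> 0 <= A -> C0 f ->
  (forall x, A < `|x| -> f x = 0) -> (forall x, x != 0 -> 0 <= f x) ->
  (forall x, x != 0 -> f x = F x) ->
  (forall m, 0 <= I (cut (sq_succ m) f)) /\
  (I (cut (sq_succ m) f))%:E @[m --> \oo] --> iint N (EFin \o F) 0.
Proof.
move=> N0 A0 fc lap2_dens f0 fF.
have g0 m x : 0 <= cutoff (sq_succ m) (geod_r x) * f x.
  have [->|x0] := eqVneq x 0; first by rewrite geod_r0 cutoff_near ?mulr0 // mul0r.
  by rewrite mulr_ge0 ?theta_ge0 // f0.
have uv m := cut_good_cutoff A0 (sq_succ_gt0 m) fc lap2_dens.
split=> [m|].
  rewrite -(@iter_int0 R N N 0); apply: (iter_int_le _ A0) => //.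
  - exact: ucont0.
  - exact: (uv m).1.
  - exact: (uv m).2.
apply: (@iint_lim R N F (fun m => cut (sq_succ m) f) A) => //.
- by move=> m; exact: (uv m).1.
- by move=> m; exact: (uv m).2.
- move=> m x; have [->|x0] := eqVneq x 0; first by rewrite geod_r0 !cutoff_near ?mulr0 // mul0r.
  rewrite ler_wpM2r ?f0 // cutoff_nd // lerXn2r ?nnegrE ?ler0n // ler_nat.
  exact: ltnW.
move=> x x0; have r0 := geod_r_gt0 x0.
pose q := 2 / geod_r x ^+ 2.
exists (Num.bound q) => //= m qm.
rewrite -(fF x x0) /cutoff theta1 ?mul1r // -mulrA -expr2.
have q0 : 0 <= q by rewrite divr_ge0 // sqr_ge0.
have h1 : q < m.+1%:R.
  apply: (lt_le_trans (archi_boundP q0)); rewrite ler_nat; exact: leqW.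
have h2 : q <= sq_succ m.
  apply: (le_trans (ltW h1)); rewrite expr2 ler_peMr //.
  by rewrite -[leLHS]/(1%:R) ler_nat.
by rewrite -ler_pdivrMr ?exprn_gt0.
Qed.

End Limits.

Section Error.
Context {R : realType} {N : nat}.
Notation V := 'rV[R]_N.
Implicit Types (x y : V) (m : nat).
Hypothesis N3 : (3 <= N)%N.
Variables psi psi1 : R -> R.
Variable u : V -> R.
Notation sq_succ m := (m.+1%:R ^+ 2 : R).

(** With M = m + 1, the error lives on the shell 1 < M^2 r^2 < 2. There r^(-2) < M^2, so it is at
    most 8 K M^2, and the shell lies in a cube of side 4 / M. *)
Lemma cut_error_bound (Lam : R) : 2 <= Lam -> Ob Lam (-2) (flux_dens psi psi1 u) ->
  (forall k, 0 < k -> ucont (cut_error psi psi1 u k)) ->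
  exists K : R, forall m, `|iter_int N (cut_error psi psi1 u (sq_succ m)) 0| <= K * m.+1%:R^-1.
Proof.
move=> L2 [K K0 hK] uE; exists (8 * K * 4 ^+ N) => m.
pose M : R := m.+1%:R; have M1 : 1 <= M by rewrite /M -[leLHS]/(1%:R) ler_nat.
have M0 : 0 < M by apply: lt_le_trans M1.
have bd y : `|cut_error psi psi1 u (sq_succ m) y| <= 8 * K * M ^+ 2.
  have pos : 0 <= 8 * K * M ^+ 2 by rewrite mulr_ge0 ?sqr_ge0 // mulr_ge0.
  have [->|y0] := eqVneq y 0; first by rewrite /cut_error geod_r0 !mul0r normr0.
  have r0 := geod_r_gt0 y0; rewrite /cut_error -/M.
  have [h1|h1] := leP (M ^+ 2 * geod_r y * geod_r y) 1.
    by rewrite dcutoff_near // mulr0 mul0r normr0.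
  have [h2|h2] := leP 2 (M ^+ 2 * geod_r y * geod_r y).
    by rewrite dcutoff_far // mulr0 mul0r normr0.
  (* As M >= 1, every shell lies in r <= 2, where the order estimate is valid. *)
  have rL : geod_r y <= Lam.
    apply: le_trans L2; rewrite leNgt; apply/negP => h3.
    have h4 : geod_r y * geod_r y <= M ^+ 2 * geod_r y * geod_r y.
      by rewrite ler_wpM2r ?(ltW r0) // ler_peMl ?(ltW r0) // exprn_ege1.
    have h5 : 2 * 2 < geod_r y * geod_r y by apply: ltr_pM.
    by have := lt_trans (lt_le_trans h5 h4) h2; rewrite -natrM ltr_nat.
  rewrite normrM -mulrA; apply: ler_pM => //; first by apply: t_dcutoff_le; exact: sqr_ge0.
  apply: (le_trans (hK y y0 rL)); rewrite ler_wpM2l //.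
  have -> : geod_r y ^ (-2) = (geod_r y ^+ 2)^-1 by [].
  rewrite -[leRHS]mul1r -ler_pdivrMr ?exprn_gt0 //.
  rewrite -invfM -[leRHS]invr1 lef_pV2 ?posrE ?mulr_gt0 ?exprn_gt0 //.
  by rewrite mulrC expr2 mulrA ltW.
have A0 : 0 <= 2 / M by rewrite divr_ge0 // ltW.
have va : vanish (2 / M) 0 (cut_error psi psi1 u (sq_succ m)).
  move=> y i _ hi; rewrite /cut_error dcutoff_far ?mulr0 ?mul0r // -/M.
  have h1 := lt_le_trans hi (coord_le_r y i).
  have h2 : 2 < geod_r y * M by rewrite -ltr_pdivrMr.
  have -> : M ^+ 2 * geod_r y * geod_r y = (geod_r y * M) * (geod_r y * M) by ring.
  have h3 : 2 * 2 < (geod_r y * M) * (geod_r y * M) by apply: ltr_pM.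
  by rewrite (le_trans _ (ltW h3)) // -natrM ler_nat.
apply: (le_trans (iter_int_bound 0 A0 (uE _ (sq_succ_gt0 m)) va (leqnn N) bd)).
have -> : (2 * (2 / M)) ^+ N = 4 ^+ N * M^-1 ^+ N.
  by rewrite mulrA -natrM exprMn.
have -> : 8 * K * M ^+ 2 * (4 ^+ N * M^-1 ^+ N) = 8 * K * 4 ^+ N * (M ^+ 2 * M^-1 ^+ N) by ring.
rewrite ler_wpM2l //; first by rewrite mulr_ge0 ?exprn_ge0 // mulr_ge0.
(* M^(2 - N) = M^(-1) M^(-(N - 3)), and the last factor is at most 1 since N >= 3. *)
have -> : N = (N - 3 + 3)%N by rewrite subnK.
rewrite exprD -/M.
have -> : M ^+ 2 * (M^-1 ^+ (N - 3) * M^-1 ^+ 3) = M^-1 * M^-1 ^+ (N - 3).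
  by move: (M^-1 ^+ (N - 3)) => z; field; rewrite gt_eqF.
rewrite ler_piMr ?invr_ge0 ?(ltW M0) // exprn_ile1 ?invr_ge0 ?(ltW M0) //.
by rewrite invf_le1.
Qed.

End Error.

Theorem theorem2p11 (R : realType) (N : nat) (psi : R -> R) :
  (5 <= N)%N ->
  (forall (n : nat) (t : R), derivable (derive1n n psi) t 1) ->
  (forall t : R, 0 <= t -> 0 <= psi t) ->
  (forall t : R, 0 < t -> 0 < psi t) ->
  derive1n 1 psi 0 = 1 ->
  (forall k : nat, derive1n (2 * k) psi 0 = 0) ->
  (forall r : R, 0 < r -> K_rad psi r <= -1) ->
  (forall r : R, 0 < r -> H_tan psi r <= K_rad psi r) ->
  forall u : 'rV[R]_N -> R, Cc_infty u ->
  (int_M psi (fun x => (lap_g psi u x ^+ 2)%R)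
     - (((N%:R - 1) / 2) ^+ 2)%:E * int_M psi (grad_norm2 psi u)
   >= (1 / 4)%:E * int_M psi (fun x => (grad_norm2 psi u x / geod_r x ^+ 2)%R)
      + ((N%:R ^+ 2 - 1) / 4)%:E * int_M psi (fun x => (grad_norm2 psi u x / psi (geod_r x) ^+ 2)%R))%E.
Proof.
move=> N5 smooth_psi _ psi_gt0 psi'0 psi_even K_le H_le u [su [A' u0']].
pose A := Num.max A' 0.
have A0 : 0 <= A by rewrite le_max lexx orbT.
have u0 (x : 'rV[R]_N) : A < `|x| -> u x = 0 by rewrite gt_max => /andP[/u0'].
pose psi1 := derive1n 1 psi; pose psi2 := derive1n 2 psi.
have dpsi (t : R) : 0 < t -> is_derive t 1 psi (psi1 t) by move=> _; exact: (D_psi smooth_psi 0).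
have dpsi1 (t : R) : 0 < t -> is_derive t 1 psi1 (psi2 t) by move=> _; exact: (D_psi smooth_psi 1).
have cpsi2 : C0p psi2 by move=> t _; exact: (cont_psi smooth_psi (n := 2)).
have pge := psi_ge smooth_psi psi_gt0 psi'0 psi_even K_le.
have p2ge := psi2_ge psi_gt0 K_le.
have p1sq := psi1_sq_ge psi_gt0 H_le.
have n5 : 5 <= N%:R :> R by rewrite (ler_nat R 5).
have NA0 : 0 <= N%:R * A by rewrite mulr_ge0.
(* The 2 covers the shells of the cutoffs; N A covers the support of u, on which the sup norm is at
   most A and hence r <= N A. *)
pose Lam := 2 + N%:R * A.
have L2 : 2 <= Lam by rewrite /Lam lerDl.
have L1 : 1 <= Lam by apply: le_trans L2; rewrite ler1n.
have [M M0 hM] := psi_bounds smooth_psi psi_even (le_trans ler01 L1).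
have psi_le (t : R) : 0 <= t <= Lam -> psi t <= M * t by move=> /hM[].
have psi1_le (t : R) : 0 <= t <= Lam -> `|psi1 t| <= M.
  move=> tL; have [_ h] := hM t tL; rewrite ger0_norm //.
  have /andP[t0 _] := tL.
  exact: le_trans ler01 (psi1_ge1 smooth_psi psi_gt0 psi'0 psi_even K_le t0).
have obG : Ob Lam (-2) (flux_dens psi psi1 u).
  have h1 := Ob_vol (N := N) M0 pge psi_le.
  have h2 := Ob_flux_rad L1 M0 pge psi1_le su A0 u0.
  exact: (Ob_mul h1 h2).
have [KB KB0 hKB] : Ob Lam 0 (grad2_dens psi u) by exact: (Ob_grad M0 pge psi_le su A0 u0).
have [K hK] := cut_error_bound (leq_trans (isT : 3 <= 5)%N N5) L2 obG
  (fun k k0 => (cut_error_good dpsi dpsi1 cpsi2 pge su A0 u0 k0).1).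
have N0 : (0 < N)%N by apply: leq_trans N5.
have [cA cB cC cD _] := dens_C0 dpsi dpsi1 cpsi2 pge su.
have van (x : 'rV[R]_N) : A < `|x| -> _ := dens_vanish psi psi1 u0 (x := x).
have gge (x : 'rV[R]_N) : x != 0 -> 0 <= grad2_val psi u x := grad2_val_ge0 psi u (x := x).
have v0 (x : 'rV[R]_N) := vol_ge0 (N := N) pge x.
have vE (x : 'rV[R]_N) : x != 0 -> vol_density psi x = rad (voldens (N := N) psi) x.
  by move=> x0; exact: (vol_densityE N5 psi_gt0 x0).
have gE (x : 'rV[R]_N) : x != 0 -> grad_norm2 psi u x = grad2_val psi u x.
  by move=> x0; exact: (grad_norm2E psi_gt0 u x0).
have lE (x : 'rV[R]_N) : x != 0 -> lap_g psi u x = lap_val psi psi1 u x.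
  by move=> x0; exact: (lap_gE N5 dpsi dpsi1 psi_gt0 su x0).
have [a0 aA] := lim_cut (F := fun x => lap_g psi u x ^+ 2 * vol_density psi x) N0 A0 cA
  (fun x h => let: And5 a _ _ _ _ := van x h in a)
  (fun x _ => mulr_ge0 (sqr_ge0 _) (v0 x))
  (fun x x0 => etrans (erefl _) (esym (congr2 (fun a b => a ^+ 2 * b) (lE x x0) (vE x x0)))).
have [b0 bB] := lim_cut (F := fun x => grad_norm2 psi u x * vol_density psi x) N0 A0 cB
  (fun x h => let: And5 _ a _ _ _ := van x h in a)
  (fun x x0 => mulr_ge0 (gge x x0) (v0 x))
  (fun x x0 => esym (congr2 (fun a b => a * b) (gE x x0) (vE x x0))).
have eC (x : 'rV[R]_N) : x != 0 ->
    grad2_r_dens psi u x = grad_norm2 psi u x / geod_r x ^+ 2 * vol_density psi x.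
  by move=> x0; rewrite gE // vE // /grad2_r_dens /inv_r /rad exprVn.
have eD (x : 'rV[R]_N) : x != 0 ->
    grad2_psi_dens psi u x = grad_norm2 psi u x / psi (geod_r x) ^+ 2 * vol_density psi x.
  by move=> x0; rewrite gE // vE // /grad2_psi_dens /inv_psi /rad exprVn.
have [c0 cC'] := lim_cut (F := fun x => grad_norm2 psi u x / geod_r x ^+ 2 * vol_density psi x) N0 A0 cC
  (fun x h => let: And5 _ _ a _ _ := van x h in a)
  (fun x x0 => mulr_ge0 (mulr_ge0 (gge x x0) (sqr_ge0 _)) (v0 x)) eC.
have [d0 dD] := lim_cut (F := fun x => grad_norm2 psi u x / psi (geod_r x) ^+ 2 * vol_density psi x) N0 A0 cD
  (fun x h => let: And5 _ _ _ a _ := van x h in a)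
  (fun x x0 => mulr_ge0 (mulr_ge0 (gge x x0) (sqr_ge0 _)) (v0 x)) eD.
(* A bound uniform in m: it makes the integral of |grad_g u|^2 finite, as the subtraction in the
   statement requires. *)
have bM m : iter_int N (fun x => cutoff (m.+1%:R ^+ 2) (geod_r x) * grad2_dens psi u x) 0 <= KB * (2 * A) ^+ N.
  have [uB vB] := cut_good_cutoff A0 (sq_succ_gt0 m) cB (fun x h => let: And5 _ a _ _ _ := van x h in a).
  apply: le_trans (ler_norm _) _.
  apply: (iter_int_bound 0 A0 uB vB (leqnn N)) => x.
  have [->|x0] := eqVneq x 0; first by rewrite geod_r0 cutoff_near ?mulr0 // mul0r normr0.
  have [xA|xA] := leP `|x| A; last first.
    by have [_ -> _ _ _] := van x xA; rewrite mulr0 normr0.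
  have xL : geod_r x <= Lam.
    apply: (@le_trans _ _ (N%:R * A)); last by rewrite /Lam lerDr.
    rewrite -(ler_pXn2r (ltn0Sn 1)) ?nnegrE ?geod_r_ge0 // geod_r2.
    apply: le_trans (sqn_le_norm x) _; rewrite exprMn ler_pM ?sqr_ge0 //.
      by rewrite expr2 ler_peMr // ler1n.
    by rewrite lerXn2r ?nnegrE.
  have h := hKB x x0 xL; rewrite expr0z mulr1 in h.
  have o0 : 0 <= cutoff (m.+1%:R ^+ 2) (geod_r x) by exact: theta_ge0.
  have o1 : cutoff (m.+1%:R ^+ 2) (geod_r x) <= 1 by exact: theta_le1.
  apply: (le_trans _ h).
  by rewrite [leLHS]normrM (ger0_norm o0) ler_piMl.
apply: (ereal_limit_ineq (K := K) _ _ _ b0 c0 d0 aA bB cC' dD bM).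
- exact: sqr_ge0.
- by rewrite divr_ge0.
- by rewrite divr_ge0 // subr_ge0; move: (N%:R : R) n5 => n h; nra.
move=> m.
apply: le_trans (cut_ineq N5 dpsi dpsi1 cpsi2 pge p2ge p1sq su A0 u0 (sq_succ_gt0 m)) _.
by rewrite lerD2l (le_trans (ler_norm _)).
Qed.
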